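(* Let $b:\mathbb{R}\to(0,+\infty)$ be continuous and increasing (in the non-strict sense), with finite limits $b_{\pm}=\lim_{x\to\pm\infty}b(x)$ satisfying $0<b_-<b_+$. Assume that there is $x_\infty\in\mathbb{R}$ such that $b(x)=b_+$ for all $x\ge x_\infty$ and $b(x)<b_+$ for all $x<x_\infty$. Let $a(x)=\int_0^x b(t)\,\mathrm{d}t$, $a_\infty=a(x_\infty)$, $\Lambda_n=2n-1$, and $t_k=\dfrac{a_\infty-k}{b_+^{1/2}}$. For $k\in\mathbb{R}$ and $n\ge 1$ let $E_n(k)$ be the $n$-th eigenvalue (in increasing order) of the operator $\mathfrak{h}(k)=-\partial_x^2+(a(x)-k)^2$ acting in $L^2(\mathbb{R})$. Let $n\geq 1$ be an integer. (i) Assume that the contact at $x_\infty$ is of finite order $p\ge 1$. Then, as $k\to+\infty$, $$E_n(k)=b_+\Lambda_n+C(n,p,b_+)\,b^{(p)}(x_\infty^-)\,k^{2n-p-3}e^{-t_k^2}+o\big(k^{2n-p-3}e^{-t_k^2}\big),$$ where $$C(n,p,b_+)=(-1)^p\,\frac{2^{n-p-2}}{\sqrt{\pi}\,(n-1)!\,b_+^{\,n-\frac32}}.$$ (ii) Assume that the contact at $x_\infty$ is of order $\infty$. Then, as $k\to+\infty$, $$e^{t_k^2}\big(E_n(k)-b_+\Lambda_n\big)=o(k^{-\infty}).$$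
   Context: For each $k\in\mathbb{R}$, $\mathfrak{h}(k)=-\partial_x^2+(a(x)-k)^2$ is a positive self-adjoint operator in $L^2(\mathbb{R})$ with compact resolvent and simple eigenvalues; $E_1(k)<E_2(k)<\cdots$ denotes the increasing sequence of its eigenvalues. (These are the band functions of the Iwatsuka magnetic Laplacian $-\partial_x^2+(-i\partial_y-a(x))^2$ in $L^2(\mathbb{R}^2)$.) Order of contact: for an integer $p\ge1$, the contact at $x_\infty$ is of order $p$ if $b$ is $C^p$ on $(-\infty,x_\infty)$, with derivatives having limits from the left $b^{(j)}(x_\infty^-):=\lim_{x\to x_\infty,\,x<x_\infty}b^{(j)}(x)$, $1\le j\le p$, such that $b^{(j)}(x_\infty^-)=0$ for all $j=1,\dots,p-1$ and $b^{(p)}(x_\infty^-)\neq0$. The contact is of order $\infty$ if $b$ is $C^\infty$ on $(-\infty,x_\infty)$ and $b^{(j)}(x_\infty^-)=0$ for all integers $j\ge1$. The notation $f(k)=o(k^{-\infty})$ as $k\to+\infty$ means $f(k)=o(k^{-N})$ for every $N\in\mathbb{N}$. *)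

(* Defs.v *)
From HB Require Import structures.
From mathcomp Require Import all_boot all_order all_algebra.
From mathcomp Require Import complex.
From mathcomp Require Import all_classical all_reals all_analysis.

Set Implicit Arguments.
Unset Strict Implicit.
Unset Printing Implicit Defensive.

Import Order.TTheory GRing.Theory Num.Theory.
Import numFieldNormedType.Exports.

Local Open Scope classical_set_scope.
Local Open Scope ring_scope.

(* Lets the little-o notations be used at +oo. *)
Canonical pinfty_filter_on (R : numFieldType) : filter_on R :=
  FilterType (pinfty_nbhs R) _.

Definition oriented_integral (R : realType) (f : R -> R) (x y : R) : R :=
  if x <= y then \int[lebesgue_measure]_(t in `[x, y]) f t
  else - \int[lebesgue_measure]_(t in `[y, x]) f t.

(* u is locally absolutely continuous, with almost everywhere derivative v *)
Definition is_AC_primitive (R : realType) (u v : R -> R) : Prop :=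
  locally_integrable [set: R] v /\
  forall x y : R, u y - u x = oriented_integral v x y.

Definition in_L2 (R : realType) (u : R -> R) : Prop :=
  u \in Lfun (@lebesgue_measure R) 2%:E.

(* Graph, on real-valued functions, of the operator - d^2/dx^2 + V of L^2(R) on
   its maximal domain { u in L^2 | u and u' locally absolutely continuous,
   - u'' + V u in L^2 }. For V continuous and bounded below this is the unique
   self-adjoint realization. An element of the domain is given by its
   continuous representative; the image f matters up to a null set only. *)
Definition schrodinger_graph_real (R : realType) (V u f : R -> R) : Prop :=
  [/\ in_L2 u, in_L2 f &
      exists u' u'' : R -> R,
        [/\ is_AC_primitive u u',
            is_AC_primitive u' u'' &
            {ae lebesgue_measure, forall x, f x = - u'' x + V x * u x}]].

(* The operator on the complex space L^2(R): V is real-valued, so it acts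
   separately on real and imaginary parts. *)
Definition schrodinger_graph (R : realType) (V : R -> R) (u f : R -> R[i]) :
    Prop :=
  schrodinger_graph_real V (fun x => complex.Re (u x))
                           (fun x => complex.Re (f x)) /\
  schrodinger_graph_real V (fun x => complex.Im (u x))
                           (fun x => complex.Im (f x)).

Definition is_eigenvalue (R : realType) (V : R -> R) (lambda : R) : Prop :=
  exists u : R -> R[i],
    ~ {ae lebesgue_measure, forall x, u x = 0} /\
    schrodinger_graph V u (fun x => lambda%:C%C * u x).

(* The terms are indexed from 1; e 0 is irrelevant. *)
Definition is_eigenvalue_sequence (R : realType) (V : R -> R) (e : nat -> R) :
    Prop :=
  (forall m n : nat, (0 < m)%N -> (m < n)%N -> e m < e n) /\
  (forall lambda : R,
     is_eigenvalue V lambda <-> exists2 n : nat, (0 < n)%N & lambda = e n).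

Definition iwatsuka_a (R : realType) (b : R -> R) (x : R) : R :=
  oriented_integral b 0 x.

Definition iwatsuka_potential (R : realType) (b : R -> R) (k x : R) : R :=
  (iwatsuka_a b x - k) ^+ 2.

(* Only meaningful when the limit exists, as required by the contact
   hypotheses. *)
Definition left_derivative_limit (R : realType) (b : R -> R) (j : nat)
    (x0 : R) : R :=
  lim ((b^`(j))%classic x @[x --> x0^'-]).

Definition contact_of_order (R : realType) (b : R -> R) (x0 : R) (p : nat) :
    Prop :=
  [/\ (0 < p)%N,
      forall (j : nat) (x : R),
        (j < p)%N -> x < x0 -> derivable (b^`(j))%classic x 1,
      forall x : R, x < x0 -> {for x, continuous (b^`(p))%classic},
      forall j : nat, (0 < j <= p)%N -> cvg ((b^`(j))%classic x @[x --> x0^'-]) &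
      (forall j : nat, (0 < j < p)%N -> left_derivative_limit b j x0 = 0) /\
      left_derivative_limit b p x0 <> 0].

Definition contact_of_infinite_order (R : realType) (b : R -> R) (x0 : R) :
    Prop :=
  (forall (j : nat) (x : R), x < x0 -> derivable (b^`(j))%classic x 1) /\
  (forall j : nat, (0 < j)%N -> (b^`(j))%classic x @[x --> x0^'-] --> (0 : R)).

Definition Landau_level (R : realType) (n : nat) : R := 2 * n%:R - 1.

Definition contact_constant (R : realType) (n p : nat) (bp : R) : R :=
  (-1) ^+ p * ((2 : R) ^ (n%:Z - p%:Z - 2) /
    (Num.sqrt pi * (n.-1)`!%:R * bp `^ (n%:R - 3 / 2))).

(* Main.v *)
Require Import Defs.
From mathcomp Require Import all_boot all_order all_algebra.
From mathcomp Require Import complex.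
From mathcomp Require Import all_classical all_reals all_analysis.
From mathcomp Require Import measurable_realfun.
From mathcomp Require Import ring lra zify.

Set Implicit Arguments.
Unset Strict Implicit.
Unset Printing Implicit Defensive.

Import Order.TTheory GRing.Theory Num.Theory.
Import numFieldNormedType.Exports.

Local Open Scope classical_set_scope.
Local Open Scope ring_scope.

(** In the variable [y = sqrt bp * (x - x_inf) + t], where
    [t = (a x_inf - k) / sqrt bp], the operator divided by [bp] becomes
    [- d^2/dy^2 + (y + g (t - y)) ^+ 2]. The function [g] is the deviation of
    [a], at a given scaled distance to the left of [x_inf], from its linear
    continuation; it does not depend on [k], vanishes on the negative half-line
    and satisfies [0 <= g' <= 1]. As [k] tends to [+oo], [t] tends to [-oo]: the
    potential is [y ^+ 2] to the right of [t] and at least [t ^+ 2] to the left.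
    The eigenvalues therefore approach those of the harmonic oscillator, the
    odd integers, and what remains is the size of the correction.

    Let [u] be the eigenfunction for an eigenvalue [l] near [2 m + 1] and [phi]
    the [m]-th Hermite function. Integrating the derivative of their Wronskian
    gives the exact identity
      [(l - (2 m + 1)) * \int u phi = \int (q - y ^+ 2) u phi]
    ([energy_shift]), in which the perturbation [q - y ^+ 2] is
    [g (t - y) * (2 y + g (t - y))], supported to the left of [t]. On the left
    of [t] the product [u phi] behaves like its value at [t] times
    [expR (- 2 |t| (t - y))], by Riccati comparison of the logarithmic slopes
    ([product_slopes]); the ratio [u / phi] at [t] tends to [1] ([ratio_close]),
    and [\int u phi] tends to [\int phi ^+ 2 = 2 ^+ m * m! * sqrt pi]
    ([overlap_total]). If [g d] is equivalent to [B d ^+ Q] at [0], Laplace's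
    method ([weighted_upper], [weighted_lower]) yields
      [l - (2 m + 1) ~ - B Q! (2 |t|) ^- Q phi(t) ^+ 2 / (2 ^+ m m! sqrt pi)],
    which is [scaled_asymptotics]; here [phi(t) ^+ 2] is equivalent to
    [(2 t) ^+ (2 m) * expR (- t ^+ 2)]. Contact of order [p] means that
    [b - bp], hence after one integration [g], has a one-term Taylor expansion
    from the left ([left_taylor_derivatives], [deviation_taylor]), with
    [Q = p + 1]; contact of infinite order gives [B = 0] for every [Q].

    All of this is done with ordinary differential equations. Square-integrable
    eigenfunctions are bounded classical solutions and conversely
    ([affine_eigenvalue]). For every energy one follows the solution decaying at
    [+oo], which is either an eigenfunction or escapes on the left. By
    compactness, eigenvalues of the perturbed problem can only occur near the
    odd integers ([eigenlevels_near_levels]); orthogonality allows at most one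
    near each ([level_unique]); and since the sign of the escaping solution
    changes across each odd integer ([level_crossing]), there is at least one
    ([level_exists]). This identifies the [n]-th eigenvalue with the one near
    [2 n - 1] ([nth_level_close]). *)

(** * Calculus of everywhere differentiable functions *)

Definition has_deriv (R : realType) (f df : R -> R) : Prop :=
  forall x : R, is_derive x 1 f (df x).

Section Calculus.
Context {R : realType}.
Implicit Types (f g df dg : R -> R) (a b x y : R).

Lemma der_cst (c x : R) : is_derive x 1 (fun _ => c) 0.
Proof. exact: is_derive_cst. Qed.

Lemma der_id (x : R) : is_derive x 1 (fun y : R => y) 1.
Proof. exact: is_derive_id. Qed.

Lemma der_add f g x a b :
  is_derive x 1 f a -> is_derive x 1 g b ->
  is_derive x 1 (fun y => f y + g y) (a + b).
Proof. by move=> fa gb; apply: is_deriveD. Qed.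

Lemma der_opp f x a :
  is_derive x 1 f a -> is_derive x 1 (fun y => - f y) (- a).
Proof. by move=> fa; apply: is_deriveN. Qed.

Lemma der_mul f g x a b :
  is_derive x 1 f a -> is_derive x 1 g b ->
  is_derive x 1 (fun y => f y * g y) (a * g x + f x * b).
Proof.
move=> fa gb; have := @is_deriveM _ _ f g x 1 a b fa gb.
by move=> /is_derive_eq; apply; rewrite addrC /GRing.scale/= mulrC.
Qed.

Lemma der_comp f g x a b :
  is_derive (g x) 1 f a -> is_derive x 1 g b ->
  is_derive x 1 (fun y => f (g y)) (a * b).
Proof. by move=> fa gb; exact: (is_derive1_comp fa gb). Qed.

Lemma der_exp f x a :
  is_derive x 1 f a ->
  is_derive x 1 (fun y => expR (f y)) (expR (f x) * a).
Proof. by move=> fa; exact: (der_comp (is_derive_expR _) fa). Qed.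

Lemma der_pow f x a (n : nat) :
  is_derive x 1 f a ->
  is_derive x 1 (fun y => f y ^+ n) (n%:R * f x ^+ n.-1 * a).
Proof.
move=> fa; elim: n => [|n IH]; first by rewrite !mul0r; exact: der_cst.
have -> : (fun y => f y ^+ n.+1) = (fun y => f y * f y ^+ n).
  by apply/funext => y; rewrite exprS.
apply: is_derive_eq (der_mul fa IH) _.
case: n {IH} => [|n] /=; first by rewrite !mul0r mulr0 !expr0; ring.
by rewrite exprS -[n.+2%:R]natr1; ring.
Qed.

Lemma der_inv f x a :
  f x != 0 -> is_derive x 1 f a ->
  is_derive x 1 (fun y => (f y)^-1) (- a / f x ^+ 2).
Proof.
move=> fx0 [df dfa].
have dV := @derivableV _ _ f x 1 fx0 df.
apply: DeriveDef; first exact: dV.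
rewrite deriveV // dfa; have -> : forall x1 x2 : R, x1 *: (x2 : R^o) = x1 * x2 by [].
by rewrite mulNr mulNr [X in - X]mulrC.
Qed.

End Calculus.

(** Differentiates a term built from constants, the variable, ring
    operations, powers, exponentials and functions whose derivative is given
    by a hypothesis. *)
Ltac der := match goal with
  | |- is_derive _ _ (fun _ => ?c) _ => exact: der_cst
  | |- is_derive _ _ (fun y => y) _ => exact: der_id
  | |- is_derive _ _ (fun y => _ + _) _ => notypeclasses refine (der_add _ _); der
  | |- is_derive _ _ (fun y => - _) _ => notypeclasses refine (der_opp _); der
  | |- is_derive _ _ (fun y => _ * _) _ => notypeclasses refine (der_mul _ _); der
  | |- is_derive _ _ (fun y => _ ^+ _) _ => notypeclasses refine (der_pow _ _); der
  | |- is_derive _ _ (fun y => expR _) _ => notypeclasses refine (der_exp _); der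
  | H : has_deriv ?f _ |- is_derive _ _ (fun y => ?f y) _ => exact: H
  | H : has_deriv ?f _ |- is_derive _ _ ?f _ => exact: H
  | H : has_deriv ?f _ |- is_derive _ _ (fun y => ?f _) _ =>
      notypeclasses refine (der_comp _ _); [exact: H | der]
  | |- is_derive _ _ (fun y => (_)^-1) _ => notypeclasses refine (der_inv _ _); [ | der]
  | |- is_derive ?x ?v ?f ?d =>
      lazymatch f with
      | (fun _ => _) => fail
      | _ => change (is_derive x v (fun z => f z) d); der
      end
  | |- _ => idtac
  end.

Ltac derive := notypeclasses refine (is_derive_eq _ _); [der | cbv beta].

Section CalculusConsequences.
Context {R : realType}.
Implicit Types (f g df dg : R -> R) (a b x y : R).

Lemma has_deriv_continuous f df : has_deriv f df -> continuous f.
Proof.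
move=> fd x; apply: differentiable_continuous; apply/derivable1_diffP.
by have := fd x => -[].
Qed.

Lemma mean_value_on f df a b : a <= b ->
  (forall x, a <= x <= b -> is_derive x 1 f (df x)) ->
  exists2 c : R, a <= c <= b & f b - f a = df c * (b - a).
Proof.
move=> ab fd.
have fd' x : x \in `]a, b[ -> is_derive x 1 f (df x).
  by rewrite in_itv/= => /andP[/ltW ax /ltW xb]; apply: fd; rewrite ax.
have cf : {within `[a, b], continuous f}.
  apply: derivable_within_continuous => x; rewrite in_itv/= => /fd.
  by move=> [].
have [c] := MVT_segment ab fd' cf.
by rewrite in_itv/= => cab e; exists c.
Qed.

Lemma mean_value f df a b : has_deriv f df -> a <= b ->
  exists2 c : R, a <= c <= b & f b - f a = df c * (b - a).
Proof. by move=> fd ab; apply: mean_value_on. Qed.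

Lemma deriv_ge0_le_on f df a b : a <= b ->
  (forall x, a <= x <= b -> is_derive x 1 f (df x)) ->
  (forall x, a <= x <= b -> 0 <= df x) -> f a <= f b.
Proof.
move=> ab fd h; have [c cab e] := mean_value_on ab fd.
by rewrite -subr_ge0 e mulr_ge0 ?subr_ge0 ?h.
Qed.

Lemma deriv_ge0_le f df a b : has_deriv f df -> a <= b ->
  (forall x, a <= x <= b -> 0 <= df x) -> f a <= f b.
Proof.
move=> fd ab h; have [c cab e] := mean_value fd ab.
by rewrite -subr_ge0 e mulr_ge0 ?subr_ge0 ?h.
Qed.

Lemma deriv_le0_ge f df a b : has_deriv f df -> a <= b ->
  (forall x, a <= x <= b -> df x <= 0) -> f b <= f a.
Proof.
move=> fd ab h; have [c cab e] := mean_value fd ab.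
by rewrite -subr_le0 e mulr_le0_ge0 ?subr_ge0 ?h.
Qed.

Lemma deriv_eq0_eq f df a b : has_deriv f df -> a <= b ->
  (forall x, a <= x <= b -> df x = 0) -> f a = f b.
Proof.
move=> fd ab h; have [c cab e] := mean_value fd ab.
by apply/eqP; rewrite eq_sym -subr_eq0 e h ?mul0r.
Qed.

(** The comparison principle behind all barrier arguments below. *)
Lemma deriv_le_sub f df g dg a b : has_deriv f df -> has_deriv g dg -> a <= b ->
  (forall x, a <= x <= b -> df x <= dg x) -> f b - f a <= g b - g a.
Proof.
move=> fd gd ab h.
have gfd : has_deriv (fun x => g x - f x) (fun x => dg x - df x).
  by move=> x; der.
suff : g a - f a <= g b - f b by lra.
by apply: deriv_ge0_le gfd ab _ => x xab; rewrite subr_ge0 h.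
Qed.

Lemma increment_dominated f df g dg a b : has_deriv f df -> has_deriv g dg -> a <= b ->
  (forall x, a <= x <= b -> `|df x| <= dg x) -> `|f b - f a| <= g b - g a.
Proof.
move=> fd gd ab h; have nfd : has_deriv (fun x => - f x) (fun x => - df x) by move=> x; der.
have := deriv_le_sub fd gd ab (fun x xab => le_trans (ler_norm _) (h x xab)).
have : - f b - - f a <= g b - g a.
  apply: (deriv_le_sub nfd gd ab) => x /h; apply: le_trans.
  by rewrite -normrN ler_norm.
by rewrite ler_norml => ? ?; apply/andP; split; lra.
Qed.

Lemma zero_between f a b : continuous f -> a <= b ->
  f a * f b <= 0 -> exists2 c, a <= c <= b & f c = 0.
Proof.
move=> cf ab fab.
have cfw : {within `[a, b], continuous f}.
  by apply: continuous_subspaceT => x; exact: cf.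
have [|c] := @IVT R f a b 0 ab cfw; last first.
  by rewrite in_itv/= => cab fc; exists c.
rewrite ge_min le_max.
have [fa|fa] := leP (f a) 0; have [fb|fb] := leP (f b) 0; rewrite /=.
- have [fa0|fa0] := eqVneq (f a) 0; first by rewrite fa0 lexx.
  have fa' : f a < 0 by rewrite lt_neqAle fa0.
  by have : 0 <= f b; [nra | move=> ->; rewrite orbT].
- by rewrite (ltW fb) orbT.
- by rewrite (ltW fa).
- by have := mulr_gt0 fa fb; rewrite ltNge fab.
Qed.

Lemma continuous_bounded f a b : continuous f ->
  exists2 M, 0 < M & forall x, a <= x <= b -> `|f x| <= M.
Proof.
move=> cf.
have [ab|ba] := leP a b; last first.
  exists 1 => // x /andP[ax xb]; have := le_trans ax xb; by rewrite leNgt ba.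
have cfw : {within `[a, b], continuous f}.
  by apply: continuous_subspaceT => x; exact: cf.
have [c cab hc] := EVT_max ab cfw.
have [d dab hd] := EVT_min ab cfw.
exists (`|f c| + `|f d| + 1); first by rewrite ltr_wpDl // addr_ge0.
move=> x xab.
have := hc x; have := hd x; rewrite in_itv/= xab => /(_ isT) h1 /(_ isT) h2.
rewrite ler_norml; apply/andP; split.
  have := ler_norm (- f d); rewrite normrN; have := normr_ge0 (f c); lra.
have := ler_norm (f c); have := normr_ge0 (f d); lra.
Qed.

(** How the arguments at infinity end: a quantity bounded along a bounded
    solution is shown to grow at least linearly. *)
Lemma linear_unbounded (c d e y0 : R) : 0 < c ->
  (forall y, y0 <= y -> e + c * (y - y0) <= d) -> False.
Proof.
move=> c0 h.
have := h (y0 + (`|d| + `|e| + 1) / c).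
have -> : e + c * (y0 + (`|d| + `|e| + 1) / c - y0) = e + (`|d| + `|e| + 1).
  by field; rewrite gt_eqF.
rewrite lerDl divr_ge0 ?(ltW c0) // ?addr_ge0 // => /(_ isT) H.
have := ler_norm d; have := ler_norm (- e); rewrite normrN; lra.
Qed.

Lemma expRN_le_inv (x : R) : 0 < x -> expR (- x) <= x^-1.
Proof.
move=> x0; rewrite expRN lef_pV2 ?posrE ?expR_gt0 //.
by apply: le_trans (expR_ge1Dx x); rewrite lerDr.
Qed.

Lemma expR_small (C e k : R) : 0 < e -> 0 < k ->
  exists Z : R, forall z, Z <= z -> `|C| * expR (- (k * z)) <= e.
Proof.
move=> e0 k0; exists ((`|C| + 1) / (e * k)) => z zZ.
have C0 : 0 < `|C| + 1 by rewrite ltr_wpDl.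
have kz : (`|C| + 1) / e <= k * z.
  apply: le_trans (ler_wpM2l (ltW k0) zZ).
  by rewrite le_eqVlt; apply/orP; left; apply/eqP; field; rewrite !gt_eqF.
have kz0 : 0 < k * z by apply: lt_le_trans kz; rewrite divr_gt0.
apply: (@le_trans _ _ ((`|C| + 1) * (k * z)^-1)).
  apply: ler_pM; rewrite ?expR_ge0 ?lerDl //; exact: expRN_le_inv.
by rewrite ler_pdivrMr // mulrC -ler_pdivrMr.
Qed.

(** Controls the tail beyond [a] of the integral of a decaying function,
    uniformly in [b]. *)
Lemma increment_exp_decay f df (K k c a b : R) : has_deriv f df -> 0 < k -> 0 <= K -> a <= b ->
  (forall x, a <= x <= b -> `|df x| <= K * expR (c - k * x)) ->
  `|f b - f a| <= K / k * expR (c - k * a).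
Proof.
move=> fd k0 K0 ab h.
have gd : has_deriv (fun x => - (K / k * expR (c - k * x))) (fun x => K * expR (c - k * x)).
  by move=> x; derive; field; rewrite gt_eqF.
apply: le_trans (increment_dominated fd gd ab h) _.
by rewrite opprK gerDr oppr_le0 mulr_ge0 ?expR_ge0 // divr_ge0 // ltW.
Qed.

End CalculusConsequences.

(** * Primitives and the linear second-order initial value problem *)

Section Primitives.
Context {R : realType}.
Implicit Types (f g : R -> R) (a x y : R).
Local Notation mu := (@lebesgue_measure R).

Definition segment_integrable f : Prop :=
  forall a c : R, mu.-integrable `[a, c] (EFin \o f).

Lemma oriented_integral_split f a x y : segment_integrable f ->
  a <= x -> a <= y ->
  oriented_integral f x y =
  \int[mu]_(s in `[a, y]) f s - \int[mu]_(s in `[a, x]) f s.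
Proof.
have main x' y' : segment_integrable f -> a <= x' -> x' <= y' ->
    \int[mu]_(s in `[x', y']) f s =
    \int[mu]_(s in `[a, y']) f s - \int[mu]_(s in `[a, x']) f s.
  move=> fi ax xy; rewrite Rintegral_itvB ?bnd_simp ?Rintegral_itv_obnd_cbnd //.
  apply: integrableS (fi x' y') => //.
  by apply: subset_itvr; rewrite bnd_simp.
move=> fi ax ay; rewrite /oriented_integral.
have [xy|yx] := leP x y; first exact: main.
by rewrite main ?opprB // ltW.
Qed.

Lemma continuous_segment_integrable f : continuous f -> segment_integrable f.
Proof.
move=> cf a c; apply: continuous_compact_integrable; first exact: segment_compact.
by apply: continuous_subspaceT => x; exact: cf.
Qed.

(** With a common left end [m], both orientations of the integral differ by a
    constant from the integral from [m], to which the fundamental theorem of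
    calculus applies. *)
Lemma oriented_integral_deriv f a : continuous f ->
  has_deriv (oriented_integral f a) f.
Proof.
move=> cf x; have fi := continuous_segment_integrable cf.
pose m := Num.min a x - 1.
have ma : m <= a.
  by have : Num.min a x <= a by [rewrite ge_min lexx]; rewrite /m; lra.
have mx : m < x.
  by have : Num.min a x <= x by [rewrite ge_min lexx orbT]; rewrite /m; lra.
pose F y := \int[mu]_(s in `[m, y]) f s.
have [Fd Fe] := continuous_FTC1_closed (ltr_pwDr ltr01 (lexx x)) (fi m (x + 1)) mx (cf x).
have FD : is_derive x 1 F (f x).
  by apply: DeriveDef; [exact: Fd | rewrite -derive1E; exact: Fe].
have HF : is_derive x 1 (fun y => F y - F a) (f x).
  exact: is_derive_eq (der_add FD (der_cst (- F a) x)) (addr0 _).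
apply: near_eq_is_derive HF.
near=> y; rewrite (oriented_integral_split (a := m)) // ltW //.
by near: y; exact: lt_nbhsr.
Unshelve. all: by end_near. Qed.

Lemma oriented_integral_base f a : oriented_integral f a a = 0.
Proof. by rewrite /oriented_integral lexx set_itv1 Rintegral_set1. Qed.

Lemma primitive_exists f a : continuous f ->
  exists F : R -> R, has_deriv F f /\ F a = 0.
Proof.
move=> cf; exists (oriented_integral f a).
by split; [exact: oriented_integral_deriv | exact: oriented_integral_base].
Qed.

End Primitives.

Section InitialValueProblem.
Context {R : realType}.
Implicit Types (f g u v : R -> R) (c y : R).

(** Completeness, in the form needed for nested intervals. *)
Lemma separating_point (I : pointedType) (lo hi : I -> R) :
  (forall i j, lo i <= hi j) -> exists l, forall i, lo i <= l <= hi i.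
Proof.
move=> lohi; pose S := [set lo i | i in setT].
have S0 : S !=set0 by exists (lo point); exists point.
have Sub i : ubound S (hi i) by move=> _ [j _ <-]; exact: lohi.
exists (sup S) => i; apply/andP; split.
  by apply: ub_le_sup; [exists (hi i); exact: Sub | exists i].
by apply: ge_sup; [exact: S0 | exact: Sub].
Qed.

(** The intervals of radius [2 C / 2 ^+ N] around the terms are nested, so
    they have a common point, which is the limit. *)
Lemma geometric_limit (s : nat -> R) (C : R) :
  (forall N, `|s N.+1 - s N| <= C * 2^-1 ^+ N) ->
  forall N, `|lim (s n @[n --> \oo]) - s N| <= 2 * C * 2^-1 ^+ N.
Proof.
move=> h.
have h2 N : (2^-1 : R) ^+ N.+1 = 2^-1 * 2^-1 ^+ N by rewrite exprS.
have C0 : 0 <= C by have := h 0%N; rewrite expr0 mulr1; apply: le_trans.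
have lo_mono N M : s N - 2 * C * 2^-1 ^+ N <= s (N + M)%N - 2 * C * 2^-1 ^+ (N + M).
  elim: M => [|M]; first by rewrite addn0.
  move=> /le_trans; apply; rewrite addnS h2.
  by have := h (N + M)%N; rewrite ler_norml => /andP[]; lra.
have hi_mono N M : s (N + M)%N + 2 * C * 2^-1 ^+ (N + M) <= s N + 2 * C * 2^-1 ^+ N.
  elim: M => [|M]; first by rewrite addn0.
  apply: le_trans; rewrite addnS h2.
  by have := h (N + M)%N; rewrite ler_norml => /andP[]; lra.
have pos N : 0 <= 2 * C * 2^-1 ^+ N by rewrite !mulr_ge0 // exprn_ge0.
have [l hl] : exists l, forall i : nat,
    s i - 2 * C * 2^-1 ^+ i <= l <= s i + 2 * C * 2^-1 ^+ i.
  apply: (@separating_point nat) => i j.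
  have := lo_mono i j; have := hi_mono j i; rewrite addnC; have := pos (i + j)%N.
  lra.
have hl' N : `|l - s N| <= 2 * C * 2^-1 ^+ N.
  by have := hl N; rewrite ler_norml => /andP[]; lra.
suff -> : lim (s n @[n --> \oo]) = l by [].
apply/cvg_lim => //; apply/cvgrPdist_le => e e0.
have gz : (2 * C * 2^-1 ^+ n) @[n --> \oo] --> (0 : R).
  rewrite -[X in _ --> X](mulr0 (2 * C)); apply: cvgM; first exact: cvg_cst.
  by apply: cvg_expr; rewrite gtr0_norm // invf_lt1 // ltr1n.
move/cvgrPdist_le : gz => /(_ e e0); apply: filterS => n.
rewrite sub0r normrN ger0_norm // => H; exact: le_trans (hl' n) H.
Qed.

Variables (Q : R -> R) (cQ : continuous Q) (y0 : R).
Local Notation P f := (oriented_integral f y0).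

Lemma primitive_sub f g y : continuous f -> continuous g ->
  P f y - P g y = P (fun s => f s - g s) y.
Proof.
move=> cf cg.
have cfg : continuous (fun s => f s - g s).
  by move=> x; apply: continuousB; [exact: cf | exact: cg].
have fd := oriented_integral_deriv y0 cf.
have gd := oriented_integral_deriv y0 cg.
have fgd := oriented_integral_deriv y0 cfg.
pose h s := P f s - P g s - P (fun s => f s - g s) s.
have hd : has_deriv h (fun => 0).
  by move=> x; rewrite /h; derive; ring.
have h0 : h y0 = 0 by rewrite /h !oriented_integral_base !subr0.
suff : h y = h y0 by rewrite h0 /h => /eqP; rewrite subr_eq0 => /eqP.
have [yy|yy] := leP y y0; first exact: (deriv_eq0_eq hd yy).
by rewrite (deriv_eq0_eq hd (ltW yy)).
Qed.

(** Integration gains a factor [1 / L] in the norm weighted by [expR (- L |y -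
    y0|)]; this makes the Picard map contracting on an interval of any length.
    *)
Lemma primitive_exp_bound f (T L c : R) : continuous f -> 0 < L -> 0 <= c ->
  (forall y, `|y - y0| <= T -> `|f y| <= c * expR (L * `|y - y0|)) ->
  forall y, `|y - y0| <= T -> `|P f y| <= c / L * expR (L * `|y - y0|).
Proof.
move=> cf L0 c0 hf y yT.
have fd := oriented_integral_deriv y0 cf.
have c1 : 0 <= c / L by rewrite divr_ge0 // ltW.
have [yy|yy] := leP y0 y.
  have gd : has_deriv (fun s => c / L * expR (L * (s - y0)))
                      (fun s => c * expR (L * (s - y0))).
    by move=> x; derive; field; rewrite gt_eqF.
  have e1 : `|y - y0| = y - y0 by rewrite ger0_norm ?subr_ge0.
  have bnd x : y0 <= x <= y -> `|f x| <= c * expR (L * (x - y0)).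
    move=> /andP[x1 x2]; have := hf x.
    have -> : `|x - y0| = x - y0 by rewrite ger0_norm ?subr_ge0.
    by apply; move: yT; rewrite e1; lra.
  have := increment_dominated fd gd yy bnd.
  rewrite oriented_integral_base subr0 e1 => /le_trans; apply.
  by rewrite gerBl mulr_ge0 ?expR_ge0.
have gd : has_deriv (fun s => - (c / L * expR (L * (y0 - s))))
                    (fun s => c * expR (L * (y0 - s))).
  by move=> x; derive; field; rewrite gt_eqF.
have e1 : `|y - y0| = y0 - y by rewrite distrC ger0_norm ?subr_ge0 ?(ltW yy).
have bnd x : y <= x <= y0 -> `|f x| <= c * expR (L * (y0 - x)).
  move=> /andP[x1 x2]; have := hf x.
  have -> : `|x - y0| = y0 - x by rewrite distrC ger0_norm ?subr_ge0.
  by apply; move: yT; rewrite e1; lra.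
have := increment_dominated fd gd (ltW yy) bnd.
rewrite oriented_integral_base sub0r normrN e1 => /le_trans; apply.
by rewrite opprK gerDr oppr_le0 mulr_ge0 ?expR_ge0.
Qed.

(** Picard iteration for [u'' = Q u]. On [|y - y0| <= T] the iterates converge
    geometrically in the weighted norm as soon as [L ^+ 2 >= 2 sup |Q|]; they
    do not depend on [T], so their limit solves the equation on the whole
    line. *)
Lemma ivp_exists (a b : R) : exists u v : R -> R,
  [/\ has_deriv u v, has_deriv v (fun y => Q y * u y), u y0 = a & v y0 = b].
Proof.
have tri (x1 x2 x3 x4 r1 r2 : R) : `|x2 - x4| <= r1 -> `|x3 - (x1 + x4)| <= r2 ->
    `|x1 + x2 - x3| <= r1 + r2.
  by rewrite !ler_norml => /andP[? ?] /andP[? ?]; apply/andP; split; lra.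
pose S0 y := a + b * (y - y0).
pose K u := P (P (fun s => Q s * u s)).
pose S := fix S (N : nat) : R -> R :=
  if N is M.+1 then (fun y => S0 y + K (S M) y) else S0.
have cM u : continuous u -> continuous (fun s => Q s * u s).
  by move=> cu x; apply: continuousM; [exact: cQ | exact: cu].
have Kd u : continuous u -> has_deriv (K u) (P (fun s => Q s * u s)).
  move=> cu; apply: oriented_integral_deriv.
  exact: has_deriv_continuous (oriented_integral_deriv y0 (cM _ cu)).
have S0d : has_deriv S0 (fun => b) by move=> x; rewrite /S0; derive; ring.
have cS N : continuous (S N).
  elim: N => [|N IH]; first exact: has_deriv_continuous S0d.
  have := Kd _ IH => KSd.
  apply: (@has_deriv_continuous _ _ (fun y => b + P (fun s => Q s * S N s) y)).
  by move=> x /=; der.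
have KB u w y : continuous u -> continuous w ->
    K u y - K w y = K (fun s => u s - w s) y.
  move=> cu cw; rewrite /K primitive_sub.
  - congr oriented_integral; apply/funext => s; rewrite primitive_sub ?cM //.
    + by congr oriented_integral; apply/funext => r; ring.
    + exact: cM.
    + exact: cM.
  - exact: has_deriv_continuous (oriented_integral_deriv y0 (cM _ cu)).
  - exact: has_deriv_continuous (oriented_integral_deriv y0 (cM _ cw)).
(* [K] halves the weighted norm on the segment of radius [T] *)
have Kbound T : exists2 L : R, 0 < L &
    forall u c, continuous u -> 0 <= c ->
    (forall y, `|y - y0| <= T -> `|u y| <= c * expR (L * `|y - y0|)) ->
    forall y, `|y - y0| <= T -> `|K u y| <= c * 2^-1 * expR (L * `|y - y0|).
  have [M M0 hM] := continuous_bounded (y0 - T) (y0 + T) cQ.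
  exists (1 + 2 * M) => [|u c cu c0 hu y yT]; first lra.
  have L0 : 0 < 1 + 2 * M by lra.
  have cu' := cM _ cu.
  have step1 z : `|z - y0| <= T ->
      `|Q z * u z| <= M * c * expR ((1 + 2 * M) * `|z - y0|).
    move=> zT; rewrite normrM -mulrA; apply: ler_pM => //; last exact: hu.
    by apply: hM; move: zT; rewrite ler_norml => /andP[]; lra.
  have Mc0 : 0 <= M * c by rewrite mulr_ge0 // ltW.
  have step2 := primitive_exp_bound cu' L0 Mc0 step1.
  have Mc1 : 0 <= M * c / (1 + 2 * M) by rewrite divr_ge0 // ltW.
  have cP := has_deriv_continuous (oriented_integral_deriv y0 cu').
  have := primitive_exp_bound cP L0 Mc1 step2 yT.
  move=> /le_trans; apply; apply: ler_wpM2r; first exact: expR_ge0.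
  rewrite ler_pdivrMr // ler_pdivrMr //; nra.
have dS T : exists2 L : R, 0 < L & exists2 A : R, 0 <= A & forall N y, `|y - y0| <= T ->
    `|S N.+1 y - S N y| <= A * expR (L * `|y - y0|) * 2^-1 ^+ N.
  have [L L0 KL] := Kbound T; exists L => //.
  have cK : continuous (K S0).
    exact: has_deriv_continuous (Kd _ (cS 0%N)).
  have [A A0 hA] := continuous_bounded (y0 - T) (y0 + T) cK.
  exists A; first exact: ltW.
  move=> N y yT; rewrite mulrAC.
  elim: N y yT => [|N IH] y yT.
    rewrite expr0 mulr1 /= addrAC subrr add0r.
    apply: (@le_trans _ _ (A * 1)).
      by rewrite mulr1; apply: hA; move: yT; rewrite ler_norml => /andP[]; lra.
    apply: ler_wpM2l; first exact: ltW.
    by rewrite -expR0 ler_expR mulr_ge0 // ltW.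
  have SS M : S M.+1 y = S0 y + K (S M) y by [].
  rewrite !SS opprD addrACA subrr add0r KB // exprSr mulrA; apply: KL => //.
    by move=> x; apply: continuousB; apply: cS.
  by rewrite mulr_ge0 // ?(ltW A0) // exprn_ge0.
pose u y := lim (S N y @[N --> \oo]).
have uS T : exists2 L : R, 0 < L & exists2 A : R, 0 <= A & forall N y, `|y - y0| <= T ->
    `|u y - S N y| <= (2 * A * 2^-1 ^+ N) * expR (L * `|y - y0|).
  have [L L0 [A A0 hA]] := dS T; exists L => //; exists A => // N y yT.
  have := geometric_limit (s := fun N => S N y) (fun N => hA N y yT) N.
  by move=> /le_trans; apply; rewrite le_eqVlt; apply/orP; left; apply/eqP; ring.
have small (C e : R) : 0 <= C -> 0 < e -> exists N : nat, C * 2^-1 ^+ N <= e.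
  move=> C0 e0.
  have gz : (C * 2^-1 ^+ n) @[n --> \oo] --> (0 : R).
    rewrite -[X in _ --> X](mulr0 C); apply: cvgM; first exact: cvg_cst.
    by apply: cvg_expr; rewrite gtr0_norm // invf_lt1 // ltr1n.
  move/cvgrPdist_le : gz => /(_ e e0) [N _ /(_ N (leqnn _))] /=.
  rewrite sub0r normrN ger0_norm ?mulr_ge0 ?exprn_ge0 // => H; by exists N.
have cu : continuous u.
  move=> y; apply/cvgrPdist_le => e e0.
  have [L L0 [A A0 hA]] := uS (`|y - y0| + 1).
  pose T := `|y - y0| + 1.
  have e3 : 0 < e / 3 by lra.
  have E0 : 0 <= expR (L * T) by exact: expR_ge0.
  have [N hN] := small (2 * A * expR (L * T)) (e / 3) (mulr_ge0 (mulr_ge0 (ler0n _ 2) A0) E0) e3.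
  have near1 z : `|z - y0| <= T -> `|u z - S N z| <= e / 3.
    move=> zT; apply: le_trans (hA N z zT) _.
    apply: le_trans hN; rewrite mulrAC; apply: ler_wpM2r; first by rewrite exprn_ge0.
    apply: ler_wpM2l; first by rewrite mulr_ge0.
    by rewrite ler_expR ler_wpM2l // ltW.
  have /cvgrPdist_le /(_ _ e3) := cS N y.
  move=> H; near=> z.
  have Hz : `|S N y - S N z| <= e / 3 by near: z.
  have zT : `|z - y0| <= T.
    have : `|y - z| <= 1 by near: z; apply: cvgr_dist_le.
    rewrite /T distrC => z1.
    by apply: le_trans (ler_distD y _ _) _; rewrite addrC lerD2l.
  have yT : `|y - y0| <= T by rewrite /T lerDl.
  have -> : u y - u z = (u y - S N y) + (S N y - S N z) - (u z - S N z) by ring.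
  have -> : e = e / 3 + e / 3 + e / 3 by field.
  apply: le_trans (ler_normB _ _) _; apply: lerD; last exact: near1.
  by apply: le_trans (ler_normD _ _) _; apply: lerD; [exact: near1 | exact: Hz].
(* [S N] tends to [u] and [K (S N)] to [K u], at the same geometric rate *)
have uE : u = (fun y => S0 y + K u y).
  apply/funext => y.
  have [L L0 KL] := Kbound `|y - y0|.
  have [L1 L10 [A A0 hA]] := uS `|y - y0|.
  pose E := expR (L1 * `|y - y0|).
  have diff N : `|S0 y + K u y - u y| <= (2 * A * E * (1 + expR (L * `|y - y0|))) * 2^-1 ^+ N.
    have c0 : 0 <= 2 * A * 2^-1 ^+ N * E by rewrite !mulr_ge0 // ?exprn_ge0 // expR_ge0.
    have h1 : `|K u y - K (S N) y| <= 2 * A * 2^-1 ^+ N * E * 2^-1 * expR (L * `|y - y0|).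
      rewrite KB //; apply: KL => //.
        by move=> x; apply: continuousB; [exact: cu | exact: cS].
      move=> z zy; apply: le_trans (hA N z zy) _.
      rewrite -[leLHS]mulr1; apply: ler_pM => //.
      - by rewrite !mulr_ge0 // ?exprn_ge0 // expR_ge0.
      - apply: ler_wpM2l; first by rewrite !mulr_ge0 // exprn_ge0.
        by rewrite /E ler_expR ler_wpM2l // ltW.
      - by rewrite -expR0 ler_expR mulr_ge0 // ltW.
    have := hA N.+1 y (lexx _); rewrite -/E exprSr /= => h2.
    apply: le_trans (tri _ _ _ _ _ _ h1 h2) _; rewrite -subr_ge0.
    set G := expR (L * _); set p := 2^-1 ^+ N.
    have -> : 2 * A * E * (1 + G) * p - (2 * A * p * E * 2^-1 * G + 2 * A * (p * 2^-1) * E) =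
      A * E * p * (1 + G) by field.
    by rewrite !mulr_ge0 ?addr_ge0 ?exprn_ge0 ?expR_ge0.
  apply/esym/eqP; rewrite -subr_eq0 -normr_le0; apply/ler_addgt0Pr => e e0.
  have [|N hN] := small (2 * A * E * (1 + expR (L * `|y - y0|))) e _ e0.
    by rewrite !mulr_ge0 // ?expR_ge0 // addr_ge0 // expR_ge0.
  by rewrite add0r; apply: le_trans (diff N) hN.
exists u, (fun y => b + P (fun s => Q s * u s) y).
have Pd := oriented_integral_deriv y0 (cM _ cu).
split.
- by rewrite {1}uE => y; have := Kd _ cu => Kud; derive.
- by move=> y; derive; rewrite add0r.
- by rewrite uE /S0 /K oriented_integral_base subrr mulr0 !addr0.
- by rewrite oriented_integral_base addr0.
Unshelve. all: by end_near. Qed.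

End InitialValueProblem.

(** * Solutions of [u'' = Q u] on a half-line where [Q >= 1] *)

Definition solves (R : realType) (Q u v : R -> R) : Prop :=
  has_deriv u v /\ has_deriv v (fun y => Q y * u y).

Section Gronwall.
Context {R : realType}.
Implicit Types (u v dv Q : R -> R) (a b e M y : R).

Lemma exp_shift (A B a b : R) :
  A * expR a <= B * expR b -> A <= B * expR (b - a).
Proof.
move=> h; rewrite expRD mulrA -(ler_pM2r (expR_gt0 a)).
by rewrite -[leRHS]mulrA -expRD addNr expR0 mulr1.
Qed.

(** The derivative of the left-hand side is at most [2 + M] times the
    left-hand side itself; adding [e ^+ 2] to the energy absorbs the forcing
    term. *)
Lemma gronwall u v dv a b e M : has_deriv u v -> has_deriv v dv -> 0 <= M ->
  0 <= e ->
  (forall y, a <= y <= b -> `|dv y| <= M * `|u y| + e) ->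
  forall y0 y, a <= y0 <= b -> a <= y <= b ->
  u y ^+ 2 + v y ^+ 2 + e ^+ 2 <=
  (u y0 ^+ 2 + v y0 ^+ 2 + e ^+ 2) * expR ((2 + M) * `|y - y0|).
Proof.
move=> ud vd M0 e0 h y0 y /andP[ay0 y0b] /andP[ay yb].
have key z : a <= z <= b ->
    `|2 * (u z * v z) + 2 * (v z * dv z)| <= (2 + M) * (u z ^+ 2 + v z ^+ 2 + e ^+ 2).
  move=> /h hz.
  apply: (@le_trans _ _ (2 * (`|u z| * `|v z|) + 2 * (`|v z| * (M * `|u z| + e)))).
    apply: le_trans (ler_normD _ _) _.
    rewrite !normrM (ger0_norm (ler0n _ 2)) lerD2l ler_wpM2l // ler_wpM2l //.
  rewrite -[u z ^+ 2]real_normK ?num_real // -[v z ^+ 2]real_normK ?num_real //.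
  have := normr_ge0 (u z); have := normr_ge0 (v z).
  set A := `|u z|; set B := `|v z| => B0 A0.
  have ? : 0 <= (1 + M) * (A - B) ^+ 2 by rewrite mulr_ge0 ?sqr_ge0 // addr_ge0.
  have ? : 0 <= (B - e) ^+ 2 by exact: sqr_ge0.
  have ? : 0 <= A ^+ 2 by exact: sqr_ge0.
  have ? : 0 <= (1 + M) * e ^+ 2 by rewrite mulr_ge0 ?sqr_ge0 // addr_ge0.
  nra.
pose G s := u s ^+ 2 + v s ^+ 2 + e ^+ 2.
have [yy|yy] := leP y0 y.
  have Hd : has_deriv (fun s => G s * expR (- ((2 + M) * s)))
     (fun s => ((2 * (u s * v s) + 2 * (v s * dv s)) - (2 + M) * G s) * expR (- ((2 + M) * s))).
    by move=> x; rewrite /G; derive; rewrite /=; ring.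
  have := deriv_le0_ge Hd yy _.
  rewrite -/(G y) -/(G y0) (ger0_norm (x := y - y0)) ?subr_ge0 // => H.
  have {}H : G y * expR (- ((2 + M) * y)) <= G y0 * expR (- ((2 + M) * y0)).
    apply: H => x /andP[x1 x2]; apply: mulr_le0_ge0; last exact: expR_ge0.
    have /key : a <= x <= b by apply/andP; split; lra.
    by rewrite ler_norml => /andP[_]; rewrite -/(G x); lra.
  apply: le_trans (exp_shift H) _.
  by have -> : - ((2 + M) * y0) - - ((2 + M) * y) = (2 + M) * (y - y0) by ring.
have Hd : has_deriv (fun s => G s * expR ((2 + M) * s))
   (fun s => ((2 * (u s * v s) + 2 * (v s * dv s)) + (2 + M) * G s) * expR ((2 + M) * s)).
  by move=> x; rewrite /G; derive; rewrite /=; ring.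
have := deriv_ge0_le Hd (ltW yy) _.
rewrite -/(G y) -/(G y0) distrC (ger0_norm (x := y0 - y)) ?subr_ge0 ?(ltW yy) // => H.
have {}H : G y * expR ((2 + M) * y) <= G y0 * expR ((2 + M) * y0).
  apply: H => x /andP[x1 x2]; apply: mulr_ge0; last exact: expR_ge0.
  have /key : a <= x <= b by apply/andP; split; lra.
  by rewrite ler_norml => /andP[+ _]; rewrite -/(G x); lra.
by apply: le_trans (exp_shift H) _; rewrite mulrBr.
Qed.

Lemma solves_uniq Q u v y0 : continuous Q -> solves Q u v ->
  u y0 = 0 -> v y0 = 0 -> forall y, u y = 0 /\ v y = 0.
Proof.
move=> cQ [ud vd] u0 v0 y.
have [M M0 hM] := continuous_bounded (Num.min y y0) (Num.max y y0) cQ.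
have := gronwall ud vd (ltW M0) (lexx 0) (a := Num.min y y0) (b := Num.max y y0) _ (y0 := y0) (y := y).
rewrite !ge_min !le_max !lexx /= !orbT u0 v0 !expr0n /= !addr0 mul0r.
have H : forall y1, Num.min y y0 <= y1 <= Num.max y y0 -> `|Q y1 * u y1| <= M * `|u y1|.
  by move=> y1 hy; rewrite normrM ler_wpM2r // hM.
move=> /(_ _ isT isT) H2.
have {}H2 : u y ^+ 2 + v y ^+ 2 <= 0.
  by apply: H2 => y1 hy; rewrite addr0; exact: H.
have := sqr_ge0 (u y); have := sqr_ge0 (v y) => a1 a2.
by split; apply/eqP; rewrite -sqrf_eq0; apply/eqP; lra.
Qed.

Lemma solves_scale Q u v c : solves Q u v ->
  solves Q (fun y => c * u y) (fun y => c * v y).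
Proof. by move=> [ud vd]; split => x; derive; ring. Qed.

Lemma solves_reflect Q u v : solves Q u v ->
  solves (fun y => Q (- y)) (fun y => u (- y)) (fun y => - v (- y)).
Proof. by move=> [ud vd]; split => x; derive; ring. Qed.

End Gronwall.

Section RightHalfLine.
Context {R : realType}.
Variables (Q u v : R -> R) (Y : R).
Hypothesis uv : solves Q u v.
Hypothesis Q1 : forall y, Y <= y -> 1 <= Q y.

Let ud : has_deriv u v := uv.1.
Let vd : has_deriv v (fun y => Q y * u y) := uv.2.

Lemma uv_deriv : has_deriv (fun y => u y * v y) (fun y => v y ^+ 2 + Q y * u y ^+ 2).
Proof. by move=> x; derive; ring. Qed.

Lemma sqr_deriv : has_deriv (fun y => u y ^+ 2) (fun y => 2 * (u y * v y)).
Proof. by move=> x; derive; rewrite /=; ring. Qed.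

(** The product [u * v] is half the derivative of [u ^+ 2], and it increases
    where [Q] is positive: its sign separates growing from decaying solutions.
    *)
Lemma uv_nondecr y y1 : Y <= y -> y <= y1 -> u y * v y <= u y1 * v y1.
Proof.
move=> Yy yy; apply: (deriv_ge0_le uv_deriv yy) => x /andP[yx _].
have ? := Q1 (le_trans Yy yx).
by rewrite addr_ge0 ?sqr_ge0 // mulr_ge0 ?sqr_ge0 //; lra.
Qed.

(** Once positive, [u * v] stays above its value, so that [u ^+ 2] grows at
    least linearly. *)
Lemma uv_gt0_unbounded y1 (C : R) : Y <= y1 -> 0 < u y1 * v y1 ->
  (forall y, Y <= y -> `|u y| <= C) -> False.
Proof.
move=> Yy p0 hC.
apply: (@linear_unbounded _ (2 * (u y1 * v y1)) (C ^+ 2) (u y1 ^+ 2) y1); first lra.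
move=> y yy.
have gd : has_deriv (fun y => 2 * (u y1 * v y1) * y) (fun => 2 * (u y1 * v y1)).
  by move=> x; derive; ring.
have := deriv_le_sub gd sqr_deriv yy.
have b1 : u y ^+ 2 <= C ^+ 2.
  have := hC _ (le_trans Yy yy); rewrite -[u y ^+ 2]real_normK ?num_real // => h.
  by rewrite ler_sqr ?nnegrE // (le_trans _ h).
move=> H.
suff : 2 * (u y1 * v y1) * y - 2 * (u y1 * v y1) * y1 <= u y ^+ 2 - u y1 ^+ 2 by lra.
apply: H => x /andP[yx _]; have := uv_nondecr Yy yx; lra.
Qed.

Variable C : R.
Hypothesis u_bnd : forall y, Y <= y -> `|u y| <= C.

Lemma uv_le0 y : Y <= y -> u y * v y <= 0.
Proof.
by move=> Yy; rewrite leNgt; apply/negP => /uv_gt0_unbounded; apply; [exact: Yy | exact: u_bnd].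
Qed.

(** As [u * v <= 0] and [Q >= 1], the difference [u ^+ 2 - v ^+ 2] does not
    decrease. If it were positive somewhere, [u ^+ 2] would stay away from
    zero and [u * v] would increase at least linearly, becoming positive. *)
Lemma sqr_le_deriv y1 : Y <= y1 -> u y1 ^+ 2 <= v y1 ^+ 2.
Proof.
move=> Yy; rewrite leNgt; apply/negP => p0.
pose d := u y1 ^+ 2 - v y1 ^+ 2.
have d0 : 0 < d by rewrite subr_gt0.
have pd : has_deriv (fun y => u y ^+ 2 - v y ^+ 2) (fun y => 2 * (u y * v y) * (1 - Q y)).
  by move=> x; derive; rewrite /=; ring.
have ge_d y : y1 <= y -> d <= u y ^+ 2.
  move=> yy; have : u y1 ^+ 2 - v y1 ^+ 2 <= u y ^+ 2 - v y ^+ 2.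
    apply: (deriv_ge0_le pd yy) => x /andP[yx _].
    by have := uv_le0 (le_trans Yy yx); have := Q1 (le_trans Yy yx); nra.
  by rewrite /d; have := sqr_ge0 (v y); lra.
apply: (@linear_unbounded _ d 0 (u y1 * v y1) y1) => // y yy.
have gd : has_deriv (fun y => d * y) (fun => d) by move=> x; derive; ring.
have := deriv_le_sub gd uv_deriv yy => H.
have := uv_le0 (le_trans Yy yy).
suff : d * y - d * y1 <= u y * v y - u y1 * v y1 by lra.
apply: H => x /andP[yx _]; have := ge_d _ yx; have := Q1 (le_trans Yy yx).
by have := sqr_ge0 (v x); nra.
Qed.

Lemma uv_le_Nsqr y : Y <= y -> u y * v y <= - u y ^+ 2.
Proof.
move=> Yy; have h1 := uv_le0 Yy; have h2 := sqr_le_deriv Yy.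
have ? := sqr_ge0 (u y).
suff : u y ^+ 2 <= - (u y * v y) by lra.
rewrite -ler_sqr ?nnegrE ?sqr_ge0 //; last lra.
have -> : (- (u y * v y)) ^+ 2 = u y ^+ 2 * v y ^+ 2 by ring.
by rewrite [leLHS]expr2 ler_wpM2l.
Qed.

(** From [u * v <= - u ^+ 2], the function [u ^+ 2 * expR (2 y)] is
    nonincreasing. *)
Lemma decay y1 y : Y <= y1 -> y1 <= y -> `|u y| <= `|u y1| * expR (- (y - y1)).
Proof.
move=> Yy yy.
have gd : has_deriv (fun y => u y ^+ 2 * expR (2 * y))
                    (fun y => 2 * (u y * v y + u y ^+ 2) * expR (2 * y)).
  by move=> x; derive; rewrite /=; ring.
have : u y ^+ 2 * expR (2 * y) <= u y1 ^+ 2 * expR (2 * y1).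
  apply: (deriv_le0_ge gd yy) => x /andP[yx _].
  apply: mulr_le0_ge0; last exact: expR_ge0.
  by have := uv_le_Nsqr (le_trans Yy yx); lra.
move=> /exp_shift; have -> : 2 * y1 - 2 * y = 2%:R * - (y - y1) by ring.
rewrite expRM_natl => H; rewrite -ler_sqr ?nnegrE ?mulr_ge0 ?expR_ge0 //.
by rewrite exprMn !real_normK ?num_real.
Qed.

Lemma decay_deriv y1 y : Y <= y1 -> y1 <= y -> `|v y| <= `|v y1|.
Proof.
move=> Yy yy; rewrite -ler_sqr ?nnegrE // !real_normK ?num_real //.
have gd : has_deriv (fun y => v y ^+ 2) (fun y => 2 * Q y * (u y * v y)).
  by move=> x; derive; rewrite /=; ring.
apply: (deriv_le0_ge gd yy) => x /andP[yx _].
by have := uv_le0 (le_trans Yy yx); have := Q1 (le_trans Yy yx); nra.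
Qed.

Hypothesis cQ : continuous Q.

(** Beyond a zero the decay estimate makes [u] vanish on a half-line, and
    uniqueness propagates this to the whole line. *)
Lemma nonvanishing y1 : Y <= y1 -> u y1 = 0 -> forall y, u y = 0.
Proof.
move=> Yy u0 y.
have z y2 : y1 <= y2 -> u y2 = 0.
  by move=> yy; have := decay Yy yy; rewrite u0 normr0 mul0r normr_le0 => /eqP.
have l1 : y1 <= y1 + 1 by rewrite lerDl.
have [c /andP[c1 c2]] := mean_value ud l1.
rewrite (z y1) // (z (y1 + 1)) // => e; have vc : v c = 0 by lra.
by have [] := solves_uniq cQ uv (z _ c1) vc y.
Qed.

Lemma constant_sign y y1 : Y <= y -> Y <= y1 -> 0 < u y -> 0 < u y1.
Proof.
move=> Yy Yy1 p.
rewrite ltNge; apply/negP => n.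
have cu := has_deriv_continuous ud.
suff [c Yc c0] : exists2 c, Y <= c & u c = 0.
  by have := nonvanishing Yc c0 y => e; move: p; rewrite e ltxx.
have [yy|yy] := leP y y1.
  have [|c /andP[c1 _]] := zero_between cu yy; first by nra.
  by exists c => //; exact: le_trans c1.
have [|c /andP[c1 _]] := zero_between cu (ltW yy); first by nra.
by exists c => //; exact: le_trans c1.
Qed.

End RightHalfLine.

(** The same estimates at [-oo], by reflection. *)
Section LeftHalfLine.
Context {R : realType}.
Variables (Q u v : R -> R) (Y : R).
Hypothesis uv : solves Q u v.
Hypothesis Q1 : forall y, y <= Y -> 1 <= Q y.

Let uvr := solves_reflect uv.
Let Q1r : forall y, - Y <= y -> 1 <= Q (- y).
Proof. by move=> y yY; apply: Q1; lra. Qed.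

Lemma uv_nondecr_left y1 y : y <= Y -> y1 <= y -> u y1 * v y1 <= u y * v y.
Proof.
move=> Yy yy; have := @uv_nondecr _ _ _ _ _ uvr Q1r (- y) (- y1).
rewrite !opprK => H.
have : u y * - v y <= u y1 * - v y1 by apply: H; lra.
lra.
Qed.

Variable C : R.
Hypothesis u_bnd : forall y, y <= Y -> `|u y| <= C.

Let br y : - Y <= y -> `|u (- y)| <= C.
Proof. by move=> h; apply: u_bnd; lra. Qed.

Lemma uv_ge0_left y : y <= Y -> 0 <= u y * v y.
Proof.
move=> Yy; have := @uv_le0 _ _ _ _ _ uvr Q1r C br (- y).
by rewrite opprK => H; have : u y * - v y <= 0 by [apply: H; lra]; lra.
Qed.

Lemma uv_ge_sqr_left y : y <= Y -> u y ^+ 2 <= u y * v y.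
Proof.
move=> Yy; have := @uv_le_Nsqr _ _ _ _ _ uvr Q1r C br (- y).
by rewrite opprK => H; have : u y * - v y <= - u y ^+ 2 by [apply: H; lra]; lra.
Qed.

Lemma decay_left y1 y : y <= Y -> y1 <= y -> `|u y1| <= `|u y| * expR (- (y - y1)).
Proof.
move=> Yy yy; have := @decay _ _ _ _ _ uvr Q1r C br (- y) (- y1).
by rewrite !opprK addrC; apply; lra.
Qed.

Lemma decay_deriv_left y1 y : y <= Y -> y1 <= y -> `|v y1| <= `|v y|.
Proof.
move=> Yy yy; have := @decay_deriv _ _ _ _ _ uvr Q1r C br (- y) (- y1).
by rewrite !opprK !normrN; apply; lra.
Qed.

Hypothesis cQ : continuous Q.

Let cQr : continuous (fun y => Q (- y)).
Proof.
move=> x; apply: (continuous_comp (f := fun y : R => - y)); last exact: cQ.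
exact: opp_continuous.
Qed.

Lemma nonvanishing_left y1 : y1 <= Y -> u y1 = 0 -> forall y, u y = 0.
Proof.
move=> Yy u0 y.
have := @nonvanishing _ _ _ _ _ uvr Q1r C br cQr (- y1).
rewrite opprK => /(_ _ u0 (- y)); rewrite opprK; apply; lra.
Qed.

End LeftHalfLine.

(** * Solutions decaying at infinity *)

Section WeylSolution.
Context {R : realType}.
Implicit Types (Q q u v : R -> R) (Y Z y l : R).

(** The product [u * v] starts nonnegative and stays so; hence [v ^+ 2] does
    not decrease and [v] cannot reach zero. *)
Lemma growing_slope Q u v Y : solves Q u v -> (forall y, Y <= y -> 1 <= Q y) ->
  0 <= u Y -> 0 < v Y -> forall y, Y <= y -> v Y <= v y.
Proof.
move=> uvs Q1 u0 v0 y Yy; have [ud vd] := uvs.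
have p z : Y <= z -> 0 <= u z * v z.
  move=> Yz; apply: le_trans (uv_nondecr uvs Q1 (lexx Y) Yz).
  by rewrite mulr_ge0 // ltW.
have gd : has_deriv (fun y => v y ^+ 2) (fun y => 2 * Q y * (u y * v y)).
  by move=> x; derive; rewrite /=; ring.
have v2 z : Y <= z -> v Y ^+ 2 <= v z ^+ 2.
  move=> Yz; apply: (deriv_ge0_le gd Yz) => x /andP[Yx _].
  by have := p _ Yx; have := Q1 _ Yx; nra.
have := v2 _ Yy; have [vy|vy] := leP 0 (v y).
  by rewrite ler_sqr ?nnegrE // ltW.
have cv := has_deriv_continuous vd.
have [|c /andP[c1 _] vc] := zero_between cv Yy; first by nra.
by have := v2 _ c1; rewrite vc; nra.
Qed.

Lemma growing_value Q u v Y : solves Q u v -> (forall y, Y <= y -> 1 <= Q y) ->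
  0 < u Y -> 0 <= v Y -> forall y, Y <= y -> u Y <= u y /\ v Y <= v y.
Proof.
move=> uvs Q1 u0 v0; have [ud vd] := uvs.
have p z : Y <= z -> 0 <= u z * v z.
  move=> Yz; apply: le_trans (uv_nondecr uvs Q1 (lexx Y) Yz).
  by rewrite mulr_ge0 // ltW.
have u2 z : Y <= z -> u Y ^+ 2 <= u z ^+ 2.
  move=> Yz; apply: (deriv_ge0_le (sqr_deriv uvs) Yz) => x /andP[Yx _].
  by have := p _ Yx; lra.
have up z : Y <= z -> u Y <= u z.
  move=> Yy; have := u2 _ Yy; have [vy|vy] := leP 0 (u z).
    by rewrite ler_sqr ?nnegrE // ltW.
  have cv := has_deriv_continuous ud.
  have [|c /andP[c1 _] vc] := zero_between cv Yy; first by nra.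
  by have := u2 _ c1; rewrite vc; nra.
move=> y Yy; split; first exact: up.
apply: (deriv_ge0_le vd Yy) => x /andP[Yx _].
by have := up _ Yx; have := Q1 _ Yx; nra.
Qed.

(** The decaying solution is [c - l s] where [c] and [s] are the fundamental
    solutions at [Y] and [l] is the supremum of the increasing function
    [c' / s']: this choice makes the solution nonincreasing, and nonnegative
    because [c' / s'] never exceeds [c / s]. *)
Lemma decaying_solution Q Y : continuous Q -> (forall y, Y <= y -> 1 <= Q y) ->
  exists u v, [/\ solves Q u v, u Y = 1 & forall y, Y <= y -> `|u y| <= 1].
Proof.
move=> cQ Q1.
have [c [dc [cd dcd cY dcY]]] := ivp_exists cQ Y 1 0.
have [s [ds [sd dsd sY dsY]]] := ivp_exists cQ Y 0 1.
have ds1 z : Y <= z -> 1 <= ds z.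
  move=> Yz; rewrite -dsY; apply: (growing_slope (conj sd dsd) Q1) => //.
    by rewrite sY.
  by rewrite dsY.
have s0 z : Y < z -> 0 < s z.
  move=> Yz; have := @deriv_le_sub _ (fun y => y) (fun => 1) s ds Y z.
  rewrite sY subr0 => H.
  have : z - Y <= s z.
    apply: H => //; [by move=> x; der | exact: ltW |].
    by move=> x /andP[Yx _]; exact: ds1.
  lra.
have wr z : Y <= z -> c z * ds z - dc z * s z = 1.
  move=> Yz.
  have gd : has_deriv (fun y => c y * ds y - dc y * s y) (fun => 0).
    by move=> x; derive; ring.
  by rewrite -(deriv_eq0_eq gd Yz) // cY dsY sY; ring.
(* the solution with value [1] and slope [0] at [z] is nonnegative on the
   half-line: for [y > Y] this says that [c' / s'] at [z] is at most [c / s]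
   at [y] *)
have key z y : Y <= z -> Y <= y -> 0 <= c y * ds z - s y * dc z.
  move=> Yz Yy.
  pose e y := c y * ds z - s y * dc z; pose De y := dc y * ds z - ds y * dc z.
  have es : solves Q e De by split => x; rewrite /e /De; derive; ring.
  have ez : e z = 1 by rewrite /e -(wr z Yz); ring.
  have Dz : De z = 0 by rewrite /De; ring.
  have [zy|yz] := leP z y.
    have := @growing_value Q e De z es (fun y zy => Q1 y (le_trans Yz zy)).
    by rewrite ez Dz => /(_ ltr01 (lexx 0) y zy)[h _]; rewrite -/(e y); lra.
  have eD x : Y <= x -> x <= z -> e x * De x <= 0.
    move=> Yx xz; have := uv_nondecr es Q1 Yx xz.
    by rewrite Dz mulr0.
  have e1 x : Y <= x -> x <= z -> 1 <= e x ^+ 2.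
    move=> Yx xz; have <- : e z ^+ 2 = 1 by rewrite ez expr1n.
    apply: (deriv_le0_ge (sqr_deriv es) xz) => w /andP[xw wz].
    by have := eD w (le_trans Yx xw) wz; lra.
  rewrite -/(e y) leNgt; apply/negP => ey.
  have [|x /andP[x1 x2] ex] := zero_between (has_deriv_continuous es.1) (ltW yz).
    by rewrite ez; lra.
  by have := e1 x (le_trans Yy x1) x2; rewrite ex expr0n /= ler10.
pose S := [set dc z / ds z | z in [set z | Y <= z]].
have S0 : S !=set0 by exists (dc Y / ds Y); exists Y => /=.
have Sub y : Y < y -> ubound S (c y / s y).
  move=> Yy _ [z /= Yz <-].
  have := key z y Yz (ltW Yy); have := s0 y Yy; have := ds1 z Yz => h1 h2 h3.
  rewrite ler_pdivrMr; last lra.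
  rewrite mulrAC ler_pdivlMr //; lra.
pose l := sup S.
have l1 z : Y <= z -> dc z <= l * ds z.
  move=> Yz; have dz := ds1 z Yz; rewrite -ler_pdivrMr; last lra.
  apply: ub_le_sup; last by exists z.
  by exists (c (Y + 1) / s (Y + 1)); apply: Sub; rewrite ltrDl.
have l2 y : Y < y -> l * s y <= c y.
  move=> Yy; rewrite -ler_pdivlMr ?s0 //.
  by apply: ge_sup; [exact: S0 | exact: Sub].
exists (fun y => c y - l * s y), (fun y => dc y - l * ds y).
have us : solves Q (fun y => c y - l * s y) (fun y => dc y - l * ds y).
  by split=> x; derive; ring.
split=> //; first by rewrite cY sY mulr0 subr0.
move=> y; rewrite le_eqVlt => /predU1P[<-|Yy].
  by rewrite cY sY mulr0 subr0 normr1.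
rewrite ger0_norm ?subr_ge0 ?l2 //.
have := deriv_le0_ge us.1 (ltW Yy) _; rewrite cY sY mulr0 subr0; apply.
by move=> x /andP[Yx _]; have := l1 x Yx; lra.
Qed.

(** The Weyl solution at [+oo] for the energy [l]: boundedness singles it out
    when the potential exceeds [l] near [+oo]. *)
Definition weyl (Y : R) (q : R -> R) (l : R) (u v : R -> R) : Prop :=
  [/\ solves (fun y => q y - l) u v, u Y = 1 &
      exists C, forall y, Y <= y -> `|u y| <= C].

Lemma weyl_exists Y q l : continuous q -> (forall y, Y <= y -> 1 + l <= q y) ->
  exists u v, weyl Y q l u v.
Proof.
move=> cq q1.
have cQ : continuous (fun y => q y - l).
  by move=> x; apply: continuousB; [exact: cq | exact: cst_continuous].
have [|u [v [s uY ub]]] := decaying_solution (Y := Y) cQ.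
  by move=> y /q1; lra.
by exists u, v; split=> //; exists 1.
Qed.

Lemma weyl_tail Y q l u v : weyl Y q l u v ->
  (forall y, Y <= y -> 1 + l <= q y) ->
  forall y, Y <= y -> `|u y| <= expR (- (y - Y)) /\ `|v y| <= `|v Y|.
Proof.
move=> [s uY [C uC]] q1 y Yy.
have Q1 x : Y <= x -> 1 <= q x - l by move=> /q1; lra.
split; last exact: (decay_deriv s Q1 uC).
by have := decay s Q1 uC (lexx Y) Yy; rewrite uY normr1 mul1r.
Qed.

Lemma weyl_gt0 Y q l u v : continuous q -> weyl Y q l u v ->
  (forall y, Y <= y -> 1 + l <= q y) ->
  forall y, Y <= y -> 0 < u y.
Proof.
move=> cq [s uY [C uC]] q1 y Yy.
have Q1 x : Y <= x -> 1 <= q x - l by move=> /q1; lra.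
have cQ : continuous (fun y => q y - l).
  by move=> x; apply: continuousB; [exact: cq | exact: cst_continuous].
by apply: (constant_sign s Q1 uC cQ (lexx Y) Yy); rewrite uY.
Qed.

Lemma wronskian_small Y q1 q2 l1 l2 u1 v1 u2 v2 :
  weyl Y q1 l1 u1 v1 -> weyl Y q2 l2 u2 v2 ->
  (forall y, Y <= y -> 1 + l1 <= q1 y) -> (forall y, Y <= y -> 1 + l2 <= q2 y) ->
  forall e, 0 < e -> exists Z, forall z, Z <= z -> Y <= z ->
  `|v1 z * u2 z - u1 z * v2 z| <= e.
Proof.
move=> w1 w2 h1 h2 e e0.
have [Z hZ] := expR_small ((`|v1 Y| + `|v2 Y|) * expR Y) e0 ltr01.
exists Z => z Zz Yz; apply: le_trans (hZ z Zz).
have [a1 b1] := weyl_tail w1 h1 Yz; have [a2 b2] := weyl_tail w2 h2 Yz.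
apply: le_trans (ler_normB _ _) _.
rewrite [in leRHS]ger0_norm; last by rewrite mulr_ge0 ?addr_ge0 ?expR_ge0.
rewrite !normrM mul1r -[leRHS]mulrA -expRD mulrDl.
have -> : Y - z = - (z - Y) by ring.
by apply: lerD; [|rewrite mulrC]; apply: ler_pM.
Qed.

(** The Wronskian of two decaying solutions vanishes at [+oo], so its value at
    [Y] is, up to sign, the integral of [(l1 - l2) * u1 * u2], where both
    solutions are at most [expR (Y - y)]. *)
Lemma weyl_slope_lipschitz Y q1 q2 l1 l2 u1 v1 u2 v2 :
  weyl Y q1 l1 u1 v1 -> weyl Y q2 l2 u2 v2 ->
  (forall y, Y <= y -> 1 + l1 <= q1 y) -> (forall y, Y <= y -> 1 + l2 <= q2 y) ->
  (forall y, Y <= y -> q1 y = q2 y) ->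
  `|v1 Y - v2 Y| <= `|l1 - l2|.
Proof.
move=> w1 w2 h1 h2 q12.
have [[u1d v1d] u1Y _] := w1; have [[u2d v2d] u2Y _] := w2.
apply/ler_addgt0Pr => e e0.
have [Z hZ] := wronskian_small w1 w2 h1 h2 e0.
pose z := Num.max Y Z.
have Yz : Y <= z by rewrite le_max lexx.
have Zz : Z <= z by rewrite le_max lexx orbT.
have := hZ z Zz Yz.
pose W y := v1 y * u2 y - u1 y * v2 y.
have Wd : has_deriv W (fun y => (q1 y - l1 - (q2 y - l2)) * (u1 y * u2 y)).
  by move=> x; rewrite /W; derive; ring.
pose L := `|l1 - l2|.
have bnd x : Y <= x <= z -> `|(q1 x - l1 - (q2 x - l2)) * (u1 x * u2 x)| <= L * expR (2 * Y - 2 * x).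
  move=> /andP[Yx _]; rewrite q12 // !normrM.
  have [a1 _] := weyl_tail w1 h1 Yx; have [a2 _] := weyl_tail w2 h2 Yx.
  apply: ler_pM; rewrite ?mulr_ge0 //.
    by rewrite /L distrC le_eqVlt; apply/orP; left; apply/eqP; congr (`|_|); ring.
  have -> : 2 * Y - 2 * x = - (x - Y) + - (x - Y) by ring.
  by rewrite expRD; apply: ler_pM.
have L0 : 0 <= L by exact: normr_ge0.
have := increment_exp_decay Wd (ltr0n _ 2) L0 Yz bnd.
rewrite subrr expR0 mulr1 -/(W z) => inc Wz.
have -> : v1 Y - v2 Y = W z - (W z - W Y) by rewrite /W u1Y u2Y; ring.
apply: le_trans (ler_normB _ _) _; rewrite addrC lerD //.
by apply: (le_trans inc); rewrite ler_piMr // invf_le1 // ler1n.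
Qed.

(** Extracts both components from Gronwall's inequality, for an initial gap at
    most [L] and a forcing term [L * B]. *)
Lemma gronwall_arithmetic (x y s L B E X : R) : 0 <= B -> 0 <= L -> 1 <= E -> X <= E -> 0 <= X ->
  `|s| <= L -> x ^+ 2 + y ^+ 2 + (L * B) ^+ 2 <= (s ^+ 2 + (L * B) ^+ 2) * X ->
  `|x| <= (1 + B) * E * L /\ `|y| <= (1 + B) * E * L.
Proof.
move=> B0 L0 E1 XE X0 sL G.
have C0 : 0 <= (1 + B) * E * L by rewrite !mulr_ge0 ?addr_ge0 // (le_trans ler01).
have {}sL : s ^+ 2 <= L ^+ 2 by rewrite -[leLHS]real_normK ?num_real // ler_sqr ?nnegrE.
have {}G : x ^+ 2 + y ^+ 2 <= ((1 + B) * E * L) ^+ 2.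
  apply: (@le_trans _ _ ((L ^+ 2 + (L * B) ^+ 2) * E)).
    apply: (@le_trans _ _ ((s ^+ 2 + (L * B) ^+ 2) * X)).
      by apply: le_trans G; rewrite lerDl sqr_ge0.
    by apply: ler_pM => //; rewrite ?addr_ge0 ?sqr_ge0 // lerD2r.
  have -> : ((1 + B) * E * L) ^+ 2 = L ^+ 2 * (1 + B) ^+ 2 * E * E by ring.
  have -> : (L ^+ 2 + (L * B) ^+ 2) * E = L ^+ 2 * (1 + B ^+ 2) * E * 1 by ring.
  have E0 : 0 <= E := le_trans ler01 E1.
  apply: ler_pM => //; first by rewrite !mulr_ge0 ?addr_ge0 ?sqr_ge0.
  apply: ler_wpM2r => //; apply: ler_wpM2l; first exact: sqr_ge0.
  by have -> : (1 + B) ^+ 2 = 1 + B ^+ 2 + 2 * B by [ring]; rewrite lerDl mulr_ge0.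
split; rewrite -ler_sqr ?nnegrE // real_normK ?num_real //; apply: le_trans G.
  by rewrite lerDl sqr_ge0.
by rewrite lerDr sqr_ge0.
Qed.

(** The slopes at [Y] differ by at most [|l - l0|] and Gronwall's inequality
    propagates this over [[Z, Z2]]. The constant involves only the reference
    problem, hence it is uniform over the potentials which agree with [q] to the
    right of [Z]. *)
Lemma weyl_close_on Y Z Z2 q l0 u0 v0 : Z <= Y -> Y <= Z2 -> continuous q ->
  weyl Y q l0 u0 v0 ->
  (forall y, Y <= y -> 1 + l0 <= q y) ->
  exists2 C, 0 < C & forall q1 l u v, weyl Y q1 l u v ->
    (forall y, Z <= y -> q1 y = q y) ->
    (forall y, Y <= y -> 1 + l <= q y) -> `|l - l0| <= 1 ->
    forall y, Z <= y <= Z2 -> `|u y - u0 y| <= C * `|l - l0| /\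
                             `|v y - v0 y| <= C * `|l - l0|.
Proof.
move=> ZY YZ2 cq w0 h0; have [[u0d v0d] u0Y _] := w0.
have [M M0 hM] := continuous_bounded Z Z2 cq.
have [B B0 hB] := continuous_bounded Z Z2 (has_deriv_continuous u0d).
pose M1 := M + `|l0| + 1.
have M10 : 0 <= M1 by rewrite /M1; have := normr_ge0 l0; lra.
pose E := expR ((2 + M1) * (Z2 - Z)).
have ZZ2 := le_trans ZY YZ2.
have E1 : 1 <= E by rewrite /E -expR0 ler_expR mulr_ge0 ?subr_ge0 // addr_ge0.
exists ((1 + B) * E); first by rewrite mulr_gt0 //; lra.
move=> q1 l u v w hq h1 ll; have [[ud vd] uY _] := w.
pose L := `|l - l0|.
have h1' y : Y <= y -> 1 + l <= q1 y by move=> Yy; rewrite hq ?h1 // (le_trans ZY).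
have sl : `|v Y - v0 Y| <= L.
  by apply: weyl_slope_lipschitz w w0 h1' h0 _ => y Yy; rewrite hq // (le_trans ZY).
have wd : has_deriv (fun y => u y - u0 y) (fun y => v y - v0 y) by move=> x; der.
have dwd : has_deriv (fun y => v y - v0 y)
  (fun y => (q1 y - l) * u y - (q y - l0) * u0 y) by move=> x; der.
have L0 : 0 <= L by exact: normr_ge0.
have e0 : 0 <= L * B by rewrite mulr_ge0 // ltW.
have G := gronwall wd dwd M10 e0 (a := Z) (b := Z2) _.
move=> y yZY; have /andP[Zy yY] := yZY.
have {}G : (u y - u0 y) ^+ 2 + (v y - v0 y) ^+ 2 + (L * B) ^+ 2 <=
    ((u Y - u0 Y) ^+ 2 + (v Y - v0 Y) ^+ 2 + (L * B) ^+ 2) * expR ((2 + M1) * `|y - Y|).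
  apply: G => // [x xZY|]; last by rewrite ZY YZ2.
  have /andP[Zx xY] := xZY.
  rewrite hq // [X in `|X|](_ : _ = (q x - l) * (u x - u0 x) + (l0 - l) * u0 x); last by ring.
  apply: le_trans (ler_normD _ _) _; rewrite !normrM; apply: lerD.
    apply: ler_wpM2r => //; rewrite /M1.
    have -> : q x - l = (q x - l0) - (l - l0) by ring.
    apply: le_trans (ler_normB _ _) _; apply: lerD => //.
    by apply: le_trans (ler_normB _ _) _; rewrite lerD2r; exact: hM.
  by rewrite distrC; apply: ler_wpM2l => //; exact: hB.
have EE : expR ((2 + M1) * `|y - Y|) <= E.
  rewrite /E ler_expR; apply: ler_wpM2l; first by rewrite addr_ge0.
  by move: yZY ZY YZ2 => /andP[? ?] ? ?; rewrite ler_norml; apply/andP; split; lra.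
rewrite uY u0Y subrr expr0n add0r in G.
exact: gronwall_arithmetic (ltW B0) L0 E1 EE (expR_ge0 _) sl G.
Qed.

Lemma weyl_close Y Z q l0 u0 v0 : Z <= Y -> continuous q -> weyl Y q l0 u0 v0 ->
  (forall y, Y <= y -> 1 + l0 <= q y) ->
  exists2 C, 0 < C & forall q1 l u v, weyl Y q1 l u v ->
    (forall y, Z <= y -> q1 y = q y) ->
    (forall y, Y <= y -> 1 + l <= q y) -> `|l - l0| <= 1 ->
    forall y, Z <= y <= Y -> `|u y - u0 y| <= C * `|l - l0| /\
                             `|v y - v0 y| <= C * `|l - l0|.
Proof. by move=> ZY; exact: weyl_close_on ZY (lexx Y). Qed.

Lemma weyl_uniq Y Z q q1 l u v u1 v1 : Z <= Y -> continuous q ->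
  weyl Y q l u v -> weyl Y q1 l u1 v1 ->
  (forall y, Z <= y -> q1 y = q y) ->
  (forall y, Y <= y -> 1 + l <= q y) ->
  forall y, Z <= y <= Y -> u1 y = u y /\ v1 y = v y.
Proof.
move=> ZY cq w w1 hq h y yZY.
have [C C0 hC] := weyl_close ZY cq w h.
have := hC _ _ _ _ w1 hq h; rewrite subrr normr0 mulr0 => /(_ ler01 y yZY).
by rewrite !normr_le0 !subr_eq0 => -[/eqP -> /eqP ->].
Qed.

End WeylSolution.

(** * Bounded solutions on the line; the harmonic oscillator *)

Section BoundedSolutions.
Context {R : realType}.
Implicit Types (Q q u v f : R -> R) (Y y l C : R).

Lemma bounded_pieces f Y C1 C2 : continuous f ->
  (forall y, Y <= y -> `|f y| <= C1) -> (forall y, y <= - Y -> `|f y| <= C2) ->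
  exists C, forall y, `|f y| <= C.
Proof.
move=> cf h1 h2; have [M M0 hM] := continuous_bounded (- Y) Y cf.
exists (`|C1| + `|C2| + M) => y.
have := normr_ge0 C1; have := normr_ge0 C2; have := ler_norm C1; have := ler_norm C2.
have [Yy|yY] := leP Y y; first by have := h1 y Yy; lra.
have [Yy|yY2] := leP y (- Y); first by have := h2 y Yy; lra.
by have := hM y; rewrite (ltW yY) (ltW yY2) => /(_ isT); lra.
Qed.

(** A bound state is a nonzero bounded solution; boundedness is equivalent to
    square integrability since the potential exceeds the energy by [1] outside
    [[-Y, Y]]. *)
Section BoundState.
Variables (q u v : R -> R) (Y l C : R).
Hypothesis Y0 : 0 <= Y.
Hypothesis cq : continuous q.
Hypothesis q1 : forall y, Y <= `|y| -> 1 + l <= q y.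
Hypothesis s : solves (fun y => q y - l) u v.
Hypothesis uC : forall y, `|u y| <= C.

Let cQ : continuous (fun y => q y - l).
Proof. by move=> x; apply: continuousB; [exact: cq | exact: cst_continuous]. Qed.

Let Q1 y : Y <= y -> 1 <= q y - l.
Proof.
move=> Yy; have : 1 + l <= q y by apply: q1; rewrite ger0_norm // (le_trans Y0).
lra.
Qed.

Let Q2 y : y <= - Y -> 1 <= q y - l.
Proof.
move=> Yy; have yn : y <= 0 by apply: (le_trans Yy); rewrite oppr_le0.
have : 1 + l <= q y by apply: q1; rewrite ler0_norm; lra.
by lra.
Qed.

Lemma bound_state_decay y : `|u y| <= C * expR Y * expR (- `|y|).
Proof.
have C0 : 0 <= C := le_trans (normr_ge0 _) (uC 0).
rewrite -mulrA -expRD.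
have [Yy|yY] := leP Y y.
  apply: le_trans (decay s Q1 (fun y _ => uC y) (lexx Y) Yy) _.
  have -> : `|y| = y by rewrite ger0_norm // (le_trans Y0).
  have -> : - (y - Y) = Y - y by ring.
  by apply: ler_pM => //; exact: expR_ge0.
have [Yy|yY2] := leP y (- Y).
  apply: le_trans (decay_left s Q2 (fun y _ => uC y) (lexx (- Y)) Yy) _.
  have -> : `|y| = - y by rewrite ler0_norm // (le_trans Yy) // oppr_le0.
  have -> : - (- Y - y) = Y - - y by ring.
  by apply: ler_pM => //; exact: expR_ge0.
apply: le_trans (uC y) _; rewrite -[leLHS]mulr1; apply: ler_wpM2l => //.
rewrite -expR0 ler_expR subr_ge0 ler_norml; apply/andP; split; lra.
Qed.

Lemma bound_state_deriv_bounded : exists K, forall y, `|v y| <= K.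
Proof.
apply: (@bounded_pieces v Y `|v Y| `|v (- Y)|).
- exact: has_deriv_continuous s.2.
- by move=> y Yy; have := decay_deriv s Q1 (fun y _ => uC y) (lexx Y) Yy.
- by move=> y Yy; have := decay_deriv_left s Q2 (fun y _ => uC y) (lexx _) Yy.
Qed.

Hypothesis u0 : exists y, u y != 0.

Lemma bound_state_neq0 y : Y <= y -> u y != 0.
Proof.
move=> Yy; apply/eqP => uy; have [x /eqP] := u0; apply.
exact: (nonvanishing s Q1 (fun y _ => uC y) cQ Yy uy).
Qed.

Lemma bound_state_neq0_left y : y <= - Y -> u y != 0.
Proof.
move=> Yy; apply/eqP => uy; have [x /eqP] := u0; apply.
exact: (nonvanishing_left s Q2 (fun y _ => uC y) cQ Yy uy).
Qed.

(** If [l <= 0], then [u * v] does not decrease on the line, although it is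
    nonnegative at [- Y] and negative at [Y]. *)
Lemma bound_state_energy_gt0 : (forall y, 0 <= q y) -> 0 < l.
Proof.
move=> q0; rewrite ltNge; apply/negP => l0.
have YY : - Y <= Y by have := Y0; lra.
have h1 := uv_ge0_left s Q2 (fun y _ => uC y) (lexx (- Y)).
have h2 := uv_le_Nsqr s Q1 (fun y _ => uC y) (lexx Y).
have h3 : u (- Y) * v (- Y) <= u Y * v Y.
  apply: (deriv_ge0_le (uv_deriv s) YY) => x _.
  have := q0 x => qx; rewrite addr_ge0 ?sqr_ge0 // mulr_ge0 ?sqr_ge0 //; lra.
have : u Y != 0 by exact: bound_state_neq0.
rewrite -sqrf_eq0 => /eqP; apply; have := sqr_ge0 (u Y); lra.
Qed.

End BoundState.
End BoundedSolutions.

Definition osc (R : realType) (y : R) : R := y ^+ 2.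

Section Oscillator.
Context {R : realType}.
Implicit Types (u v F : R -> R) (y l C : R).

Lemma osc_continuous : continuous (@osc R).
Proof. by move=> x; exact: exprn_continuous. Qed.

Lemma osc_ge0 y : 0 <= osc y.
Proof. exact: sqr_ge0. Qed.

Lemma osc_large l y : 1 + `|l| <= `|y| -> 1 + l <= osc y.
Proof.
move=> h; rewrite /osc -real_normK ?num_real //.
have := ler_norm l; have := normr_ge0 l; nra.
Qed.

Lemma mul_expN_le (Y y : R) : Y <= y -> 0 <= Y -> y * expR (- (y - Y)) <= Y + 1.
Proof.
move=> Yy Y0; rewrite expRN ler_pdivrMr ?expR_gt0 //.
have := expR_ge1Dx (y - Y); set E := expR _ => h.
have ? : 0 <= Y * (y - Y) by rewrite mulr_ge0 // subr_ge0.
have : (Y + 1) * (1 + (y - Y)) <= (Y + 1) * E by apply: ler_wpM2l => //; lra.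
lra.
Qed.

(** The annihilation operator [d/dy + y] lowers the energy of a bounded
    solution by [2], and only kills solutions of energy [1]; since energies of
    bound states are positive, iterating it shows that they are odd
    integers. *)
Lemma oscillator_spectrum l u v C : solves (fun y => osc y - l) u v ->
  (forall y, `|u y| <= C) -> (exists y, u y != 0) ->
  exists m : nat, l = m.*2.+1%:R.
Proof.
have [N lN] : exists N : nat, l < N.*2%:R.
  exists (Num.truncn `|l|).+1; apply: le_lt_trans (ler_norm l) _.
  apply: lt_le_trans (truncnS_gt _) _; by rewrite ler_nat -addnn leq_addr.
elim: N l lN u v C => [|N IH] l lN u v C s uC u0.
  have Y0 : 0 <= 1 + `|l| by rewrite addr_ge0.
  have := bound_state_energy_gt0 Y0 osc_continuous (@osc_large l) s uC u0 osc_ge0.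
  by move: lN; rewrite double0 => /ltW; rewrite leNgt => /negP.
have [ud vd] := s; rewrite /osc in vd.
pose w y := v y + y * u y; pose dw y := y * w y - (l - 1) * u y.
have ws : solves (fun y => osc y - (l - 2)) w dw.
  by split=> x; rewrite /w /dw /w; derive; rewrite /osc; ring.
have Y0 : 0 <= 1 + `|l| by rewrite addr_ge0.
pose Y : R := 1 + `|l|; have := @osc_large l; rewrite -/Y => q1.
have C0 : 0 <= C := le_trans (normr_ge0 _) (uC 0).
have [K hK] := bound_state_deriv_bounded Y0 q1 s uC.
have wB y : `|w y| <= K + C * expR Y.
  apply: le_trans (ler_normD _ _) _; apply: lerD; first exact: hK.
  rewrite normrM mulrC; have := bound_state_decay Y0 q1 s uC y => h.
  apply: le_trans (ler_wpM2r (normr_ge0 y) h) _.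
  have -> : C * expR (1 + `|l|) * expR (- `|y|) * `|y| =
      C * expR Y * (`|y| * expR (- `|y|)) by rewrite /Y; ring.
  rewrite -[leRHS]mulr1; apply: ler_wpM2l; first by rewrite mulr_ge0 ?expR_ge0.
  have := mul_expN_le (normr_ge0 y) (lexx 0); rewrite subr0 add0r; exact.
have [[y wy]|nw] := pselect (exists y, w y != 0).
  have l2 : l - 2 < N.*2%:R.
    by move: lN; rewrite doubleS -[_.+2%:R]natr1 -[_.+1%:R]natr1; lra.
  have [m lm] := IH (l - 2) l2 w dw _ ws wB (ex_intro _ y wy).
  exists m.+1; rewrite doubleS -[_.+3%:R]natr1 -[_.+2%:R]natr1 -lm; lra.
exists 0%N; have w0 y : w y = 0.
  by apply/eqP; apply: contra_notT nw => wy; exists y.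
have [y uy] := u0.
have dw0 : dw =1 (fun=> 0).
  move=> x; have wd := ws.1 x; have wE : w = cst 0 by apply/funext.
  rewrite wE in wd; rewrite -(@derive_val _ _ _ _ _ _ _ wd); exact: derive_cst.
have := dw0 y; rewrite /dw w0 mulr0 sub0r => /eqP.
rewrite oppr_eq0 mulf_eq0 (negbTE uy) orbF subr_eq0 => /eqP ->.
by [].
Qed.

End Oscillator.

(** * Hermite functions *)

Section Hermite.
Context {R : realType}.
Implicit Types (y e T : R) (n : nat).

(** The pair [(H_n, H_{n-1})], with [H_{-1} = 0]. *)
Fixpoint hermite_pair n y : R * R :=
  if n is m.+1 then
    let p := hermite_pair m y in (2 * y * p.1 - 2 * m%:R * p.2, p.1)
  else (1, 0).

Definition hermite n y : R := (hermite_pair n y).1.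

Lemma hermite0 y : hermite 0 y = 1.
Proof. by []. Qed.

Lemma hermiteS n y :
  hermite n.+1 y = 2 * y * hermite n y - 2 * n%:R * hermite n.-1 y.
Proof. by case: n => [|n] //; rewrite /hermite /= !mulr0 !mul0r. Qed.

Lemma hermite_deriv n :
  has_deriv (hermite n) (fun y => 2 * n%:R * hermite n.-1 y).
Proof.
suff : has_deriv (hermite n) (fun y => 2 * n%:R * hermite n.-1 y) /\
       has_deriv (hermite n.+1) (fun y => 2 * n.+1%:R * hermite n y) by case.
elim: n => [|n [IH1 IH2]]; split.
- by move=> x; rewrite mulr0 mul0r; exact: der_cst.
- have -> : hermite 1 = fun y => 2 * y.
    by apply/funext => y; rewrite hermiteS hermite0; ring.
  by move=> x; derive; rewrite hermite0; ring.
- exact: IH2.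
- have -> : hermite n.+2 = fun y => 2 * y * hermite n.+1 y - 2 * n.+1%:R * hermite n y.
    by apply/funext => y; rewrite hermiteS.
  have e := hermiteS n.
  move=> x; derive; rewrite /= -[n.+2%:R]natr1; ring: (e x).
Qed.

Definition hermite_fun n y : R := hermite n y * expR (- (y ^+ 2 / 2)).

Definition hermite_fun_deriv n y : R :=
  2 * n%:R * hermite_fun n.-1 y - y * hermite_fun n y.

Lemma hermite_fun_der n : has_deriv (hermite_fun n) (hermite_fun_deriv n).
Proof.
have hd := hermite_deriv n.
by move=> x; rewrite /hermite_fun /hermite_fun_deriv /hermite_fun; derive; rewrite /=; field.
Qed.

Lemma hermite_fun_raise n y :
  hermite_fun n.+1 y = y * hermite_fun n y - hermite_fun_deriv n y.
Proof. by rewrite /hermite_fun_deriv /hermite_fun hermiteS; ring. Qed.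

Lemma hermite_fun_lower n y :
  hermite_fun_deriv n.+1 y = 2 * n.+1%:R * hermite_fun n y - y * hermite_fun n.+1 y.
Proof. by []. Qed.

Lemma hermite_fun_solves n :
  solves (fun y => osc y - n.*2.+1%:R) (hermite_fun n) (hermite_fun_deriv n).
Proof.
split; first exact: hermite_fun_der.
have d1 := hermite_fun_der n.-1; have d2 := hermite_fun_der n.
move=> x; rewrite {1}/hermite_fun_deriv; derive.
rewrite -[n.*2.+1%:R]natr1 -mul2n natrM /osc.
case: n {d1 d2} => [|n] /=; first by rewrite /hermite_fun_deriv; ring.
rewrite /hermite_fun_deriv /= /hermite_fun [hermite n.+1 x]hermiteS -[n.+1%:R]natr1.
by ring.
Qed.

(** The exponential is the power [n] of an exponential, which is at least its
    first-order expansion. *)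
Lemma polynomial_gaussian_bounded n :
  exists C, forall y, (1 + `|y|) ^+ n * expR (- (y ^+ 2 / 2)) <= C.
Proof.
case: n => [|n].
  exists 1 => y; rewrite expr0 mul1r -expR0 ler_expR oppr_le0.
  by rewrite divr_ge0 ?sqr_ge0.
exists ((2 * n.+1%:R) ^+ n.+1) => y.
rewrite expRN ler_pdivrMr ?expR_gt0 //.
have split_exp (N : R) : N != 0 -> y ^+ 2 / 2 = N * (y ^+ 2 / (2 * N)).
  by move=> N0; field.
rewrite (split_exp n.+1%:R) ?pnatr_eq0 // expRM_natl -exprMn; apply: lerXn2r; rewrite ?nnegrE ?addr_ge0 ?mulr_ge0 ?expR_ge0 //.
set N : R := n.+1%:R.
have N1 : 1 <= N by rewrite /N ler1n.
have := expR_ge1Dx (y ^+ 2 / (2 * N)); set E := expR _ => h.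
have : 2 * N * (1 + y ^+ 2 / (2 * N)) <= 2 * N * E by apply: ler_wpM2l => //; lra.
apply: le_trans.
have -> : 2 * N * (1 + y ^+ 2 / (2 * N)) = 2 * N + y ^+ 2.
  by field; rewrite gt_eqF //; lra.
rewrite -[y ^+ 2]real_normK ?num_real //; have := sqr_ge0 (`|y| - 1); nra.
Qed.

Lemma hermite_growth n : exists2 c : R, 0 <= c & forall y, `|hermite n y| <= c * (1 + `|y|) ^+ n.
Proof.
suff : (exists2 c : R, 0 <= c & forall y, `|hermite n y| <= c * (1 + `|y|) ^+ n) /\
       (exists2 c : R, 0 <= c & forall y, `|hermite n.+1 y| <= c * (1 + `|y|) ^+ n.+1) by case.
elim: n => [|n [[c c0 hc] [d d0 hd]]]; split.
- by exists 1 => // y; rewrite hermite0 expr0 mulr1 normr1.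
- exists 2 => // y; rewrite hermiteS hermite0 !mulr0 mul0r subr0 mulr1 expr1.
  by rewrite normrM ger0_norm // ler_wpM2l // lerDr.
- by exists d.
- exists (2 * d + 2 * n.+1%:R * c); first by rewrite addr_ge0 // !mulr_ge0.
  move=> y; rewrite hermiteS /=; apply: le_trans (ler_normB _ _) _.
  rewrite !normrM !(ger0_norm (ler0n _ _)) [leRHS]mulrDl.
  have a1 : 1 <= 1 + `|y| by rewrite lerDl.
  apply: lerD.
    have -> : 2 * d * (1 + `|y|) ^+ n.+2 = (2 * (1 + `|y|)) * (d * (1 + `|y|) ^+ n.+1).
      by rewrite [_ ^+ n.+2]exprS; ring.
    apply: ler_pM => //; apply: ler_wpM2l => //; lra.
  rewrite -[leRHS]mulrA; apply: ler_wpM2l; first by rewrite mulr_ge0.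
  apply: le_trans (hc y) _; apply: ler_wpM2l => //.
  by apply: ler_weXn2l => //; rewrite ltnW // .
Qed.

Lemma hermite_fun_bounded n : exists C, forall y, `|hermite_fun n y| <= C.
Proof.
have [c c0 hc] := hermite_growth n.
have [C hC] := polynomial_gaussian_bounded n.
exists (c * C) => y; rewrite /hermite_fun normrM (ger0_norm (expR_ge0 _)).
apply: (@le_trans _ _ (c * (1 + `|y|) ^+ n * expR (- (y ^+ 2 / 2)))).
  by apply: ler_wpM2r; rewrite ?expR_ge0.
by rewrite -mulrA; apply: ler_wpM2l.
Qed.

(** In the three-term recurrence the term with [H_(n-1)] is of lower order;
    the induction carries two consecutive indices. *)
Lemma hermite_leading n e : 0 < e -> exists2 T : R, 0 < T & forall y, T <= `|y| ->
  `|hermite n y - (2 * y) ^+ n| <= e * `|2 * y| ^+ n.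
Proof.
move=> e0.
suff H : forall n e, 0 < e ->
    (exists2 T : R, 0 < T & forall y, T <= `|y| ->
      `|hermite n y - (2 * y) ^+ n| <= e * `|2 * y| ^+ n) /\
    (exists2 T : R, 0 < T & forall y, T <= `|y| ->
      `|hermite n.+1 y - (2 * y) ^+ n.+1| <= e * `|2 * y| ^+ n.+1).
  by have [] := H n e e0.
move=> {n e e0}; elim=> [|n IH] e e0; split.
- exists 1 => // y _; rewrite hermite0 !expr0 subrr normr0; lra.
- exists 1 => // y _; rewrite hermiteS hermite0 !mulr0 mul0r subr0 mulr1 expr1 subrr normr0.
  by rewrite mulr_ge0 // ?exprn_ge0 // ltW.
- by have [] := IH e e0.
- have e2 : 0 < e / 2 by lra.
  have [[T1 T10 h1] [T2 T20 h2]] := IH _ e2.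
  have [[T3 T30 h3] _] := IH 1 ltr01.
  pose N : R := n.+1%:R.
  have N0 : 0 <= N by exact: ler0n.
  pose T4 := 1 + 8 * N / e.
  have T41 : 1 <= T4 by rewrite /T4 lerDl divr_ge0 ?mulr_ge0 // ltW.
  exists (T2 + T3 + T4); first lra.
  move=> y yT; have y2 : T2 <= `|y| by lra.
  have y3 : T3 <= `|y| by lra.
  have y4 : T4 <= `|y| by lra.
  have := h2 y y2; have := h3 y y3.
  have -> : hermite n.+2 y - (2 * y) ^+ n.+2 =
     2 * y * (hermite n.+1 y - (2 * y) ^+ n.+1) - 2 * N * hermite n y.
    by rewrite hermiteS /= exprS; ring.
  move=> b1 b2.
  have b3 : `|hermite n y| <= 2 * `|2 * y| ^+ n.
    have -> : hermite n y = (hermite n y - (2 * y) ^+ n) + (2 * y) ^+ n by ring.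
    apply: le_trans (ler_normD _ _) _; rewrite normrX; lra.
  apply: le_trans (ler_normB _ _) _.
  rewrite normrM [X in _ + X]normrM [`|2 * N|]ger0_norm; last by rewrite mulr_ge0.
  set a := `|2 * y| in b1 b2 b3 *.
  have a2 : a = 2 * `|y| by rewrite /a normrM ger0_norm.
  have a0 : 0 <= a by rewrite /a.
  have an : 0 <= a ^+ n by rewrite exprn_ge0.
  have k1 : a * `|hermite n.+1 y - (2 * y) ^+ n.+1| <= a * (e / 2 * a ^+ n.+1).
    by apply: ler_wpM2l.
  have k2 : 2 * N * `|hermite n y| <= 2 * N * (2 * a ^+ n).
    by apply: ler_wpM2l => //; rewrite mulr_ge0.
  have k3 : 4 * N <= e / 2 * (a * a).
    have ea : 8 * N <= e * `|y|.
      have : e * (8 * N / e) <= e * `|y|.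
        by apply: ler_wpM2l; [exact: ltW | rewrite /T4 in y4; lra].
      by rewrite mulrC divfK ?gt_eqF.
    have aa : 1 <= a by rewrite a2; lra.
    have : e / 2 * `|y| * 1 <= e / 2 * a * a.
      apply: ler_pM => //; first by rewrite mulr_ge0 // ltW.
      by apply: ler_wpM2l; [lra | rewrite a2; lra].
    lra.
  have : 4 * N * a ^+ n <= e / 2 * (a * a) * a ^+ n by apply: ler_wpM2r.
  rewrite !exprS in k1 *; lra.
Qed.

Lemma hermite_fun_neq0 n : exists y, hermite_fun n y != 0.
Proof.
have h2 : (0 : R) < 1 / 2 by lra.
have [T T0 h] := hermite_leading n h2.
have := h T; rewrite ger0_norm ?(ltW T0) // => /(_ (lexx T)) hT.
exists T; apply/eqP; rewrite /hermite_fun => /eqP.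
rewrite mulf_eq0 [expR _ == 0]gt_eqF ?expR_gt0 // orbF => /eqP hz.
have p : 0 < `|2 * T| ^+ n by rewrite exprn_gt0 // normr_gt0 mulf_neq0 // gt_eqF.
move: hT; rewrite hz sub0r normrN normrX; lra.
Qed.

(** The integral over the line of the square of [hermite_fun n]. *)
Definition hermite_norm n : R := 2 ^+ n * n`!%:R * Num.sqrt pi.

Lemma hermite_norm_gt0 n : 0 < hermite_norm n.
Proof. by rewrite !mulr_gt0 ?exprn_gt0 ?ltr0n ?fact_gt0 ?sqrtr_gt0 ?pi_gt0. Qed.

(** Formulated for an arbitrary primitive, so that reflection gives the other
    half-line. *)
Lemma gauss_primitive (F : R -> R) e : has_deriv F (fun y => expR (- y ^+ 2)) ->
  0 < e -> exists Z, forall z, Z <= z -> `|F z - F 0 - Num.sqrt pi / 2| <= e.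
Proof.
move=> Fd e0.
have cg : continuous (@gauss_fun R) := @continuous_gauss_fun R.
have Fz z : 0 <= z -> F z - F 0 = gauss_integral_proof.integral0_gauss z.
  move=> z0; have gd := oriented_integral_deriv 0 cg.
  have -> : gauss_integral_proof.integral0_gauss z = oriented_integral (@gauss_fun R) 0 z.
    by rewrite /oriented_integral z0.
  have hd : has_deriv (fun y => F y - oriented_integral (@gauss_fun R) 0 y) (fun => 0).
    by move=> x; derive; rewrite /gauss_fun subrr.
  have := deriv_eq0_eq hd z0 (fun _ _ => erefl).
  rewrite oriented_integral_base; lra.
have cvg_Ig : @gauss_integral_proof.integral0_gauss R x @[x --> +oo] --> Num.sqrt pi / 2.
  have : Num.sqrt (@gauss_integral_proof.integral0_gauss R x ^+ 2) @[x --> +oo]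
      --> Num.sqrt (pi / 4).
    apply: continuous_cvg => //;
      [exact: sqrt_continuous|exact: gauss_integral_proof.cvg_integral0_gauss_sqr].
  rewrite sqrtrM ?pi_ge0// sqrtrV// (_ : 4 = 2 ^+ 2); last first.
    by rewrite expr2 -natrM.
  rewrite sqrtr_sqr ger0_norm//.
  rewrite (_ : (fun _ => Num.sqrt _) = gauss_integral_proof.integral0_gauss)//.
  apply/funext => r; rewrite sqrtr_sqr// ger0_norm//.
  exact: gauss_integral_proof.integral0_gauss_ge0.
have /cvgrPdist_le /(_ e e0) [M [_ hM]] := cvg_Ig.
exists (`|M| + 1) => z zM.
rewrite Fz; last by apply: le_trans zM; rewrite addr_ge0.
rewrite distrC; apply: hM; apply: lt_le_trans zM.
by rewrite (le_lt_trans (ler_norm M)) // ltrDl.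
Qed.

(** The relation [(phi_(n+1) phi_n)' = 2 (n+1) phi_n^2 - phi_(n+1)^2], where
    [phi_n] is [hermite_fun n], gives the ratio of consecutive norms; the
    first norm is the Gaussian integral. *)
Lemma hermite_fun_norm n (F : R -> R) e :
  has_deriv F (fun y => hermite_fun n y ^+ 2) -> 0 < e ->
  exists Z, forall z z', Z <= z -> Z <= z' -> `|F z - F (- z') - hermite_norm n| <= e.
Proof.
elim: n F e => [|n IH] F e Fd e0.
  have e2 : 0 < e / 2 by lra.
  have E y : hermite_fun 0 y ^+ 2 = expR (- y ^+ 2).
    by rewrite /hermite_fun hermite0 mul1r -expRM_natl; congr expR; field.
  have F1 : has_deriv F (fun y => expR (- y ^+ 2)).
    by move=> x; have := Fd x; rewrite E.
  have F2 : has_deriv (fun y => - F (- y)) (fun y => expR (- y ^+ 2)).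
    by move=> x; derive; rewrite sqrrN; ring.
  have [Z1 h1] := gauss_primitive F1 e2; have [Z2 h2] := gauss_primitive F2 e2.
  exists (Num.max Z1 Z2) => z z'; rewrite !ge_max => /andP[/h1 a1 _] /andP[_ /h2 a2].
  move: a1 a2; rewrite /hermite_norm fact0 expr0 !mul1r oppr0 !ler_norml.
  by move=> /andP[? ?] /andP[? ?]; apply/andP; split; lra.
have d1 := hermite_fun_der n; have d2 := hermite_fun_der n.+1.
pose N : R := 2 * n.+1%:R.
have N0 : 0 < N by rewrite mulr_gt0.
have [F1 [F1d _]] : exists F1 : R -> R, has_deriv F1 (fun y => hermite_fun n y ^+ 2) /\ F1 0 = 0.
  apply: primitive_exists.
  by apply: (@has_deriv_continuous _ _ (fun y => 2 * hermite_fun n y * hermite_fun_deriv n y)) => x; derive; rewrite /=; ring.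
have e2 : 0 < e / (2 * N) by rewrite divr_gt0 // mulr_gt0.
have [Z1 h1] := IH F1 _ F1d e2.
pose p y := hermite_fun n.+1 y * hermite_fun n y.
have cd : has_deriv (fun y => F y + p y - N * F1 y) (fun => 0).
  move=> x; rewrite /p; derive.
  rewrite hermite_fun_lower {1 2}hermite_fun_raise /N; rewrite (_ : hermite_fun_deriv n x = x * hermite_fun n x - hermite_fun n.+1 x); last first.
    by rewrite hermite_fun_raise; ring.
  by ring.
have [C hC] := hermite_fun_bounded n.+1; have [D hD] := hermite_fun_bounded n.
have Y0 : 0 <= 1 + `|n.*2.+1%:R : R| by rewrite addr_ge0.
have dec := bound_state_decay Y0 (@osc_large R n.*2.+1%:R) (hermite_fun_solves n) hD.
have C0 : 0 <= C := le_trans (normr_ge0 _) (hC 0).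
have e4 : 0 < e / 4 by lra.
have [Z2 h2] := expR_small (C * (D * expR (1 + `|n.*2.+1%:R : R|))) e4 ltr01.
exists (Num.max 0 (Num.max Z1 Z2)) => z z'.
rewrite !ge_max => /and3P[z0 zZ1 zZ2] /and3P[z0' zZ1' zZ2'].
have ps y : Z2 <= `|y| -> `|p y| <= e / 4.
  move=> yZ; apply: le_trans (h2 _ yZ).
  apply: le_trans (_ : _ <= C * (D * expR (1 + `|n.*2.+1%:R : R|) * expR (- `|y|))) _.
    by rewrite /p normrM; apply: ler_pM => //; exact: dec.
  rewrite mul1r mulrA; apply: ler_wpM2r; [exact: expR_ge0 | exact: ler_norm].
have p1 : `|p z| <= e / 4 by apply: ps; rewrite ger0_norm.
have p2 : `|p (- z')| <= e / 4 by apply: ps; rewrite normrN ger0_norm.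
have zz : - z' <= z by lra.
have := deriv_eq0_eq cd zz (fun _ _ => erefl).
have := h1 z z' zZ1 zZ1' => a1 a2.
have a3 : `|N * (F1 z - F1 (- z') - hermite_norm n)| <= e / 2.
  rewrite normrM (gtr0_norm N0); apply: le_trans (ler_wpM2l (ltW N0) a1) _.
  by rewrite le_eqVlt; apply/orP; left; apply/eqP; field; rewrite gt_eqF.
have a4 : hermite_norm n.+1 = N * hermite_norm n.
  by rewrite /hermite_norm factS natrM exprS /N; ring.
rewrite a4; move: a3 p1 p2; rewrite !ler_norml => /andP[? ?] /andP[? ?] /andP[? ?].
by apply/andP; split; lra.
Qed.

End Hermite.

(** * Counting the eigenvalues of a truncated oscillator *)

Section Eigenstates.
Context {R : realType}.
Implicit Types (Q q u v f F : R -> R) (Y y l C e t : R).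

(** Eigenfunctions are normalised at [Y], where they do not vanish, so that
    those of different potentials and energies can be compared. *)
Definition eigenstate Y q l u v : Prop :=
  weyl Y q l u v /\ exists C, forall y, `|u y| <= C.

Definition eigenlevel Y q l : Prop := exists u v, eigenstate Y q l u v.

Definition confining Y q l : Prop := forall y, Y <= `|y| -> 1 + l <= q y.

Lemma confining_right Y q l : 0 <= Y -> confining Y q l ->
  forall y, Y <= y -> 1 + l <= q y.
Proof. by move=> Y0 h y Yy; apply: h; rewrite ger0_norm // (le_trans Y0). Qed.

Lemma confining_left Y q l : 0 <= Y -> confining Y q l ->
  forall y, y <= - Y -> 1 <= q y - l.
Proof.
move=> Y0 h y Yy; have : 1 + l <= q y.
  by apply: h; rewrite ler0_norm; lra.
lra.
Qed.

Lemma shift_continuous q l : continuous q -> continuous (fun y => q y - l).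
Proof. by move=> cq x; apply: continuousB; [exact: cq | exact: cst_continuous]. Qed.

Lemma bounded_solution_eigenlevel Y q l u v C : 0 <= Y -> continuous q ->
  confining Y q l -> solves (fun y => q y - l) u v -> (forall y, `|u y| <= C) ->
  (exists y, u y != 0) -> eigenlevel Y q l.
Proof.
move=> Y0 cq q1 s uC u0; have uY := bound_state_neq0 Y0 cq q1 s uC u0 (lexx Y).
have b y : `|(u Y)^-1 * u y| <= `|(u Y)^-1| * C by rewrite normrM ler_wpM2l.
exists (fun y => (u Y)^-1 * u y), (fun y => (u Y)^-1 * v y); split.
  split; [exact: solves_scale | by rewrite mulVf |].
  by exists (`|(u Y)^-1| * C) => y _.
by exists (`|(u Y)^-1| * C).
Qed.

Lemma weyl_neq0 Y q l u v : weyl Y q l u v -> exists y, u y != 0.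
Proof. by move=> [_ uY _]; exists Y; rewrite uY oner_neq0. Qed.

(** If [u * v] is nonnegative on the left then [u ^+ 2] does not grow towards
    [-oo]. Hence a decaying solution that is not an eigenstate has [u * v < 0]
    at some point, from which on it escapes to infinity; this open condition
    is the basis of the counting of eigenvalues. *)
Lemma weyl_escape Y q l u v : 0 <= Y -> confining Y q l -> weyl Y q l u v ->
  (forall y, y <= - Y -> 0 <= u y * v y) -> eigenstate Y q l u v.
Proof.
move=> Y0 q1 w h; split => //; have [[ud vd] _ [C uC]] := w.
apply: (@bounded_pieces _ u Y C `|u (- Y)|) => //.
  exact: has_deriv_continuous ud.
move=> y Yy; rewrite -ler_sqr ?nnegrE // !real_normK ?num_real //.
have gd : has_deriv (fun y => u y ^+ 2) (fun y => 2 * (u y * v y)).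
  by move=> x; derive; rewrite /=; ring.
apply: (deriv_ge0_le gd Yy) => x /andP[_ xY].
by rewrite mulr_ge0 // h.
Qed.

Lemma eigenstate_uv_ge0 Y q l u v : 0 <= Y -> confining Y q l ->
  eigenstate Y q l u v -> forall y, y <= - Y -> 0 <= u y * v y.
Proof.
move=> Y0 q1 [[s _ _] [C uC]] y Yy.
exact: (uv_ge0_left s (confining_left Y0 q1) (fun y _ => uC y) Yy).
Qed.

Lemma eigenstate_same_sign_left Y q l u v : 0 <= Y -> continuous q ->
  confining Y q l -> eigenstate Y q l u v ->
  forall y y1, y <= - Y -> y1 <= - Y -> 0 < u y * u y1.
Proof.
move=> Y0 cq q1 [w [C uC]]; have [s _ _] := w; have u0 := weyl_neq0 w.
have cu := has_deriv_continuous s.1.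
have main y y1 : y <= y1 -> y1 <= - Y -> 0 < u y * u y1.
  move=> yy Yy1; rewrite ltNge; apply/negP => h.
  have [c /andP[_ c1] uc] := zero_between cu yy h.
  have := bound_state_neq0_left Y0 cq q1 s uC u0 (le_trans c1 Yy1).
  by rewrite uc eqxx.
move=> y y1 Yy Yy1; have [yy|yy] := leP y y1; first exact: main.
by rewrite mulrC; apply: main => //; exact: ltW.
Qed.

Lemma eigenstate_wronskian_small Y q1 q2 l1 l2 u1 v1 u2 v2 : 0 <= Y ->
  confining Y q1 l1 -> confining Y q2 l2 ->
  eigenstate Y q1 l1 u1 v1 -> eigenstate Y q2 l2 u2 v2 ->
  forall e, 0 < e -> exists Z, forall y, Z <= `|y| ->
  `|v1 y * u2 y - u1 y * v2 y| <= e.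
Proof.
move=> Y0 h1 h2 [[s1 _ _] [C1 b1]] [[s2 _ _] [C2 b2]] e e0.
have [K1 k1] := bound_state_deriv_bounded Y0 h1 s1 b1.
have [K2 k2] := bound_state_deriv_bounded Y0 h2 s2 b2.
have d1 := bound_state_decay Y0 h1 s1 b1; have d2 := bound_state_decay Y0 h2 s2 b2.
have [Z hZ] := expR_small (K1 * (C2 * expR Y) + K2 * (C1 * expR Y)) e0 ltr01.
exists Z => y Zy; apply: le_trans (hZ _ Zy).
apply: le_trans (ler_normB _ _) _; rewrite !normrM mul1r.
apply: (@le_trans _ _ ((K1 * (C2 * expR Y) + K2 * (C1 * expR Y)) * expR (- `|y|))).
  rewrite mulrDl -!mulrA; apply: lerD.
    by apply: ler_pM => //; rewrite mulrA; exact: d2.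
  by rewrite mulrC; apply: ler_pM => //; rewrite mulrA; exact: d1.
by apply: ler_wpM2r; [exact: expR_ge0 | exact: ler_norm].
Qed.

Lemma primitive_sqr_increasing f F a b : has_deriv F (fun y => f y ^+ 2) ->
  continuous f -> a < b -> f b != 0 -> F a < F b.
Proof.
move=> Fd cf ab fb; rewrite lt_neqAle; apply/andP; split; last first.
  by apply: (deriv_ge0_le Fd (ltW ab)) => x _; exact: sqr_ge0.
apply/eqP => Fab.
have := cf b => /cvgrPdist_lt /(_ `|f b|); rewrite normr_gt0 => /(_ fb).
move=> [d /= d0 hd].
pose x := Num.max a (b - d / 2).
have xb : x < b by rewrite gt_max ab /=; lra.
have ax : a <= x by rewrite le_max lexx.
have dx : b - d / 2 <= x by rewrite le_max lexx orbT.
have [c /andP[xc cb] e] := mean_value Fd (ltW xb).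
have h1 : F a <= F x by apply: (deriv_ge0_le Fd ax) => z _; exact: sqr_ge0.
have h2 : F x <= F b by apply: (deriv_ge0_le Fd (ltW xb)) => z _; exact: sqr_ge0.
have fc : f c = 0.
  apply/eqP; rewrite -sqrf_eq0; apply/eqP.
  have : f c ^+ 2 * (b - x) = 0 by rewrite -e; lra.
  by move/eqP; rewrite mulf_eq0 subr_eq0 (gt_eqF xb) orbF => /eqP.
have := hd c; rewrite /= fc subr0 ltxx => H.
have : false by apply: H; rewrite /ball_ /= ger0_norm; lra.
by [].
Qed.

(** The escape condition [u * v < 0] is open, and the sign of [u] is locally
    constant under it. *)
Lemma product_neg_stable (a b : R) : a * b < 0 -> exists2 s : R, 0 < s &
  forall a' b', `|a' - a| <= s -> `|b' - b| <= s -> a' * b' < 0 /\ 0 < a * a'.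
Proof.
move=> ab; have a0 : a != 0 by apply: contraTneq ab => ->; rewrite mul0r ltxx.
have b0 : b != 0 by apply: contraTneq ab => ->; rewrite mulr0 ltxx.
exists (Num.min `|a| `|b| / 2).
  by rewrite divr_gt0 // lt_min !normr_gt0 a0 b0.
move=> a' b' h1 h2.
have m1 : Num.min `|a| `|b| <= `|a| by rewrite ge_min lexx.
have m2 : Num.min `|a| `|b| <= `|b| by rewrite ge_min lexx orbT.
have k1 : `|a' - a| <= `|a| / 2 by lra.
have k2 : `|b' - b| <= `|b| / 2 by lra.
have [pa|na|z] := ltrgtP a 0; last by rewrite z eqxx in a0.
  have pb : 0 < b by nra.
  move: k1 k2; rewrite (ltr0_norm pa) (gtr0_norm pb) !ler_norml.
  by move=> /andP[? ?] /andP[? ?]; split; nra.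
have pb : b < 0 by nra.
move: k1 k2; rewrite (gtr0_norm na) (ltr0_norm pb) !ler_norml.
by move=> /andP[? ?] /andP[? ?]; split; nra.
Qed.

(** Connectedness of a segment, for two disjoint open conditions. *)
Lemma segment_gap (A B : R -> Prop) (a b : R) : a <= b ->
  (forall x, a <= x <= b -> A x -> exists2 d, 0 < d &
     forall x', a <= x' <= b -> `|x' - x| <= d -> A x') ->
  (forall x, a <= x <= b -> B x -> exists2 d, 0 < d &
     forall x', a <= x' <= b -> `|x' - x| <= d -> B x') ->
  (forall x, a <= x <= b -> A x -> B x -> False) ->
  A a -> B b -> exists2 x, a <= x <= b & ~ A x /\ ~ B x.
Proof.
move=> ab oA oB AB Aa Bb.
pose S := [set x | a <= x <= b /\ A x].
have Sa : S a by split => //; rewrite lexx.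
have ubS : ubound S b by move=> x [/andP[_ xb] _].
have hs : has_sup S by split; [exists a | exists b].
pose c := sup S.
have ac : a <= c by apply: ub_le_sup => //; exists b.
have cb : c <= b by apply: ge_sup => //; exists a.
have cab : a <= c <= b by rewrite ac.
exists c => //; split => [Ac|Bc].
  have [d d0 hd] := oA c cab Ac.
  have [cb1|cb1] := ltP c b; last first.
    by have cE : c = b by [lra]; apply: (AB c) => //; rewrite cE.
  pose x := Num.min b (c + d).
  have xb : x <= b by rewrite ge_min lexx.
  have xd : x <= c + d by rewrite ge_min lexx orbT.
  have cx : c < x by rewrite lt_min cb1 /=; lra.
  have xab : a <= x <= b by rewrite xb andbT; lra.
  have Sx : S x by split => //; apply: hd => //; rewrite ger0_norm; lra.
  have : x <= c by apply: ub_le_sup => //; exists b.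
  lra.
have [d d0 hd] := oB c cab Bc.
have [x [xab Ax] xc] := sup_adherent d0 hs.
have xc2 : x <= c by apply: ub_le_sup => //; exists b.
apply: (AB x) => //; apply: hd => //.
by rewrite ler0_norm; move: xc; rewrite -/c; lra.
Qed.

End Eigenstates.

Section Counting.
Context {R : realType}.
Variable n : nat.
Implicit Types (q u v F : R -> R) (y l C e t : R) (m : nat).

(** Beyond this radius the oscillator exceeds every energy up to [2 n] by at
    least [1]. *)
Definition radius : R := n%:R + 2.
Local Notation Y := radius.

(** All that the counting of eigenvalues has to know about the scaled Iwatsuka
    potential. *)
Definition truncated_oscillator t q : Prop :=
  [/\ continuous q, forall y, t <= y -> q y = osc y &
      forall y, y <= t -> t ^+ 2 <= q y].

Definition level m : R := m.*2.+1%:R.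

Lemma radius_ge2 : 2 <= Y.
Proof. by rewrite /radius lerDr. Qed.

Lemma radius_ge0 : 0 <= Y.
Proof. by have := radius_ge2; lra. Qed.

Lemma radius_sqr : 1 + 2 * n%:R <= Y ^+ 2.
Proof. by rewrite /radius; have : 0 <= n%:R :> R by []; nra. Qed.

Lemma osc_confining l : l <= 2 * n%:R -> confining Y (@osc R) l.
Proof.
move=> l2 y Yy; rewrite /osc -real_normK ?num_real //.
have := radius_sqr; have := radius_ge0 => Y0 Y2.
have : Y ^+ 2 <= `|y| ^+ 2 by rewrite ler_sqr ?nnegrE.
lra.
Qed.

Lemma truncated_confining t q l : truncated_oscillator t q -> t <= - Y ->
  l <= 2 * n%:R -> confining Y q l.
Proof.
move=> [_ q1 q2] tY l2 y Yy; have := osc_confining l2 Yy.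
have [ty|yt] := leP t y; first by rewrite q1.
move=> _; apply: le_trans (q2 y (ltW yt)).
have := radius_sqr; have := radius_ge0 => Y0 Y2.
have : Y ^+ 2 <= (- t) ^+ 2 by rewrite ler_sqr ?nnegrE //; lra.
rewrite sqrrN; lra.
Qed.

Lemma truncated_ge0 t q : truncated_oscillator t q -> forall y, 0 <= q y.
Proof.
move=> [_ q1 q2] y; have [ty|yt] := leP t y; first by rewrite q1 // osc_ge0.
by apply: le_trans (q2 y (ltW yt)); exact: sqr_ge0.
Qed.

Lemma osc_truncated t : t <= 0 -> truncated_oscillator t (@osc R).
Proof.
move=> t0; split => //; first exact: osc_continuous.
by move=> y yt; rewrite /osc -[leLHS]sqrrN -[leRHS]sqrrN ler_sqr ?nnegrE; lra.
Qed.

Lemma level_le m : (m < n)%N -> level m <= 2 * n%:R - 1.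
Proof.
move=> mn; rewrite /level -natr1 -mul2n natrM.
have : (m.+1%:R : R) <= n%:R by rewrite ler_nat.
rewrite -natr1; lra.
Qed.

(** A decaying solution that does not escape is an eigenstate, and the
    energies of the oscillator are odd integers. *)
Lemma osc_escape l u v : l <= 2 * n%:R -> weyl Y (@osc R) l u v ->
  (forall m, l <> level m) -> exists2 y, y <= - Y & u y * v y < 0.
Proof.
move=> l2 w nl; apply: contrapT => h.
have [_ [C uC]] : eigenstate Y (@osc R) l u v.
  apply: weyl_escape w _; [exact: radius_ge0 | exact: osc_confining |].
  by move=> y Yy; rewrite leNgt; apply/negP => uv0; apply: h; exists y.
have [s _ _] := w.
have [m lm] := oscillator_spectrum s uC (weyl_neq0 w).
exact: nl lm.
Qed.

Lemma eigenlevel_gt0 t q l : truncated_oscillator t q -> t <= - Y ->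
  l <= 2 * n%:R -> eigenlevel Y q l -> 0 < l.
Proof.
move=> qt tY l2 [u [v [w [C uC]]]]; have [s _ _] := w; have [cq _ _] := qt.
exact: (bound_state_energy_gt0 radius_ge0 cq (truncated_confining qt tY l2) s uC
  (weyl_neq0 w) (truncated_ge0 qt)).
Qed.

(** At an energy which is not an odd integer the decaying solution of the
    oscillator escapes at some point. The same happens at this point for
    nearby energies and for every potential truncated farther to the left,
    because it has the same decaying solution there. Compactness of [[0, 2 n]]
    makes the truncation uniform. *)
Lemma eigenlevels_near_levels e : 0 < e -> exists T : R, forall t q l, t <= T ->
  truncated_oscillator t q -> l <= 2 * n%:R -> eigenlevel Y q l ->
  exists2 m, (m < n)%N & `|l - level m| < e.
Proof.
move=> e0.
pose P (T l : R) := l <= 2 * n%:R -> (exists2 m, (m < n)%N & `|l - level m| < e) \/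
  forall t q, t <= T -> truncated_oscillator t q -> ~ eigenlevel Y q l.
have H : \forall T \near -oo%R, `[0, 2 * n%:R] `<=` P T.
  have NC : near_covering `[(0 : R), 2 * n%:R].
    by apply/compact_near_coveringP; exact: segment_compact.
  apply: NC => l0.
  rewrite /= in_itv/= => /andP[l00 l02].
  have [[m lm]|nl] := pselect (exists m, l0 = level m).
    have mn : (m < n)%N.
      move: l02; rewrite lm /level -mul2n -natrM ler_nat; lia.
    have A : \forall l \near l0, `|l0 - l| < e.
      exact: (@cvgr_dist_lt _ _ _ _ _ id l0 (@cvg_id _ _) e e0).
    exists ([set l | `|l0 - l| < e], setT).
      by split => //=; exact: filterT.
    move=> [l T] /= [la _] _; left; exists m => //.
    by rewrite -lm distrC.
  have [u0 [v0 w0]] := weyl_exists osc_continuous (confining_right radius_ge0 (osc_confining l02)).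
  have [|y0 y0Y uv0] := osc_escape l02 w0.
    by move=> m lm; apply: nl; exists m.
  have YY : y0 <= Y by have := radius_ge0; lra.
  have [C C0 hC] := weyl_close YY osc_continuous w0 (confining_right radius_ge0 (osc_confining l02)).
  have [s s0 hs] := product_neg_stable uv0.
  pose d := Num.min 1 (s / C).
  have d0 : 0 < d by rewrite lt_min ltr01 divr_gt0.
  have A : \forall l \near l0, `|l0 - l| <= d.
    exact: (@cvgr_dist_le _ _ _ _ _ id l0 (@cvg_id _ _) d d0).
  exists ([set l | `|l0 - l| <= d], [set T | T <= y0]).
    split => //=; exists y0; split; first exact: num_real.
    by move=> x /= /ltW.
  move=> [l T] /= [ld Ty0] l2; right => t q tT qt [u [v es]].
  rewrite distrC in ld.
  have [w _] := es; have [cq q1 _] := qt.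
  have ty0 : t <= y0 by exact: le_trans Ty0.
  have cf : confining Y q l by apply: truncated_confining qt _ l2; exact: le_trans y0Y.
  have := hC q l u v w (fun y hy => q1 y (le_trans ty0 hy)) (confining_right radius_ge0 (osc_confining l2)).
  move: ld; rewrite le_min => /andP[ld1 ld2] /(_ ld1 y0); rewrite lexx YY => /(_ isT)[a1 a2].
  have Cs : C * `|l - l0| <= s by move: ld2; rewrite ler_pdivlMr // mulrC.
  have [uv1 _] := hs _ _ (le_trans a1 Cs) (le_trans a2 Cs).
  have := eigenstate_uv_ge0 radius_ge0 cf es y0Y.
  by rewrite leNgt uv1.
have [T [_ hT]] := H.
exists (Num.min T (- Y) - 1) => t q l tT qt l2 el.
have TT : Num.min T (- Y) <= T by rewrite ge_min lexx.
have TY : Num.min T (- Y) <= - Y by rewrite ge_min lexx orbT.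
have tY : t <= - Y by lra.
have t1 : t < T by lra.
have l0 := eigenlevel_gt0 qt tY l2 el.
have lin : `[(0 : R), 2 * n%:R]%classic l by rewrite /= in_itv/= (ltW l0).
have [//|h] := hT t t1 l lin l2.
by case: (h t q (lexx t) qt).
Unshelve. all: by end_near. Qed.

(** On [[- Y, Y]] decaying solutions at energies close to the level are close
    to [u0], so that their products are close to [u0 ^+ 2]; beyond [Y] they
    are positive, which only increases the overlap. *)
Lemma overlap m u0 v0 : (m < n)%N -> eigenstate Y (@osc R) (level m) u0 v0 ->
  exists2 d, 0 < d <= 1 / 2 & exists2 j, 0 < j &
  forall q1 q2 l1 l2 u1 v1 u2 v2,
    truncated_oscillator (- Y) q1 -> truncated_oscillator (- Y) q2 ->
    `|l1 - level m| <= d -> `|l2 - level m| <= d ->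
    weyl Y q1 l1 u1 v1 -> weyl Y q2 l2 u2 v2 ->
    0 < u1 (- Y) * u0 (- Y) /\
    forall F, has_deriv F (fun y => u1 y * u2 y) ->
      forall z, Y <= z -> j <= F z - F (- Y).
Proof.
move=> mn es0; have [w0 [C0 b0]] := es0; have [s0 u0Y _] := w0.
have lm := level_le mn.
have lm2 : level m <= 2 * n%:R by lra.
have cf0 := osc_confining lm2; have Y2 := radius_ge2.
have YY : - Y <= Y by lra.
have [C C1 hC] := weyl_close YY osc_continuous w0 (confining_right radius_ge0 cf0).
have cu0 := has_deriv_continuous s0.1.
have [B B0 hB] := continuous_bounded (- Y) Y cu0.
have uY0 : u0 (- Y) != 0.
  apply: (bound_state_neq0_left radius_ge0 osc_continuous cf0 s0 b0 (weyl_neq0 w0) (lexx _)).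
have [F0 [F0d _]] : exists F : R -> R, has_deriv F (fun y => u0 y ^+ 2) /\ F 0 = 0.
  apply: primitive_exists.
  have ud := s0.1.
  by apply: (@has_deriv_continuous _ _ (fun y => 2 * u0 y * v0 y)) => x; derive; rewrite /=; ring.
pose j := (F0 Y - F0 (- Y)) / 2.
have j0 : 0 < j.
  rewrite divr_gt0 // subr_gt0; apply: (primitive_sqr_increasing F0d cu0); first lra.
  by rewrite u0Y oner_neq0.
pose s1 := j / (2 * Y * (2 * B + 1)).
have s10 : 0 < s1 by rewrite divr_gt0 // !mulr_gt0 //; lra.
pose s2 := Num.min 1 (Num.min s1 (`|u0 (- Y)| / 2)).
have s20 : 0 < s2 by rewrite !lt_min ltr01 s10 divr_gt0 // normr_gt0.
pose d := Num.min (1 / 2) (s2 / C).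
have d0 : 0 < d by rewrite lt_min !divr_gt0.
have d2 : d <= 1 / 2 by rewrite ge_min lexx.
exists d; first by rewrite d0.
exists j => // q1 q2 l1 l2 u1 v1 u2 v2 t1 t2 h1 h2 w1 w2.
have close q l u v : truncated_oscillator (- Y) q -> `|l - level m| <= d -> weyl Y q l u v ->
    l <= 2 * n%:R /\ forall y, - Y <= y <= Y -> `|u y - u0 y| <= s2.
  move=> [cq q' _] ld w.
  have l2' : l <= 2 * n%:R by move: ld; rewrite ler_norml => /andP[]; lra.
  split => // y yY.
  have [|a _] := hC q l u v w q' (confining_right radius_ge0 (osc_confining l2')) _ y yY.
    by apply: le_trans ld _; lra.
  apply: le_trans a _.
  have : `|l - level m| <= s2 / C by apply: le_trans ld _; rewrite ge_min lexx orbT.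
  by rewrite ler_pdivlMr // mulrC.
have [l12 c1] := close _ _ _ _ t1 h1 w1.
have [l22 c2] := close _ _ _ _ t2 h2 w2.
have s21 : s2 <= 1 by rewrite !ge_min lexx.
have s22 : s2 <= s1 by rewrite !ge_min lexx orbT.
have s23 : s2 <= `|u0 (- Y)| / 2 by rewrite !ge_min lexx !orbT.
split.
  have := c1 (- Y); rewrite lexx YY => /(_ isT) a.
  have : `|u1 (- Y) - u0 (- Y)| <= `|u0 (- Y)| / 2 by exact: le_trans s23.
  have [pa|na|z] := ltrgtP (u0 (- Y)) 0; last by rewrite z eqxx in uY0.
    by rewrite (ltr0_norm pa) ler_norml => /andP[? ?]; nra.
  by rewrite (gtr0_norm na) ler_norml => /andP[? ?]; nra.
move=> F Fd z Yz.
have [cq1 _ _] := t1; have [cq2 _ _] := t2.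
have tY : - Y <= - Y by [].
have p1 := weyl_gt0 cq1 w1 (confining_right radius_ge0 (truncated_confining t1 tY l12)).
have p2 := weyl_gt0 cq2 w2 (confining_right radius_ge0 (truncated_confining t2 tY l22)).
have FY : F Y <= F z.
  by apply: (deriv_ge0_le Fd Yz) => x /andP[Yx _]; rewrite mulr_ge0 // ltW ?p1 ?p2.
suff : j <= F Y - F (- Y) by lra.
have gd : has_deriv (fun y => F0 y - s1 * (2 * B + 1) * y)
                    (fun y => u0 y ^+ 2 - s1 * (2 * B + 1)).
  by move=> x; derive; ring.
have := deriv_le_sub gd Fd YY _ => H.
have {}H : F0 Y - s1 * (2 * B + 1) * Y - (F0 (- Y) - s1 * (2 * B + 1) * - Y) <= F Y - F (- Y).
  apply: H => x xY.
  have a1 := c1 x xY; have a2 := c2 x xY; have a3 := hB x xY.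
  have -> : u1 x * u2 x = u0 x ^+ 2 + (u0 x * (u2 x - u0 x) + (u1 x - u0 x) * u2 x) by ring.
  have a4 : `|u2 x| <= B + 1.
    have -> : u2 x = u0 x + (u2 x - u0 x) by ring.
    by apply: le_trans (ler_normD _ _) _; apply: lerD => //; exact: le_trans s21.
  have : `|u0 x * (u2 x - u0 x) + (u1 x - u0 x) * u2 x| <= s1 * (2 * B + 1).
    apply: le_trans (ler_normD _ _) _; rewrite !normrM.
    have -> : s1 * (2 * B + 1) = B * s1 + s1 * (B + 1) by ring.
    by apply: lerD; apply: ler_pM => //; exact: le_trans s22.
  rewrite ler_norml => /andP[+ _]; lra.
have e1 : s1 * (2 * B + 1) * (2 * Y) = j.
  by rewrite /s1; field; apply/andP; split; rewrite gt_eqF //; lra.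
have e2 : F0 Y - F0 (- Y) = 2 * j by rewrite /j; field.
lra.
Qed.

End Counting.

Section Levels.
Context {R : realType}.
Variable n : nat.
Implicit Types (q u v F : R -> R) (y l C e t : R) (m : nat).
Local Notation Y := (@radius R n).

Lemma truncated_mono t t' q : truncated_oscillator t q -> t <= t' -> t' <= 0 ->
  truncated_oscillator t' q.
Proof.
move=> [cq q1 q2] tt t'0; split => //.
  by move=> y ty; apply: q1; exact: le_trans ty.
move=> y yt; have [ty|yt2] := leP t y.
  by rewrite q1 // /osc -[leLHS]sqrrN -[leRHS]sqrrN ler_sqr ?nnegrE; lra.
apply: le_trans (q2 y (ltW yt2)).
by rewrite -[leLHS]sqrrN -[leRHS]sqrrN ler_sqr ?nnegrE; lra.
Qed.

(** Eigenstates at two energies near the same level would be orthogonal,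
    although their product is positive on the left and has positive overlap on
    the right. *)
Lemma level_unique m : (m < n)%N -> exists2 d, 0 < d & forall t q l1 l2,
  truncated_oscillator t q -> t <= - Y ->
  `|l1 - level m| <= d -> `|l2 - level m| <= d ->
  eigenlevel Y q l1 -> eigenlevel Y q l2 -> l1 = l2.
Proof.
move=> mn; have lm := @level_le R n m mn.
have lm2 : (level m : R) <= 2 * n%:R by lra.
have [B hB] := @hermite_fun_bounded R m.
have [u0 [v0 es0]] : eigenlevel Y (@osc R) (level m).
  exact: (bounded_solution_eigenlevel (radius_ge0 n) osc_continuous (osc_confining lm2)
    (hermite_fun_solves m) hB (hermite_fun_neq0 m)).
have [d /andP[d0 d2] [j j0 ov]] := overlap mn es0.
exists d => // t q l1 l2 qt tY h1 h2 [u1 [v1 es1]] [u2 [v2 es2]].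
have Y0 : 0 <= Y := radius_ge0 n.
have qY : truncated_oscillator (- Y) q by apply: truncated_mono qt tY _; lra.
have l12 : l1 <= 2 * n%:R by move: h1; rewrite ler_norml => /andP[]; lra.
have l22 : l2 <= 2 * n%:R by move: h2; rewrite ler_norml => /andP[]; lra.
have cf1 := truncated_confining qt tY l12; have cf2 := truncated_confining qt tY l22.
have [cq _ _] := qt.
have [w1 _] := es1; have [w2 _] := es2.
have [[u1d v1d] _ _] := w1; have [[u2d v2d] _ _] := w2.
have [F [Fd _]] : exists F : R -> R, has_deriv F (fun y => u1 y * u2 y) /\ F 0 = 0.
  apply: primitive_exists.
  by apply: (@has_deriv_continuous _ _ (fun y => v1 y * u2 y + u1 y * v2 y)) => x; derive; ring.
have [p1 ovF] := ov _ _ _ _ _ _ _ _ qY qY h1 h2 w1 w2.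
have [p2 _] := ov _ _ _ _ _ _ _ _ qY qY h2 h1 w2 w1.
apply/eqP; rewrite -subr_eq0; apply: contrapT => /negP ll.
have lp : 0 < `|l1 - l2| by rewrite normr_gt0.
pose W y := v1 y * u2 y - u1 y * v2 y.
have e0 : 0 < `|l1 - l2| * j / 4 by rewrite divr_gt0 // mulr_gt0.
have [Z hZ] := eigenstate_wronskian_small Y0 cf1 cf2 es1 es2 e0.
pose z := Num.max Y `|Z|.
have zY : Y <= z by rewrite le_max lexx.
have zZ : Z <= z by apply: le_trans (ler_norm Z) _; rewrite le_max lexx orbT.
have z0 : 0 <= z by lra.
have W1 : `|W z| <= `|l1 - l2| * j / 4 by apply: hZ; rewrite ger0_norm.
have W2 : `|W (- z)| <= `|l1 - l2| * j / 4 by apply: hZ; rewrite normrN ger0_norm.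
have zz : - z <= z by lra.
have cd : has_deriv (fun y => W y + (l1 - l2) * F y) (fun => 0).
  by move=> x; rewrite /W; derive; ring.
have := deriv_eq0_eq cd zz (fun _ _ => erefl) => eq1.
have f1 := ovF F Fd z zY.
have f2 : F (- z) <= F (- Y).
  have zYN : - z <= - Y by lra.
  apply: (deriv_ge0_le Fd zYN) => x /andP[_ xY]; apply: ltW.
  have s1 := eigenstate_same_sign_left Y0 cq cf1 es1 xY (lexx (- Y)).
  have s2 := eigenstate_same_sign_left Y0 cq cf2 es2 xY (lexx (- Y)).
  have s3 : 0 < u1 (- Y) * u2 (- Y).
    have : 0 < (u1 (- Y) * u0 (- Y)) * (u2 (- Y) * u0 (- Y)) by rewrite mulr_gt0.
    have -> : u1 (- Y) * u0 (- Y) * (u2 (- Y) * u0 (- Y)) =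
              u1 (- Y) * u2 (- Y) * u0 (- Y) ^+ 2 by ring.
    have := sqr_ge0 (u0 (- Y)); nra.
  have : 0 < (u1 x * u1 (- Y)) * (u2 x * u2 (- Y)) by rewrite mulr_gt0.
  have -> : u1 x * u1 (- Y) * (u2 x * u2 (- Y)) = u1 x * u2 x * (u1 (- Y) * u2 (- Y)) by ring.
  by rewrite pmulr_lgt0.
have : `|(l1 - l2) * (F z - F (- z))| <= `|l1 - l2| * j / 2.
  have -> : (l1 - l2) * (F z - F (- z)) = W (- z) - W z by lra.
  by apply: le_trans (ler_normB _ _) _; lra.
rewrite normrM [`|F z - _|]ger0_norm; last lra.
by rewrite -mulrA ler_pM2l //; lra.
Qed.

(** The sign with which the decaying solution escapes changes across each
    level: [(u / u0)' = W / u0 ^+ 2] where [W] has the sign of [l - level m]. *)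
Lemma level_crossing m u0 v0 : (m < n)%N -> eigenstate Y (@osc R) (level m) u0 v0 ->
  exists2 d, 0 < d <= 1 / 2 & forall l u v, 0 < `|l - level m| <= d ->
    weyl Y (@osc R) l u v -> exists2 y, y <= - Y &
    u y * v y < 0 /\ 0 < (level m - l) * (u y * u0 (- Y)).
Proof.
move=> mn es0; have lm := @level_le R n m mn.
have [d /andP[d0 d2] [j j0 ov]] := overlap mn es0.
exists d; first by rewrite d0.
move=> l u v /andP[ll ld] w.
have Y0 : 0 <= Y := radius_ge0 n.
have l2 : l <= 2 * n%:R by move: ld; rewrite ler_norml => /andP[]; lra.
have lm2 : (level m : R) <= 2 * n%:R by lra.
have cf := osc_confining l2; have cf0 := osc_confining lm2.
have YN : - Y <= 0 by lra.
have oY := osc_truncated YN.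
have [w0 [C0 b0]] := es0; have [s0 _ _] := w0; have [s _ _] := w.
have [ud vd] := s; have [u0d v0d] := s0.
have cu := has_deriv_continuous ud.
have lmm : `|level m - level m : R| <= d by rewrite subrr normr0 ltW.
have [p ovF] := ov _ _ _ _ _ _ _ _ oY oY ld lmm w w0.
have ne y : y <= - Y -> u0 y != 0.
  by move=> yY; exact: (bound_state_neq0_left Y0 osc_continuous cf0 s0 b0 (weyl_neq0 w0) yY).
have sg y : y <= - Y -> 0 < u0 y * u0 (- Y).
  move=> yY; exact: (eigenstate_same_sign_left Y0 osc_continuous cf0 es0 yY (lexx _)).
have [F [Fd _]] : exists F : R -> R, has_deriv F (fun y => u y * u0 y) /\ F 0 = 0.
  apply: primitive_exists.
  by apply: (@has_deriv_continuous _ _ (fun y => v y * u0 y + u y * v0 y)) => x; derive; ring.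
pose X := l - level m; pose W y := v y * u0 y - u y * v0 y.
have Wd : has_deriv W (fun y => - X * (u y * u0 y)).
  by move=> x; rewrite /W /X; derive; ring.
have cd : has_deriv (fun y => W y + X * F y) (fun => 0).
  by move=> x; derive; ring.
have X0 : X != 0 by rewrite -normr_gt0.
have WY : X ^+ 2 * j <= X * W (- Y).
  apply/ler_addgt0Pr => e e0.
  have e1 : 0 < e / `|X| by rewrite divr_gt0.
  have [Z hZ] := wronskian_small w w0 (confining_right Y0 cf) (confining_right Y0 cf0) e1.
  pose z := Num.max Y Z.
  have zY : Y <= z by rewrite le_max lexx.
  have zZ : Z <= z by rewrite le_max lexx orbT.
  have W1 : `|X * W z| <= e.
    rewrite normrM; apply: le_trans (ler_wpM2l (normr_ge0 X) (hZ z zZ zY)) _.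
    by rewrite mulrC divfK // normr_eq0.
  have zz : - Y <= z by lra.
  have eq1 := deriv_eq0_eq cd zz (fun _ _ => erefl).
  have f1 := ovF F Fd z zY.
  have -> : X * W (- Y) = X * W z + X ^+ 2 * (F z - F (- Y)).
    have -> : W (- Y) = W z + X * (F z - F (- Y)) by lra.
    by ring.
  have : X ^+ 2 * j <= X ^+ 2 * (F z - F (- Y)) by rewrite ler_wpM2l // sqr_ge0.
  by move: W1; rewrite ler_norml => /andP[]; lra.
have rd y : y <= - Y -> is_derive y 1 (fun y => u y / u0 y) (W y / u0 y ^+ 2).
  move=> yY; have := ne y yY => uy; derive; first exact: uy.
  by rewrite /W; field.
have sq_mono a : a <= - Y -> 0 <= u a * v a -> forall x y, a <= x -> x <= y -> y <= - Y ->
    u x ^+ 2 <= u y ^+ 2.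
  move=> aY uva x y ax xy yY; apply: (deriv_ge0_le (sqr_deriv s) xy) => z /andP[xz zy].
  have := uv_nondecr_left s (confining_left Y0 cf) (le_trans zy yY) (le_trans ax xz); lra.
(* below the level the solution escapes, by the spectrum of the oscillator,
   and it cannot have changed sign before; above the level [u / u0] decreases
   to the left at a rate bounded below, and so has to change sign *)
have [Xn|Xp] := ltrP X 0.
- have [|y1 y1Y uv1] := osc_escape l2 w.
    move=> m' lm'; have : `|l - level m| <= 1 / 2 by lra.
    move: X0; rewrite /X lm' => X0.
    have [mm|mm|mm] := ltngtP m m'.
    + have : (m.+1%:R : R) <= m'%:R by rewrite ler_nat.
      rewrite ler_norml => h /andP[_]; move: h.
      rewrite /level -[m.*2.+1%:R]natr1 -[m'.*2.+1%:R]natr1 -!mul2n !natrM -natr1; lra.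
    + have : (m'.+1%:R : R) <= m%:R by rewrite ler_nat.
      rewrite ler_norml => h /andP[+ _]; move: h.
      rewrite /level -[m.*2.+1%:R]natr1 -[m'.*2.+1%:R]natr1 -!mul2n !natrM -natr1; lra.
    + by move: X0; rewrite mm subrr eqxx.
  have uy1 : u y1 != 0 by apply: contraTneq uv1 => ->; rewrite mul0r ltxx.
  exists y1 => //; split => //.
  have mX : 0 < level m - l by rewrite /X in Xn; lra.
  rewrite pmulr_rgt0 // lt_neqAle eq_sym mulf_neq0 ?ne //= leNgt; apply/negP => h.
  have [|c /andP[y1c cY] uc] := zero_between cu y1Y.
    have : (u y1 * u0 (- Y)) * (u (- Y) * u0 (- Y)) <= 0 by rewrite mulr_le0_ge0 // ltW.
    have -> : u y1 * u0 (- Y) * (u (- Y) * u0 (- Y)) = u y1 * u (- Y) * u0 (- Y) ^+ 2 by ring.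
    by rewrite pmulr_lle0 // lt_neqAle sqr_ge0 eq_sym sqrf_eq0 ne.
  have uvc : 0 <= u c * v c by rewrite uc mul0r.
  have pos x : c <= x <= - Y -> 0 <= u x * u0 (- Y).
    move=> /andP[cx xY]; rewrite leNgt; apply/negP => hx.
    have [|c' /andP[xc' c'Y] uc'] := zero_between cu xY.
      have : (u x * u0 (- Y)) * (u (- Y) * u0 (- Y)) <= 0 by rewrite mulr_le0_ge0 // ltW.
      have -> : u x * u0 (- Y) * (u (- Y) * u0 (- Y)) = u x * u (- Y) * u0 (- Y) ^+ 2 by ring.
      by rewrite pmulr_lle0 // lt_neqAle sqr_ge0 eq_sym sqrf_eq0 ne.
    have := sq_mono c cY uvc x c' cx xc' c'Y; rewrite uc' expr0n /= => ux.
    have ux0 : u x = 0 by apply/eqP; rewrite -sqrf_eq0; apply/eqP; have := sqr_ge0 (u x); lra.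
    by move: hx; rewrite ux0 mul0r ltxx.
  have pos2 x : c <= x <= - Y -> 0 <= u x * u0 x.
    move=> cxY; have /andP[_ xY] := cxY; have h1 := pos x cxY; have h2 := sg x xY.
    have : 0 <= (u x * u0 (- Y)) * (u0 x * u0 (- Y)) by rewrite mulr_ge0 // ltW.
    have -> : u x * u0 (- Y) * (u0 x * u0 (- Y)) = u x * u0 x * u0 (- Y) ^+ 2 by ring.
    by rewrite pmulr_lge0 // lt_neqAle sqr_ge0 eq_sym sqrf_eq0 ne.
  have WY0 : W (- Y) < 0.
    have : 0 < X ^+ 2 * j by rewrite mulr_gt0 // lt_neqAle sqr_ge0 eq_sym sqrf_eq0 X0.
    nra.
  have Wn x : c <= x <= - Y -> W x <= 0.
    move=> /andP[cx xY]; suff : W x <= W (- Y) by lra.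
    apply: (deriv_ge0_le Wd xY) => z /andP[xz zY].
    have : 0 <= u z * u0 z by apply: pos2; rewrite zY andbT; exact: le_trans xz.
    by move=> ?; rewrite mulr_ge0 //; lra.
  have : - (u c / u0 c) <= - (u (- Y) / u0 (- Y)).
    apply: (@deriv_ge0_le_on _ (fun x => - (u x / u0 x)) (fun x => - (W x / u0 x ^+ 2)) _ _ cY).
      by move=> x /andP[_ xY]; apply: der_opp; exact: rd.
    move=> x cxY; rewrite -mulNr divr_ge0 ?sqr_ge0 //; have := Wn x cxY; lra.
  rewrite uc mul0r => h3.
  have : 0 < u (- Y) / u0 (- Y).
    have -> : u (- Y) / u0 (- Y) = (u (- Y) * u0 (- Y)) / u0 (- Y) ^+ 2 by field; exact: ne.
    by rewrite divr_gt0 // lt_neqAle sqr_ge0 eq_sym sqrf_eq0 ne.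
  lra.
have {}Xp : 0 < X by rewrite lt_neqAle eq_sym X0.
have nX : level m - l < 0 by rewrite /X in Xp; lra.
have [[y1 y1Y h]|nh] := pselect (exists2 y1, y1 <= - Y & u y1 * u0 (- Y) < 0).
  exists y1 => //; split; last by rewrite nmulr_rgt0.
  have [|c /andP[y1c cY] uc] := zero_between cu y1Y.
    have : (u y1 * u0 (- Y)) * (u (- Y) * u0 (- Y)) <= 0 by rewrite mulr_le0_ge0 // ltW.
    have -> : u y1 * u0 (- Y) * (u (- Y) * u0 (- Y)) = u y1 * u (- Y) * u0 (- Y) ^+ 2 by ring.
    by rewrite pmulr_lle0 // lt_neqAle sqr_ge0 eq_sym sqrf_eq0 ne.
  rewrite ltNge; apply/negP => uv1.
  have := sq_mono y1 y1Y uv1 y1 c (lexx _) y1c cY; rewrite uc expr0n /= => ux.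
  have ux0 : u y1 = 0 by apply/eqP; rewrite -sqrf_eq0; apply/eqP; have := sqr_ge0 (u y1); lra.
  by move: h; rewrite ux0 mul0r ltxx.
exfalso.
have pos x : x <= - Y -> 0 <= u x * u0 (- Y).
  by move=> xY; rewrite leNgt; apply/negP => hx; apply: nh; exists x.
have pos2 x : x <= - Y -> 0 <= u x * u0 x.
  move=> xY; have h1 := pos x xY; have h2 := sg x xY.
  have : 0 <= (u x * u0 (- Y)) * (u0 x * u0 (- Y)) by rewrite mulr_ge0 // ltW.
  have -> : u x * u0 (- Y) * (u0 x * u0 (- Y)) = u x * u0 x * u0 (- Y) ^+ 2 by ring.
  by rewrite pmulr_lge0 // lt_neqAle sqr_ge0 eq_sym sqrf_eq0 ne.
have WYp : X * j <= W (- Y) by rewrite -(ler_pM2l Xp) mulrA -expr2.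
have Wp x : x <= - Y -> X * j <= W x.
  move=> xY; apply: le_trans WYp _.
  apply: (deriv_le0_ge Wd xY) => z /andP[xz zY].
  have := pos2 z zY => ?; rewrite mulNr oppr_le0 mulr_ge0 //; exact: ltW.
have CC : 0 < C0 ^+ 2.
  have := b0 (- Y) => h; have : 0 < `|u0 (- Y)| by rewrite normr_gt0 ne.
  by move=> h'; rewrite exprn_gt0 // (lt_le_trans h').
pose k := X * j / C0 ^+ 2.
have k0 : 0 < k by rewrite divr_gt0 // mulr_gt0.
apply: (@linear_unbounded _ k (u (- Y) / u0 (- Y)) 0 Y) => // z zY.
have zYN : - z <= - Y by lra.
have : u (- z) / u0 (- z) - k * - z <= u (- Y) / u0 (- Y) - k * - Y.
  apply: (@deriv_ge0_le_on _ (fun x => u x / u0 x - k * x) (fun x => W x / u0 x ^+ 2 - k) _ _ zYN).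
    move=> x /andP[_ xY]; have := rd x xY => rdx.
    apply: is_derive_eq (der_add rdx (der_opp (der_mul (der_cst k x) (der_id x)))) _.
    by ring.
  move=> x /andP[_ xY]; rewrite subr_ge0 /k.
  have p2 : 0 < u0 x ^+ 2 by rewrite lt_neqAle sqr_ge0 eq_sym sqrf_eq0 ne.
  have uC : u0 x ^+ 2 <= C0 ^+ 2.
    rewrite -[leLHS]real_normK ?num_real // ler_sqr ?nnegrE //.
    exact: le_trans (b0 x).
  rewrite ler_pdivlMr // mulrAC ler_pdivrMr //.
  apply: ler_pM => //; [ | exact: ltW | exact: Wp].
  by rewrite mulr_ge0 // ltW.
have : 0 <= u (- z) / u0 (- z).
  have -> : u (- z) / u0 (- z) = (u (- z) * u0 (- z)) / u0 (- z) ^+ 2 by field; exact: ne.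
  by rewrite divr_ge0 ?sqr_ge0 // pos2.
lra.
Qed.

End Levels.

Section LevelCounting.
Context {R : realType}.
Variable n : nat.
Implicit Types (q u v F : R -> R) (y l C e t : R) (m : nat).
Local Notation Y := (@radius R n).

Lemma level_eigenstate m : (m < n)%N ->
  exists u0 v0, eigenstate Y (@osc R) (level m) u0 v0.
Proof.
move=> mn; have lm := @level_le R n m mn.
have lm2 : (level m : R) <= 2 * n%:R by lra.
have [B hB] := @hermite_fun_bounded R m.
exact: (bounded_solution_eigenlevel (radius_ge0 n) osc_continuous (osc_confining lm2)
    (hermite_fun_solves m) hB (hermite_fun_neq0 m)).
Qed.

(** Escaping with a prescribed sign is an open condition on the energy; the
    two signs exclude each other, and an energy satisfying neither is an
    eigenvalue. *)
Lemma level_exists m e : (m < n)%N -> 0 < e -> exists T, forall t q, t <= T ->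
  truncated_oscillator t q ->
  exists2 l, `|l - level m| <= e & eigenlevel Y q l.
Proof.
move=> mn e0; have lm := @level_le R n m mn.
have [u0 [v0 es0]] := level_eigenstate mn.
have [d /andP[d0 d2] hd] := level_crossing mn es0.
have Y0 : 0 <= Y := radius_ge0 n.
pose h := Num.min d e.
have h0 : 0 < h by rewrite lt_min d0 e0.
have hd' : h <= d by rewrite ge_min lexx.
have he : h <= e by rewrite ge_min lexx orbT.
pose la : R := level m - h; pose lb : R := level m + h.
have la2 : la <= 2 * n%:R by rewrite /la; lra.
have lb2 : lb <= 2 * n%:R by rewrite /lb; lra.
have [ua [va wa]] := weyl_exists osc_continuous (confining_right Y0 (osc_confining la2)).
have [ub [vb wb]] := weyl_exists osc_continuous (confining_right Y0 (osc_confining lb2)).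
have la3 : level m - la = h by rewrite /la; ring.
have lb3 : level m - lb = - h by rewrite /lb; ring.
have [|ya yaY [uva sa]] := hd la ua va _ wa.
  by rewrite distrC la3 gtr0_norm // h0.
have [|yb ybY [uvb sb]] := hd lb ub vb _ wb.
  by rewrite distrC lb3 normrN gtr0_norm // h0.
move: sa sb; rewrite la3 lb3 mulNr oppr_gt0 pmulr_rgt0 // pmulr_rlt0 // => sa sb.
exists (Num.min ya yb) => t q tT qt.
have tya : t <= ya by apply: le_trans tT _; rewrite ge_min lexx.
have tyb : t <= yb by apply: le_trans tT _; rewrite ge_min lexx orbT.
have tY : t <= - Y by exact: le_trans yaY.
have [cq q1 _] := qt.
have cf l : l <= 2 * n%:R -> confining Y q l by move=> l2; exact: (truncated_confining qt tY l2).
pose esc (sg : R) l := exists u v, weyl Y q l u v /\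
  exists2 y, y <= - Y & u y * v y < 0 /\ 0 < sg * u y.
pose s0 := u0 (- Y).
have yY y : y <= - Y -> y <= Y by move=> yy; lra.
have agree y l u v u' v' : l <= 2 * n%:R -> t <= y -> y <= - Y ->
    weyl Y (@osc R) l u v -> weyl Y q l u' v' -> u' y = u y /\ v' y = v y.
  move=> l2 ty yy w w'.
  have tYY : t <= Y by apply: (le_trans ty); exact: yY.
  apply: (weyl_uniq tYY osc_continuous w w' q1 (confining_right Y0 (osc_confining l2))).
  by rewrite ty yY.
have Aa : esc s0 la.
  have [u [v w]] := weyl_exists cq (confining_right Y0 (cf _ la2)).
  exists u, v; split => //; exists ya => //.
  have [-> ->] := agree ya la _ _ _ _ la2 tya yaY wa w; split => //.
  by rewrite mulrC.
have Bb : esc (- s0) lb.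
  have [u [v w]] := weyl_exists cq (confining_right Y0 (cf _ lb2)).
  exists u, v; split => //; exists yb => //.
  have [-> ->] := agree yb lb _ _ _ _ lb2 tyb ybY wb w; split => //.
  by rewrite mulNr oppr_gt0 mulrC.
have lab x : la <= x <= lb -> x <= 2 * n%:R.
  by move=> /andP[_ xb]; exact: le_trans xb lb2.
have opn sg x : la <= x <= lb -> esc sg x -> exists2 d', 0 < d' &
    forall x', la <= x' <= lb -> `|x' - x| <= d' -> esc sg x'.
  move=> xab [u [v [w [y yy [uvn su]]]]].
  have [C C0 hC] := weyl_close (yY _ yy) cq w (confining_right Y0 (cf _ (lab _ xab))).
  have [s s1 hs] := product_neg_stable uvn.
  exists (Num.min 1 (s / C)); first by rewrite lt_min ltr01 divr_gt0.
  move=> x' xab'; rewrite le_min => /andP[x1 x2].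
  have [u' [v' w']] := weyl_exists cq (confining_right Y0 (cf _ (lab _ xab'))).
  exists u', v'; split => //; exists y => //.
  have := hC q x' u' v' w' (fun _ _ => erefl) (confining_right Y0 (cf _ (lab _ xab'))) x1 y.
  rewrite lexx yY // => /(_ isT)[a1 a2].
  have Cs : C * `|x' - x| <= s by move: x2; rewrite ler_pdivlMr // mulrC.
  have [h1 h2] := hs _ _ (le_trans a1 Cs) (le_trans a2 Cs).
  split => //.
  have : 0 < (sg * u y) * (u y * u' y) by rewrite mulr_gt0.
  have -> : sg * u y * (u y * u' y) = sg * u' y * u y ^+ 2 by ring.
  have := sqr_ge0 (u y); nra.
have dis x : la <= x <= lb -> esc s0 x -> esc (- s0) x -> False.
  move=> xab [u [v [w [y yy [uvn su]]]]] [u' [v' [w' [y' yy' [uvn' su']]]]].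
  have x2 := lab _ xab.
  have [s _ _] := w.
  have same z : z <= - Y -> u' z = u z /\ v' z = v z.
    move=> zY; apply: (weyl_uniq (yY _ zY) cq w w' (fun _ _ => erefl) (confining_right Y0 (cf _ x2))).
    by rewrite lexx yY.
  have [e1 e2] := same _ yy'; rewrite e1 e2 in uvn' su'.
  have cu := has_deriv_continuous s.1.
  have key a b : a <= b -> b <= - Y -> u b * v b < 0 -> 0 < u a * u b.
    move=> ab bY uvb'; rewrite ltNge; apply/negP => hz.
    have [c /andP[ac cb] uc] := zero_between cu ab hz.
    have := uv_nondecr_left s (confining_left Y0 (cf _ x2)) bY cb.
    by rewrite uc mul0r leNgt uvb'.
  have : 0 < u y * u y'.
    have [yy2|yy2] := leP y y'; first exact: key.
    by rewrite mulrC; apply: key => //; exact: ltW.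
  have : 0 < (s0 * u y) * (- s0 * u y') by rewrite mulr_gt0.
  have -> : s0 * u y * (- s0 * u y') = - (s0 ^+ 2 * (u y * u y')) by ring.
  by move=> h1 h2; have := mulr_ge0 (sqr_ge0 s0) (ltW h2); lra.
have lalb : la <= lb by rewrite /la /lb; lra.
have [x xab [nA nB]] := segment_gap lalb (opn s0) (opn (- s0)) dis Aa Bb.
exists x.
  by move: xab; rewrite /la /lb ler_norml => /andP[? ?]; apply/andP; split; lra.
have x2 := lab _ xab.
have [u [v w]] := weyl_exists cq (confining_right Y0 (cf _ x2)).
exists u, v; apply: (weyl_escape Y0 (cf _ x2) w) => y yy.
rewrite leNgt; apply/negP => uvn.
have s00 : s0 != 0 by apply: contraTneq sa; rewrite /s0 => ->; rewrite mulr0 ltxx.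
have uy : u y != 0 by apply: contraTneq uvn => ->; rewrite mul0r ltxx.
have [p|p|p] := ltrgtP (s0 * u y) 0.
- by apply: nB; exists u, v; split => //; exists y => //; rewrite mulNr oppr_gt0.
- by apply: nA; exists u, v; split => //; exists y.
- by move/eqP: p; rewrite mulf_eq0 (negbTE s00) (negbTE uy).
Qed.

Lemma uniform_positive (P : nat -> R -> Prop) (N : nat) :
  (forall m, (m < N)%N -> exists2 d, 0 < d & forall x, 0 < x -> x <= d -> P m x) ->
  exists2 d, 0 < d & forall m x, (m < N)%N -> 0 < x -> x <= d -> P m x.
Proof.
elim: N => [|N IH] h; first by exists 1.
have [d1 d10 h1] := IH (fun m mN => h m (ltnW mN)).
have [d2 d20 h2] := h N (ltnSn N).
exists (Num.min d1 d2); first by rewrite lt_min d10.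
move=> m x; rewrite ltnS leq_eqVlt => /predU1P[->|mN] x0; rewrite le_min => /andP[x1 x2].
  exact: h2.
exact: h1.
Qed.

Lemma uniform_threshold (P : nat -> R -> Prop) (N : nat) :
  (forall m, (m < N)%N -> exists T, forall t, t <= T -> P m t) ->
  exists T, forall m t, (m < N)%N -> t <= T -> P m t.
Proof.
elim: N => [|N IH] h; first by exists 0.
have [d1 h1] := IH (fun m mN => h m (ltnW mN)).
have [d2 h2] := h N (ltnSn N).
exists (Num.min d1 d2).
move=> m x; rewrite ltnS leq_eqVlt => /predU1P[->|mN]; rewrite le_min => /andP[x1 x2].
  exact: h2.
exact: h1.
Qed.

Lemma level_lt m m' : (m < m')%N -> (level m : R) + 2 <= level m'.
Proof.
move=> mm; rewrite /level -natrD ler_nat; lia.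
Qed.

(** Far to the left of the origin, a truncation leaves exactly one eigenvalue
    near each of the first [n] levels and no other up to there, so that an
    increasing enumeration lists these in order. *)
Lemma nth_level_close e : 0 < e -> exists T, forall t q (E : nat -> R), t <= T ->
  truncated_oscillator t q ->
  (forall i j : nat, (0 < i)%N -> (i < j)%N -> E i < E j) ->
  (forall l, l <= 2 * n%:R -> eigenlevel Y q l <-> exists2 i : nat, (0 < i)%N & l = E i) ->
  forall m, (m < n)%N -> `|E m.+1 - level m| <= e.
Proof.
move=> e0.
have [d d0 hd] := @uniform_positive (fun m d => forall t q l1 l2,
  truncated_oscillator t q -> t <= - Y ->
  `|l1 - level m| <= d -> `|l2 - level m| <= d ->
  eigenlevel Y q l1 -> eigenlevel Y q l2 -> l1 = l2) n (fun m mn =>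
    let: ex_intro2 d d0 h := level_unique mn in
    ex_intro2 _ _ d d0 (fun x x0 xd t q l1 l2 qt tY h1 h2 =>
      h t q l1 l2 qt tY (le_trans h1 xd) (le_trans h2 xd))).
pose r := Num.min e (Num.min d (1 / 2)).
have r0 : 0 < r by rewrite !lt_min e0 d0 /=; lra.
have re : r <= e by rewrite ge_min lexx.
have rd : r <= d by rewrite !ge_min lexx orbT.
have r2 : r <= 1 / 2 by rewrite !ge_min lexx !orbT.
have [T1 h1] := @eigenlevels_near_levels R n r r0.
have [T2 h2] := @uniform_threshold (fun m t => forall q, truncated_oscillator t q ->
  exists2 l, `|l - level m| <= r & eigenlevel Y q l) n (fun m mn =>
    let: ex_intro T h := level_exists mn r0 in
    ex_intro _ T (fun t tT q qt => h t q tT qt)).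
exists (Num.min (- Y) (Num.min T1 T2)) => t q E.
rewrite !le_min => /and3P[tY tT1 tT2] qt Einc Espec m.
suff H : (m < n)%N -> `|E m.+1 - level m| <= r by move=> /H /le_trans; apply.
elim/ltn_ind: m => m IH mn.
have lm := @level_le R n m mn.
have [l ll el] := h2 m t mn tT2 q qt.
have l2 : l <= 2 * n%:R by move: ll; rewrite ler_norml => /andP[]; lra.
have [i i0 li] := (Espec l l2).1 el.
have mi : (m < i)%N.
  rewrite ltnNge; apply/negP => im.
  have iE : i = i.-1.+1 by rewrite prednK.
  have im1 : (i.-1 < m)%N by rewrite -iE.
  have := IH _ im1 (ltn_trans im1 mn); rewrite -iE -li => a.
  have := level_lt im1; move: a ll; rewrite !ler_norml => /andP[? ?] /andP[? ?]; lra.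
have El : E m.+1 <= l.
  rewrite li; move: mi; rewrite leq_eqVlt => /predU1P[<-|mi]; first exact: lexx.
  by apply: ltW; exact: Einc.
have E2 : E m.+1 <= 2 * n%:R by exact: le_trans l2.
have eE : eigenlevel Y q (E m.+1) by apply/(Espec _ E2); exists m.+1.
have [j jn hj] := h1 t q _ tT1 qt E2 eE.
have jm : (j <= m)%N.
  rewrite leqNgt; apply/negP => mj.
  have := level_lt mj; move: hj ll; rewrite ltr_norml ler_norml => /andP[? ?] /andP[? ?]; lra.
move: jm; rewrite leq_eqVlt => /predU1P[jm|jm].
  by rewrite jm in hj; exact: ltW.
have hj' := IH _ jm jn.
have ej : eigenlevel Y q (E j.+1).
  have Ej2 : E j.+1 <= 2 * n%:R.
    by apply: le_trans E2; apply: ltW; exact: Einc.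
  by apply/(Espec _ Ej2); exists j.+1.
have EE := hd j r jn r0 rd t q _ _ qt tY (ltW hj) hj' eE ej.
by have := Einc j.+1 m.+1 isT jm; rewrite EE ltxx.
Qed.

End LevelCounting.

(** * The eigenfunctions to the left of the truncation point *)

Section LaplaceMonomials.
Context {R : realType}.
Implicit Types (k d e : R) (i Q : nat).

(** [laplace i k d] is the integral of [s ^+ i * expR (- k s)] over
    [[d, +oo[]. *)
Fixpoint laplace i k d : R :=
  if i is j.+1 then (d ^+ i * expR (- (k * d)) + i%:R * laplace j k d) / k
  else expR (- (k * d)) / k.

Lemma laplace_deriv i k : k != 0 ->
  has_deriv (laplace i k) (fun d => - (d ^+ i * expR (- (k * d)))).
Proof.
move=> k0; elim: i => [|i IH] x /=.
  by derive; rewrite expr0 mul1r; field.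
derive; rewrite /= exprS; field; exact: k0.
Qed.

Lemma laplace_at0 i k : k != 0 -> laplace i k 0 = i`!%:R / k ^+ i.+1.
Proof.
move=> k0; elim: i => [|i IH] /=.
  by rewrite mulr0 oppr0 expR0 fact0 expr1.
rewrite expr0n /= mul0r add0r IH factS natrM [k ^+ i.+2]exprS.
by field; rewrite ?expf_neq0 //; exact: k0.
Qed.

Lemma laplace_ge0 i k d : 0 < k -> 0 <= d -> 0 <= laplace i k d.
Proof.
move=> k0 d0; elim: i => [|i IH] /=; first by rewrite divr_ge0 ?expR_ge0 // ltW.
by rewrite divr_ge0 ?(ltW k0) // addr_ge0 // mulr_ge0 ?expR_ge0 ?exprn_ge0.
Qed.

Lemma monomial_exp_bounded i k : 0 < k ->
  exists2 C, 0 <= C & forall d, 0 <= d -> d ^+ i * expR (- (k * d)) <= C.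
Proof.
move=> k0; case: i => [|i].
  exists 1 => // d d0; rewrite expr0 mul1r -expR0 ler_expR oppr_le0 mulr_ge0 //.
  exact: ltW.
exists ((i.+1%:R / k) ^+ i.+1) => [|d d0]; first by rewrite exprn_ge0 // divr_ge0 // ltW.
rewrite expRN ler_pdivrMr ?expR_gt0 //.
have split_exp (N : R) : N != 0 -> k * d = N * (k * d / N) by move=> N0; field.
rewrite (split_exp i.+1%:R) ?pnatr_eq0 // expRM_natl -exprMn.
set N : R := i.+1%:R; have N0 : 0 < N by rewrite /N ltr0n.
have h := expR_ge1Dx (k * d / N).
have a0 : 0 <= N / k by rewrite divr_ge0 // ltW.
apply: lerXn2r; rewrite ?nnegrE ?(mulr_ge0 a0) ?expR_ge0 //.
have : N / k * (1 + k * d / N) <= N / k * expR (k * d / N) by apply: ler_wpM2l.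
have -> : N / k * (1 + k * d / N) = N / k + d by field; rewrite !gt_eqF.
lra.
Qed.

Lemma laplace_small i k e : 0 < k -> 0 < e ->
  exists Z, forall d, Z <= d -> 0 <= d -> laplace i k d <= e.
Proof.
move=> k0; elim: i e => [|i IH] e e0.
  have ek : 0 < e * k by rewrite mulr_gt0.
  have [Z hZ] := expR_small 1 ek k0; exists Z => d dZ d0 /=.
  by rewrite ler_pdivrMr //; have := hZ d dZ; rewrite normr1 mul1r.
have k2 : 0 < k / 2 by rewrite divr_gt0.
have [C C0 hC] := monomial_exp_bounded i.+1 k2.
have ek : 0 < e * k / 2 by rewrite divr_gt0 // mulr_gt0.
have [Z1 h1] := expR_small C ek k2.
have ei : 0 < e * k / 2 / i.+1%:R by rewrite divr_gt0.
have [Z2 h2] := IH _ ei.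
exists (Num.max Z1 Z2) => d; rewrite ge_max => /andP[d1 d2] d0 /=.
rewrite ler_pdivrMr //.
have a1 : d ^+ i.+1 * expR (- (k * d)) <= e * k / 2.
  apply: le_trans (h1 d d1).
  have -> : - (k * d) = - (k / 2 * d) + - (k / 2 * d) by field.
  rewrite expRD mulrA; apply: ler_wpM2r; first exact: expR_ge0.
  exact: le_trans (hC d d0) (ler_norm _).
have a2 : i.+1%:R * laplace i k d <= e * k / 2.
  by rewrite mulrC -ler_pdivlMr // h2.
lra.
Qed.

End LaplaceMonomials.

Section SlopeBounds.
Context {R : realType}.
Variables (h dh a da : R -> R) (t l C : R).
Hypothesis hd : has_deriv h dh.
Hypothesis as_ : solves (fun y => h y ^+ 2 - l) a da.
Hypothesis a0 : forall y, y <= t -> 0 < a y.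
Hypothesis aC : forall y, y <= t -> a y <= C.

(** Riccati comparison: if [da - k a] were negative somewhere, it would grow
    exponentially in modulus towards [-oo], whereas [a] is bounded and [da]
    nonnegative. *)
Lemma slope_lower k : 1 <= k -> (forall y, y <= t -> k ^+ 2 <= h y ^+ 2 - l) ->
  forall y, y <= t -> k * a y <= da y.
Proof.
move=> k1 hk y1 y1t; rewrite leNgt; apply/negP => z0.
have [ad dad] := as_.
pose z y := da y - k * a y.
have z1 : z y1 < 0 by rewrite /z; lra.
have zd : has_deriv (fun y => z y * expR (k * y))
   (fun y => (h y ^+ 2 - l - k ^+ 2) * a y * expR (k * y)).
  by move=> x; rewrite /z; derive; ring.
have Q1 y : y <= t -> 1 <= h y ^+ 2 - l.
  by move=> yt; apply: le_trans (hk y yt); rewrite expr2; nra.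
have aB y : y <= t -> `|a y| <= C.
  by move=> yt; rewrite gtr0_norm ?a0 ?aC.
have dn y : y <= t -> 0 <= da y.
  move=> yt; have := uv_ge0_left as_ Q1 aB yt.
  by rewrite pmulr_rge0 // a0.
apply: (@linear_unbounded _ (- z y1 * k) (k * C) (- z y1) (- y1)).
  by rewrite mulr_gt0; lra.
move=> w wy; have yy : - w <= y1 by lra.
have wt : - w <= t by lra.
have := deriv_ge0_le zd yy _ => H.
have {}H : z (- w) * expR (k * - w) <= z y1 * expR (k * y1).
  apply: H => x /andP[_ xy]; have xt : x <= t by lra.
  rewrite mulr_ge0 ?expR_ge0 // mulr_ge0 ?(ltW (a0 xt)) //.
  have := hk x xt; lra.
have {}H := exp_shift H.
have e1 : 1 + k * (w + y1) <= expR (k * y1 - k * - w).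
  have -> : k * y1 - k * - w = k * (w + y1) by ring.
  exact: expR_ge1Dx.
have := dn _ wt; have := aC wt => h1 h2.
have h3 : k * a (- w) <= k * C by apply: ler_wpM2l => //; lra.
have h4 : z y1 * expR (k * y1 - k * - w) <= z y1 * (1 + k * (w + y1)).
  by apply: ler_wnM2l => //; exact: ltW.
have : z (- w) = da (- w) - k * a (- w) by [].
lra.
Qed.

(** Riccati comparison with [h + 1]: as [(h + 1) ^+ 2 + dh] is at least [h ^+
    2 - l], a positive gap [da - (h + 1) a] would persist to the left and
    drive [a] below zero. *)
Lemma slope_upper : 0 <= l -> (forall y, y <= t -> 0 <= h y) ->
  (forall y, y <= t -> -1 <= dh y) ->
  forall y, y <= t -> da y <= (h y + 1) * a y.
Proof.
move=> l0 h0 dh0 y1 y1t; rewrite leNgt; apply/negP => zp.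
have [ad dad] := as_; have hd' := hd.
pose z y := da y - (h y + 1) * a y.
have z1 : 0 < z y1 by rewrite /z; lra.
have [H [Hd _]] : exists H : R -> R, has_deriv H (fun y => h y + 1) /\ H 0 = 0.
  apply: primitive_exists.
  by apply: (@has_deriv_continuous _ _ dh) => x; derive; rewrite addr0.
have zd : has_deriv (fun y => z y * expR (H y))
   (fun y => (- l - dh y - 2 * h y - 1) * a y * expR (H y)).
  by move=> x; rewrite /z; derive; ring.
have lo y : y <= y1 -> z y1 <= da y.
  move=> yy; have yt : y <= t by lra.
  have K : z y1 * expR (H y1) <= z y * expR (H y).
    apply: (deriv_le0_ge zd yy) => x /andP[_ xy]; have xt : x <= t by lra.
    rewrite mulr_le0_ge0 ?expR_ge0 // mulr_le0_ge0 ?(ltW (a0 xt)) //.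
    by have := h0 x xt; have := dh0 x xt; have := l0; lra.
  have {}K := exp_shift K.
  have HH : H y <= H y1.
    by apply: (deriv_ge0_le Hd yy) => x /andP[_ xy]; rewrite addr_ge0 // h0 //; lra.
  have zy : 0 < z y.
    have : 0 < z y * expR (H y - H y1) by exact: lt_le_trans K.
    by rewrite pmulr_lgt0 // expR_gt0.
  have e1 : expR (H y - H y1) <= 1 by rewrite -expR0 ler_expR subr_le0.
  have : z y * expR (H y - H y1) <= z y by rewrite ler_piMr // ltW.
  have : 0 <= (h y + 1) * a y by rewrite mulr_ge0 ?addr_ge0 ?h0 // ltW ?a0.
  by move=> p1 p2; have : z y = da y - (h y + 1) * a y by []; lra.
apply: (@linear_unbounded _ (z y1) (a y1) 0 (- y1)) => // w wy.
have yy : - w <= y1 by lra.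
have gd : has_deriv (fun y => z y1 * y) (fun => z y1) by move=> x; derive; ring.
have := deriv_le_sub gd ad yy (fun x hx => lo x (andP hx).2).
have wt : - w <= t by lra.
by have := a0 wt; lra.
Qed.

End SlopeBounds.

Section WeightedIntegrals.
Context {R : realType}.
Variables (g P S : R -> R) (t c M : R) (Q : nat).
Local Notation s := (- t).
Hypothesis g0 : forall d : R, 0 <= d -> 0 <= g d.
Hypothesis gd : forall d : R, 0 <= d -> g d <= d.
Hypothesis M0 : 0 <= M.
Hypothesis c0 : 0 <= c.
Hypothesis g_upper : forall d : R, 0 <= d -> g d <= c * d ^+ Q + M * d ^+ Q.+1.
Hypothesis P0 : forall y : R, y <= t -> 0 <= P y.
Hypothesis t0 : t <= 0.
Hypothesis Sd : forall y : R, is_derive y 1 S (g (t - y) * (- (2 * y) - g (t - y)) * P y).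

(** With [s = - t] and [d = t - y], the derivative of [S] is [g d * (2 s + 2 d
    - g d) * P y]. Bounding the weight by [2 s + 2 d], [g] by its expansion
    and [P] by an exponential gives Laplace integrals. *)
Lemma weighted_upper k y1 : 0 < k -> y1 <= t ->
  (forall y : R, y <= t -> P y <= expR (- (k * (t - y)))) ->
  S t - S y1 <= 2 * s * c * laplace Q k 0 + (2 * s * M + 2 * c) * laplace Q.+1 k 0
    + 2 * M * laplace Q.+2 k 0.
Proof.
move=> k0 y1t hP; have hS : has_deriv S _ := Sd.
have s0 : 0 <= s by have := t0; lra.
have kn : k != 0 by rewrite gt_eqF.
pose U y := 2 * s * c * laplace Q k (t - y) + (2 * s * M + 2 * c) * laplace Q.+1 k (t - y)
    + 2 * M * laplace Q.+2 k (t - y).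
have L0 := laplace_deriv Q kn; have L1 := laplace_deriv Q.+1 kn; have L2 := laplace_deriv Q.+2 kn.
pose dU y := (2 * s * c * (t - y) ^+ Q + (2 * s * M + 2 * c) * (t - y) ^+ Q.+1
    + 2 * M * (t - y) ^+ Q.+2) * expR (- (k * (t - y))).
have Ud : has_deriv U dU.
  by move=> x; rewrite /U /dU; derive; ring.
have U1 : 0 <= U y1.
  have ? : 0 <= t - y1 by rewrite subr_ge0.
  have := M0; have := c0 => ? ?.
  by rewrite !addr_ge0 // mulr_ge0 ?laplace_ge0 // ?addr_ge0 ?mulr_ge0.
have -> : 2 * s * c * laplace Q k 0 + (2 * s * M + 2 * c) * laplace Q.+1 k 0
    + 2 * M * laplace Q.+2 k 0 = U t by rewrite /U subrr.
suff : S t - S y1 <= U t - U y1 by lra.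
apply: (deriv_le_sub hS Ud y1t) => y /andP[_ yt].
pose d := t - y; have d0 : 0 <= d by rewrite subr_ge0.
have -> : - (2 * y) - g (t - y) = 2 * s + 2 * d - g d by rewrite /d; ring.
rewrite /dU -/d; have h1 := g0 d0; have h2 := gd d0; have h3 := g_upper d0.
have e0 := expR_ge0 (- (k * d)).
have sd : 0 <= 2 * s + 2 * d - g d by lra.
have A1 : g d * (2 * s + 2 * d - g d) <= (c * d ^+ Q + M * d ^+ Q.+1) * (2 * s + 2 * d).
  by apply: ler_pM => //; lra.
have A0 : 0 <= g d * (2 * s + 2 * d - g d) by rewrite mulr_ge0.
apply: (@le_trans _ _ ((c * d ^+ Q + M * d ^+ Q.+1) * (2 * s + 2 * d) * expR (- (k * d)))).
  by apply: ler_pM => //; [exact: P0 | exact: hP].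
rewrite le_eqVlt; apply/orP; left; apply/eqP; congr (_ * _).
by rewrite [d ^+ Q.+2]exprS [d ^+ Q.+1]exprS; ring.
Qed.

Variable b : R.
Hypothesis g_lower : forall d : R, 0 <= d -> b * d ^+ Q - M * d ^+ Q.+1 <= g d.

(** Here the weight is at least [2 s], and the Gaussian factor of [P] at least
    [1 - d ^+ 2]. The last term on the left bounds what the comparison
    function retains at [y1]. *)
Lemma weighted_lower k y1 : 0 < k -> y1 <= t ->
  (forall y : R, y <= t -> expR (- (k * (t - y) + (t - y) ^+ 2)) <= P y) ->
  2 * s * (b * laplace Q k 0 - M * laplace Q.+1 k 0 - c * laplace Q.+2 k 0 -
    M * laplace Q.+3 k 0) - 2 * s * `|b| * laplace Q k (t - y1) <= S t - S y1.
Proof.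
move=> k0 y1t hP; have hS : has_deriv S _ := Sd.
have s0 : 0 <= s by have := t0; lra.
have kn : k != 0 by rewrite gt_eqF.
pose U y := 2 * s * (b * laplace Q k (t - y) - M * laplace Q.+1 k (t - y)
   - c * laplace Q.+2 k (t - y) - M * laplace Q.+3 k (t - y)).
have L0 := laplace_deriv Q kn; have L1 := laplace_deriv Q.+1 kn.
have L2 := laplace_deriv Q.+2 kn; have L3 := laplace_deriv Q.+3 kn.
pose dU y := 2 * s * (b * (t - y) ^+ Q - M * (t - y) ^+ Q.+1 - c * (t - y) ^+ Q.+2
    - M * (t - y) ^+ Q.+3) * expR (- (k * (t - y))).
have Ud : has_deriv U dU.
  by move=> x; rewrite /U /dU; derive; ring.
have U1 : U y1 <= 2 * s * `|b| * laplace Q k (t - y1).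
  have td : 0 <= t - y1 by rewrite subr_ge0.
  have p0 := laplace_ge0 Q k0 td.
  have p1 : 0 <= M * laplace Q.+1 k (t - y1) by rewrite mulr_ge0 ?laplace_ge0.
  have p2 : 0 <= c * laplace Q.+2 k (t - y1) by rewrite mulr_ge0 ?laplace_ge0.
  have p3 : 0 <= M * laplace Q.+3 k (t - y1) by rewrite mulr_ge0 ?laplace_ge0.
  have p4 : b * laplace Q k (t - y1) <= `|b| * laplace Q k (t - y1).
    by apply: ler_wpM2r => //; exact: ler_norm.
  rewrite /U -[leRHS]mulrA; apply: ler_wpM2l; first by rewrite mulr_ge0.
  lra.
have <- : U t = 2 * s * (b * laplace Q k 0 - M * laplace Q.+1 k 0 - c * laplace Q.+2 k 0 -
    M * laplace Q.+3 k 0) by rewrite /U subrr.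
suff : U t - U y1 <= S t - S y1 by lra.
apply: (deriv_le_sub Ud hS y1t) => y /andP[_ yt].
pose d := t - y; have d0 : 0 <= d by rewrite subr_ge0.
have -> : - (2 * y) - g (t - y) = 2 * s + 2 * d - g d by rewrite /d; ring.
rewrite /dU -/d; have h1 := g0 d0; have h2 := gd d0; have h3 := g_upper d0.
have h4 := g_lower d0.
have e0 := expR_ge0 (- (k * d)).
have Py : (1 - d ^+ 2) * expR (- (k * d)) <= P y.
  apply: le_trans (hP y yt); rewrite -/d opprD expRD mulrC.
  by apply: ler_wpM2l => //; apply: expR_ge1Dx.
have A1 : 2 * s * g d * P y <= g d * (2 * s + 2 * d - g d) * P y.
  apply: ler_wpM2r; first exact: P0.
  rewrite [g d * _]mulrC; apply: ler_wpM2r => //; lra.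
apply: le_trans A1.
apply: (@le_trans _ _ (2 * s * g d * ((1 - d ^+ 2) * expR (- (k * d))))); last first.
  by apply: ler_wpM2l => //; rewrite !mulr_ge0.
rewrite -[2 * s * g d]mulrA -!mulrA; apply: ler_wpM2l => //.
apply: ler_wpM2l => //; rewrite mulrA; apply: ler_wpM2r => //.
have dd : 0 <= d ^+ 2 by exact: sqr_ge0.
have : d ^+ 2 * g d <= d ^+ 2 * (c * d ^+ Q + M * d ^+ Q.+1) by apply: ler_wpM2l.
rewrite [d ^+ Q.+3]exprS [d ^+ Q.+2]exprS [d ^+ Q.+1]exprS in h4 *.
lra.
Qed.

End WeightedIntegrals.

Section ScaledBounds.
Context {R : realType}.
Implicit Types (x s b c M : R) (i Q N : nat).

Lemma bernoulli_upper x N : 0 <= x <= 1 -> (1 + x) ^+ N <= 1 + 4 ^+ N * x.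
Proof.
move=> /andP[x0 x1]; elim: N => [|N IH]; first by rewrite !expr0 mul1r lerDl.
rewrite !exprS; have p : 1 <= 4 ^+ N :> R by rewrite exprn_ege1 // ler1n.
apply: (@le_trans _ _ ((1 + x) * (1 + 4 ^+ N * x))).
  by apply: ler_wpM2l => //; lra.
have : 4 ^+ N * x * x <= 4 ^+ N * x by rewrite ler_piMr // mulr_ge0 //; lra.
have : x <= 4 ^+ N * x by rewrite ler_peMl.
lra.
Qed.

(** The leading term is [c Q!] times a power of [s / (s - 1)], which is [1 + O
    (1 / s)]; every other term carries an additional factor [1 / s]. *)
Lemma scaled_upper Q c M : 0 <= c -> 0 <= M -> exists2 K, 0 <= K &
  forall s, 2 <= s ->
  (2 * s) ^+ Q * (2 * s * c * laplace Q (2 * (s - 1)) 0 +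
    (2 * s * M + 2 * c) * laplace Q.+1 (2 * (s - 1)) 0 +
    2 * M * laplace Q.+2 (2 * (s - 1)) 0) <= c * Q`!%:R + K / s.
Proof.
move=> c0 M0.
exists (c * Q`!%:R * (4 ^+ Q.+1 * 2) + (Q.+1)`!%:R * 2 ^+ Q.+1 * (M + c) +
   2 * M * (Q.+2)`!%:R * 2 ^+ Q).
  by rewrite !addr_ge0 // !mulr_ge0 // ?exprn_ge0 // addr_ge0.
move=> s s2; have k0 : 0 < s - 1 by lra.
have kn : 2 * (s - 1) != 0 by rewrite mulf_neq0 // gt_eqF.
have s0 : 0 < s by lra.
rewrite !laplace_at0 //.
pose r := s / (s - 1).
have r0 : 0 <= r by rewrite divr_ge0 // ltW.
have rE : r <= 1 + 2 / s.
  rewrite /r ler_pdivrMr // mulrDl mul1r mulrAC -[X in X <= _](subrK 1 s).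
  by rewrite lerD2l ler_pdivlMr //; lra.
have x01 : 0 <= 2 / s <= 1 by rewrite divr_ge0 ?(ltW s0) //= ler_pdivrMr // mul1r.
have r2 : r <= 2 by lra.
have rn N : r ^+ N <= 2 ^+ N by apply: lerXn2r; rewrite ?nnegrE.
have e1 : (2 * s) ^+ Q * (2 * s * c * (Q`!%:R / (2 * (s - 1)) ^+ Q.+1)) =
    c * Q`!%:R * r ^+ Q.+1.
  rewrite /r !exprMn exprVn [(2 : R) ^+ Q.+1]exprS [s ^+ Q.+1]exprS.
  by field; rewrite !expf_neq0 ?gt_eqF.
have e2 : (2 * s) ^+ Q * ((2 * s * M + 2 * c) * ((Q.+1)`!%:R / (2 * (s - 1)) ^+ Q.+2)) =
    (Q.+1)`!%:R * r ^+ Q.+1 * ((M + c / s) / (2 * (s - 1))).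
  rewrite /r !exprMn exprVn [(2 : R) ^+ Q.+2]exprS [(2 : R) ^+ Q.+1]exprS [s ^+ Q.+1]exprS
    [(s - 1) ^+ Q.+2]exprS.
  by field; rewrite !expf_neq0 ?gt_eqF.
have e3 : (2 * s) ^+ Q * (2 * M * ((Q.+2)`!%:R / (2 * (s - 1)) ^+ Q.+3)) =
    2 * M * (Q.+2)`!%:R * r ^+ Q * (1 / (2 * (s - 1)) ^+ 3).
  rewrite /r !exprMn exprVn [(2 : R) ^+ Q.+3]exprS [(2 : R) ^+ Q.+2]exprS
    [(2 : R) ^+ Q.+1]exprS [(s - 1) ^+ Q.+3]exprS [(s - 1) ^+ Q.+2]exprS [(s - 1) ^+ Q.+1]exprS.
  by field; rewrite !expf_neq0 ?gt_eqF.
have i1 : r ^+ Q.+1 <= 1 + 4 ^+ Q.+1 * (2 / s).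
  apply: le_trans (bernoulli_upper Q.+1 x01); apply: lerXn2r => //; rewrite nnegrE; lra.
have ks : s <= 2 * (s - 1) by lra.
have inv1 : (2 * (s - 1))^-1 <= s^-1 by rewrite lef_pV2 ?posrE //; lra.
have i2 : (M + c / s) / (2 * (s - 1)) <= (M + c) / s.
  apply: ler_pM => //.
  - by rewrite addr_ge0 // divr_ge0 // ltW.
  - by rewrite invr_ge0; lra.
  - by rewrite lerD2l ler_pdivrMr // ler_peMr //; lra.
have i3 : 1 / (2 * (s - 1)) ^+ 3 <= s^-1.
  rewrite div1r lef_pV2 ?posrE ?exprn_gt0 //; last lra.
  apply: (le_trans ks); rewrite exprS ler_peMr //; first lra.
  by rewrite exprn_ege1 //; lra.
rewrite [leLHS]mulrDr [X in X + _ <= _]mulrDr e1 e2 e3.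
have j1 : c * Q`!%:R * r ^+ Q.+1 <= c * Q`!%:R * (1 + 4 ^+ Q.+1 * (2 / s)).
  by apply: ler_wpM2l => //; rewrite mulr_ge0.
have j2 : (Q.+1)`!%:R * r ^+ Q.+1 * ((M + c / s) / (2 * (s - 1))) <=
    (Q.+1)`!%:R * 2 ^+ Q.+1 * ((M + c) / s).
  apply: ler_pM => //.
  - by rewrite mulr_ge0 // exprn_ge0.
  - by rewrite divr_ge0 ?addr_ge0 ?divr_ge0 ?(ltW s0) //; lra.
  - by apply: ler_wpM2l.
have j3 : 2 * M * (Q.+2)`!%:R * r ^+ Q * (1 / (2 * (s - 1)) ^+ 3) <=
   2 * M * (Q.+2)`!%:R * 2 ^+ Q * s^-1.
  apply: ler_pM => //.
  - by rewrite !mulr_ge0 // exprn_ge0.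
  - by rewrite divr_ge0 // exprn_ge0 //; lra.
  - by apply: ler_wpM2l; rewrite ?mulr_ge0.
apply: le_trans (lerD (lerD j1 j2) j3) _.
by rewrite le_eqVlt; apply/orP; left; apply/eqP; ring.
Qed.

(** As for the upper bound, with [s / (s + 1)]. *)
Lemma scaled_lower Q b c M : 0 <= c -> 0 <= M -> exists2 K, 0 <= K &
  forall s, 2 <= s ->
  b * Q`!%:R - K / s <=
  (2 * s) ^+ Q * (2 * s * (b * laplace Q (2 * (s + 1)) 0 - M * laplace Q.+1 (2 * (s + 1)) 0
    - c * laplace Q.+2 (2 * (s + 1)) 0 - M * laplace Q.+3 (2 * (s + 1)) 0)).
Proof.
move=> c0 M0.
exists (`|b| * Q`!%:R * 4 ^+ Q.+1 + M * (Q.+1)`!%:R + c * (Q.+2)`!%:R + M * (Q.+3)`!%:R).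
  by rewrite !addr_ge0 // !mulr_ge0 // exprn_ge0.
move=> s s2; have k0 : 0 < s + 1 by lra.
have kn : 2 * (s + 1) != 0 by rewrite mulf_neq0 // gt_eqF.
have s0 : 0 < s by lra.
rewrite !laplace_at0 //.
pose r := s / (s + 1).
have r0 : 0 <= r by rewrite divr_ge0 // ltW.
have r1 : r <= 1 by rewrite ler_pdivrMr //; lra.
have rn N : r ^+ N <= 1 by rewrite exprn_ile1.
have rn0 N : 0 <= r ^+ N by rewrite exprn_ge0.
have e i : (2 * s) ^+ Q * (2 * s * ((Q + i)`!%:R / (2 * (s + 1)) ^+ (Q + i).+1)) =
    (Q + i)`!%:R * r ^+ Q.+1 / (2 * (s + 1)) ^+ i.
  rewrite /r -addSn exprD !exprMn exprVn [(2 : R) ^+ Q.+1]exprS [s ^+ Q.+1]exprS.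
  by field; rewrite !expf_neq0 ?gt_eqF.
have e0 := e 0%N; have e1 := e 1%N; have e2 := e 2%N; have e3 := e 3%N.
rewrite addn0 expr0 divr1 in e0; rewrite addn1 in e1; rewrite addn2 in e2; rewrite addn3 in e3.
have inv i : (0 < i)%N -> forall f : R, 0 <= f -> f * r ^+ Q.+1 / (2 * (s + 1)) ^+ i <= f / s.
  move=> i0 f f0; apply: ler_pM.
  - by rewrite mulr_ge0.
  - by rewrite invr_ge0 exprn_ge0 //; lra.
  - by rewrite ler_piMr.
  - rewrite lef_pV2 ?posrE ?exprn_gt0 //; last lra.
    case: i i0 => // i _; rewrite exprS.
    apply: (@le_trans _ _ (2 * (s + 1))); first lra.
    by rewrite ler_peMr ?exprn_ege1 //; lra.
have i1 := inv 1%N isT (Q.+1)`!%:R (ler0n _ _).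
have i2 := inv 2%N isT (Q.+2)`!%:R (ler0n _ _).
have i3 := inv 3%N isT (Q.+3)`!%:R (ler0n _ _).
have rl : 1 - 4 ^+ Q.+1 / s <= r ^+ Q.+1.
  have x01 : 0 <= 1 / s <= 1 by rewrite divr_ge0 ?(ltW s0) //= ler_pdivrMr // mul1r; lra.
  have := bernoulli_upper Q.+1 x01.
  have -> : r = (1 + 1 / s)^-1 by rewrite /r; field; rewrite !gt_eqF //; lra.
  rewrite exprVn mul1r => B.
  have pp : 0 < 1 + s^-1 by rewrite addr_gt0 // invr_gt0.
  have B1 : 0 < (1 + s^-1) ^+ Q.+1 by rewrite exprn_gt0.
  rewrite -[leRHS]mul1r ler_pdivlMr //.
  set F := 4 ^+ Q.+1 / s in B *.
  have F0 : 0 <= F by rewrite divr_ge0 ?exprn_ge0 // ltW.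
  have [F1|F1] := leP F 1; last first.
    apply: (@le_trans _ _ 0) => //; rewrite mulr_le0_ge0 //; [lra | exact: ltW].
  apply: (@le_trans _ _ ((1 - F) * (1 + F))); first by apply: ler_wpM2l => //; lra.
  by have := sqr_ge0 F; nra.
have bl : b * Q`!%:R - `|b| * Q`!%:R * 4 ^+ Q.+1 / s <= b * Q`!%:R * r ^+ Q.+1.
  have f0 : 0 <= Q`!%:R :> R by [].
  have [b0|b0] := leP 0 b.
    have bf : 0 <= b * Q`!%:R by rewrite mulr_ge0.
    by rewrite (ger0_norm b0); have := ler_wpM2l bf rl; lra.
  have bf : b * Q`!%:R <= 0 by rewrite mulr_le0_ge0 // ltW.
  have := ler_wnM2l bf (rn Q.+1).
  have : 0 <= `|b| * Q`!%:R * 4 ^+ Q.+1 / s.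
    by rewrite divr_ge0 ?(ltW s0) // !mulr_ge0 // exprn_ge0.
  lra.
have -> : (2 * s) ^+ Q * (2 * s * (b * (Q`!%:R / (2 * (s + 1)) ^+ Q.+1) -
   M * ((Q.+1)`!%:R / (2 * (s + 1)) ^+ Q.+2) - c * ((Q.+2)`!%:R / (2 * (s + 1)) ^+ Q.+3) -
   M * ((Q.+3)`!%:R / (2 * (s + 1)) ^+ Q.+4))) =
  b * ((2 * s) ^+ Q * (2 * s * (Q`!%:R / (2 * (s + 1)) ^+ Q.+1))) -
  M * ((2 * s) ^+ Q * (2 * s * ((Q.+1)`!%:R / (2 * (s + 1)) ^+ Q.+2))) -
  c * ((2 * s) ^+ Q * (2 * s * ((Q.+2)`!%:R / (2 * (s + 1)) ^+ Q.+3))) -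
  M * ((2 * s) ^+ Q * (2 * s * ((Q.+3)`!%:R / (2 * (s + 1)) ^+ Q.+4))) by ring.
rewrite e0 e1 e2 e3.
have j1 := ler_wpM2l M0 i1; have j2 := ler_wpM2l c0 i2; have j3 := ler_wpM2l M0 i3.
rewrite [in leRHS]mulrA.
have -> : (`|b| * Q`!%:R * 4 ^+ Q.+1 + M * (Q.+1)`!%:R + c * (Q.+2)`!%:R + M * (Q.+3)`!%:R) / s =
  `|b| * Q`!%:R * 4 ^+ Q.+1 / s + M * ((Q.+1)`!%:R / s) + c * ((Q.+2)`!%:R / s) +
  M * ((Q.+3)`!%:R / s) by ring.
move: bl j1 j2 j3.
move: (b * Q`!%:R * r ^+ Q.+1) (M * (_ / _ ^+ 1)) (c * (_ / _ ^+ 2)) (M * (_ / _ ^+ 3)).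
move: (_ * _ / s) (M * (_ / s)) (c * (_ / s)) (M * (_ / s)) => x1 x2 x3 x4 x5 x6 x7 x8.
lra.
Qed.

End ScaledBounds.

Section ShiftedOscillator.
Context {R : realType}.
Variable n : nat.
Variables (g dg : R -> R).
Hypothesis gdg : has_deriv g dg.
Hypothesis g_left : forall d : R, d <= 0 -> g d = 0.
Hypothesis dg_ge0 : forall d : R, 0 <= dg d.
Hypothesis dg_le1 : forall d : R, dg d <= 1.
Implicit Types (t y l : R).
Local Notation Y := (@radius R n).

(** In the scaled variable the Iwatsuka potential is the square of
    [y + g (t - y)], where [g] does not depend on [t]. *)
Definition shifted_osc t y : R := (y + g (t - y)) ^+ 2.

Lemma shift_ge0 d : 0 <= d -> 0 <= g d.
Proof.
move=> d0; rewrite -(g_left (lexx 0)).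
by apply: (deriv_ge0_le gdg d0) => x _; exact: dg_ge0.
Qed.

Lemma shift_le d : 0 <= d -> g d <= d.
Proof.
move=> d0; have id_ : has_deriv (fun y : R => y) (fun => 1) by move=> x; der.
have := deriv_le_sub gdg id_ d0 (fun x _ => dg_le1 x).
by rewrite (g_left (lexx 0)) !subr0.
Qed.

Let h t y := - (y + g (t - y)).

Lemma shifted_root_deriv t : has_deriv (h t) (fun y => dg (t - y) - 1).
Proof. by have gd := gdg; move=> x; rewrite /h; derive; ring. Qed.

Lemma shifted_root_ge t y : y <= t -> - t <= h t y.
Proof.
move=> yt; have : h t t <= h t y.
  apply: (deriv_le0_ge (shifted_root_deriv t) yt) => x _.
  by have := dg_le1 (t - x); lra.
by rewrite /h subrr (g_left (lexx 0)) addr0.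
Qed.

Lemma shifted_truncated t : t <= 0 -> truncated_oscillator t (shifted_osc t).
Proof.
move=> t0; split.
- have gd := gdg.
  apply: (@has_deriv_continuous _ _ (fun y => 2 * (y + g (t - y)) * (1 - dg (t - y)))).
  by move=> x; rewrite /shifted_osc; derive; rewrite /=; ring.
- by move=> y ty; rewrite /shifted_osc g_left ?addr0 //; lra.
- move=> y yt; rewrite /shifted_osc -[leLHS]sqrrN -[leRHS]sqrrN.
  by have := shifted_root_ge yt; rewrite /h => hh; rewrite ler_sqr ?nnegrE; lra.
Qed.

Section Product.
Variables (t l l0 : R) (u v u0 v0 : R -> R).
Hypothesis tY : t <= - Y.
Hypothesis l_ge0 : 0 <= l.
Hypothesis l0_ge0 : 0 <= l0.
Hypothesis l_le : l <= 2 * n%:R.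
Hypothesis l0_le : l0 <= 2 * n%:R.
Hypothesis es : eigenstate Y (shifted_osc t) l u v.
Hypothesis es0 : eigenstate Y (@osc R) l0 u0 v0.

Let P y := u y * u0 y / (u t * u0 t).

Let t_le0 : t <= 0.
Proof. by have := tY; have := radius_ge0 n (R := R); lra. Qed.

Let qt := shifted_truncated t_le0.

(** Riccati bounds on the logarithmic slopes of both factors: at least [- t -
    1], as both potentials exceed the energy by [(- t - 1) ^+ 2] to the left
    of [t], and at most [1 - y]. *)
Lemma product_slopes : exists2 dP, has_deriv P dP &
  forall y, y <= t -> [/\ 0 < P y, 2 * (- t - 1) * P y <= dP y & dP y <= 2 * (1 - y) * P y].
Proof.
have Y0 := radius_ge0 n (R := R).
have tY' := tY; have t0' := t_le0.
have [w [C uC]] := es; have [w0 [C0 uC0]] := es0.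
have [s _ _] := w; have [s0 _ _] := w0.
have [cq _ q2] := qt.
have cf := truncated_confining qt tY l_le.
have cf0 := osc_confining l0_le.
have sg y : y <= t -> 0 < u y * u t.
  by move=> yt; apply: (eigenstate_same_sign_left Y0 cq cf es); lra.
have sg0 y : y <= t -> 0 < u0 y * u0 t.
  by move=> yt; apply: (eigenstate_same_sign_left Y0 osc_continuous cf0 es0); lra.
have ut : u t != 0 by have := sg t (lexx t); apply: contraTneq => ->; rewrite mul0r ltxx.
have u0t : u0 t != 0 by have := sg0 t (lexx t); apply: contraTneq => ->; rewrite mul0r ltxx.
pose a y := (u t)^-1 * u y; pose da y := (u t)^-1 * v y.
pose p y := (u0 t)^-1 * u0 y; pose dp y := (u0 t)^-1 * v0 y.
have as_ : solves (fun y => h t y ^+ 2 - l) a da.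
  have -> : (fun y => h t y ^+ 2 - l) = (fun y => shifted_osc t y - l).
    by apply/funext => y; rewrite /h sqrrN.
  exact: solves_scale.
have ps_ : solves (fun y => (- y) ^+ 2 - l0) p dp.
  have -> : (fun y => (- y) ^+ 2 - l0) = (fun y => osc y - l0).
    by apply/funext => y; rewrite /h sqrrN.
  exact: solves_scale.
have pos (f : R -> R) y : 0 < f y * f t -> 0 < (f t)^-1 * f y.
  move=> ff; have ft : f t != 0 by move: ff; apply: contraTneq => ->; rewrite mulr0 ltxx.
  have -> : (f t)^-1 * f y = (f y * f t) / (f t) ^+ 2 by field.
  by rewrite divr_gt0 // lt_neqAle sqr_ge0 eq_sym sqrf_eq0 ft.
have a0 y : y <= t -> 0 < a y by move=> /sg; exact: pos.
have p0 y : y <= t -> 0 < p y by move=> /sg0; exact: pos.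
have bnd (f : R -> R) D y : (forall y, `|f y| <= D) -> (f t)^-1 * f y <= `|(f t)^-1| * D.
  move=> fD; apply: le_trans (ler_norm _) _; rewrite normrM.
  by apply: ler_wpM2l.
have aC y : y <= t -> a y <= `|(u t)^-1| * C by move=> _; apply: bnd.
have pC y : y <= t -> p y <= `|(u0 t)^-1| * C0 by move=> _; apply: bnd.
have k1 : 1 <= - t - 1 by have := radius_ge2 n (R := R); lra.
have hk (r : R) : r <= 2 * n%:R -> (- t - 1) ^+ 2 <= t ^+ 2 - r.
  by move: tY'; rewrite /radius => ? ?; nra.
have l0' := l_ge0; have l00' := l0_ge0.
have nd : has_deriv (fun y : R => - y) (fun => -1) by move=> x; der.
have lo_a := slope_lower as_ a0 aC k1.
have lo_p := slope_lower ps_ p0 pC k1.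
have up_a := slope_upper (shifted_root_deriv t) as_ a0 l0'.
have up_p := slope_upper nd ps_ p0 l00'.
exists (fun y => da y * p y + a y * dp y).
  have -> : P = fun y => a y * p y.
    by apply/funext => y; rewrite /P /a /p; field; rewrite ?ut ?u0t.
  by have := as_.1; have := ps_.1 => ? ? x; der.
move=> y yt; have -> : P y = a y * p y by rewrite /P /a /p; field; rewrite ?ut ?u0t.
have := a0 y yt; have := p0 y yt => py ay.
have la : (- t - 1) * a y <= da y.
  apply: lo_a => // z zt; apply: le_trans (hk _ l_le) _.
  by rewrite lerD2r /h sqrrN; exact: q2.
have lp : (- t - 1) * p y <= dp y.
  apply: lo_p => // z zt; apply: le_trans (hk _ l0_le) _.
  by rewrite lerD2r -[leLHS]sqrrN ler_sqr ?nnegrE; lra.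
have ua : da y <= (h t y + 1) * a y.
  apply: up_a => // z zt; first by have := shifted_root_ge zt; lra.
  by have := dg_ge0 (t - z); lra.
have up : dp y <= (- y + 1) * p y.
  by apply: up_p => // z zt; lra.
have hy : h t y <= - y by rewrite /h; have := @shift_ge0 (t - y); rewrite subr_ge0 => /(_ yt); lra.
have ua' : da y <= (1 - y) * a y.
  by apply: le_trans ua _; apply: ler_wpM2r; [exact: ltW | lra].
split; first by rewrite mulr_gt0.
  have h1 : (- t - 1) * a y * p y <= da y * p y by rewrite ler_pM2r.
  have h2 : a y * ((- t - 1) * p y) <= a y * dp y by rewrite ler_pM2l.
  lra.
have h1 : da y * p y <= (1 - y) * a y * p y by rewrite ler_pM2r.
have h2 : a y * dp y <= a y * ((- y + 1) * p y) by rewrite ler_pM2l.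
lra.
Qed.

Lemma product_at : P t = 1.
Proof.
have Y0 := radius_ge0 n (R := R).
have [w [C uC]] := es; have [w0 [C0 uC0]] := es0; have tY' := tY.
have [cq _ q2] := qt.
have cf := truncated_confining qt tY l_le; have cf0 := osc_confining l0_le.
have sg := eigenstate_same_sign_left Y0 cq cf es tY' tY'.
have sg0 := eigenstate_same_sign_left Y0 osc_continuous cf0 es0 tY' tY'.
rewrite /P divff // mulf_neq0 //.
  by move: sg; apply: contraTneq => ->; rewrite mul0r ltxx.
by move: sg0; apply: contraTneq => ->; rewrite mul0r ltxx.
Qed.

Lemma product_upper y : y <= t -> P y <= expR (- (2 * (- t - 1) * (t - y))).
Proof.
move=> yt; have [dP Pd hP] := product_slopes.
pose k := 2 * (- t - 1).
have zd : has_deriv (fun y => P y * expR (- (k * y))) (fun y => (dP y - k * P y) * expR (- (k * y))).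
  by move=> x; derive; ring.
have : P y * expR (- (k * y)) <= P t * expR (- (k * t)).
  apply: (deriv_ge0_le zd yt) => x /andP[_ xt]; have [_ h1 _] := hP x xt.
  by rewrite mulr_ge0 ?expR_ge0 // subr_ge0.
move/exp_shift; rewrite product_at mul1r.
by have -> : - (k * t) - - (k * y) = - (2 * (- t - 1) * (t - y)) by rewrite /k; ring.
Qed.

Lemma product_lower y : y <= t ->
  expR (- (2 * (- t + 1) * (t - y) + (t - y) ^+ 2)) <= P y.
Proof.
move=> yt; have [dP Pd hP] := product_slopes.
have zd : has_deriv (fun y => - (P y * expR (y ^+ 2 - 2 * y)))
   (fun y => (2 * (1 - y) * P y - dP y) * expR (y ^+ 2 - 2 * y)).
  by move=> x; derive; rewrite /=; ring.
have : - (P y * expR (y ^+ 2 - 2 * y)) <= - (P t * expR (t ^+ 2 - 2 * t)).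
  apply: (deriv_ge0_le zd yt) => x /andP[_ xt]; have [_ _ h1] := hP x xt.
  by rewrite mulr_ge0 ?expR_ge0 // subr_ge0.
rewrite lerN2 product_at => /exp_shift.
have -> : y ^+ 2 - 2 * y - (t ^+ 2 - 2 * t) = - - (2 * (- t + 1) * (t - y) + (t - y) ^+ 2).
  by ring.
move=> H; rewrite expRN -[leLHS]mul1r ler_pdivrMr ?expR_gt0 //.
by move: H; rewrite opprK.
Qed.

End Product.
End ShiftedOscillator.

(** * Asymptotics of the levels of the shifted oscillator *)

Section Reference.
Context {R : realType}.
Variables (n m : nat).
Hypothesis mn : (m < n)%N.
Implicit Types (t y l e : R) (q u v F : R -> R).
Local Notation Y := (@radius R n).

Let L : R := level m.

Let lm : L <= 2 * n%:R - 1.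
Proof. exact: level_le. Qed.

Let lm2 : L <= 2 * n%:R.
Proof. by have := lm; lra. Qed.

Lemma hermite_fun_radius_neq0 : hermite_fun m Y != 0.
Proof.
have [B hB] := @hermite_fun_bounded R m.
exact: (bound_state_neq0 (radius_ge0 n) osc_continuous (osc_confining lm2)
  (hermite_fun_solves m) hB (hermite_fun_neq0 m) (lexx _)).
Qed.

(** The Hermite function in the normalisation of [eigenstate]. *)
Definition ref y : R := (hermite_fun m Y)^-1 * hermite_fun m y.
Definition ref_deriv y : R := (hermite_fun m Y)^-1 * hermite_fun_deriv m y.

Lemma ref_eigenstate : eigenstate Y (@osc R) L ref ref_deriv.
Proof.
have [B hB] := @hermite_fun_bounded R m.
have h y : `|ref y| <= `|(hermite_fun m Y)^-1| * B by rewrite normrM; apply: ler_wpM2l.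
split; last by exists (`|(hermite_fun m Y)^-1| * B).
split; [exact: solves_scale (hermite_fun_solves m) | | by exists (`|(hermite_fun m Y)^-1| * B)].
by rewrite /ref mulVf // hermite_fun_radius_neq0.
Qed.

(** The integral over the line of [ref ^+ 2]. *)
Definition ref_norm : R := hermite_norm m / hermite_fun m Y ^+ 2.

Lemma ref_norm_gt0 : 0 < ref_norm.
Proof.
by rewrite divr_gt0 ?hermite_norm_gt0 // lt_neqAle sqr_ge0 eq_sym sqrf_eq0 hermite_fun_radius_neq0.
Qed.

(** On a fixed segment the eigenstate is close to [ref]; outside it both decay
    exponentially, uniformly in [t] and [l]. *)
Lemma overlap_total e : 0 < e -> exists2 d, 0 < d & exists T, forall t q l u v F,
  t <= T -> truncated_oscillator t q -> `|l - L| <= d -> eigenstate Y q l u v ->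
  has_deriv F (fun y => u y * ref y) ->
  exists Z, forall z z', Z <= z -> Z <= z' -> `|F z - F (- z') - ref_norm| <= e.
Proof.
move=> e0; have es0 := ref_eigenstate; have [w0 [C0 b0]] := es0; have [s0 u0Y _] := w0.
have Y0 := radius_ge0 n (R := R); have Y2 := radius_ge2 n (R := R).
have mm := mn; have lm' := lm; have lm2' := lm2.
have cf0 := osc_confining lm2'.
have cr := has_deriv_continuous s0.1.
have hY := hermite_fun_radius_neq0.
have [F0 [F0d _]] : exists F : R -> R, has_deriv F (fun y => ref y ^+ 2) /\ F 0 = 0.
  apply: primitive_exists; have rd := s0.1.
  by apply: (@has_deriv_continuous _ _ (fun y => 2 * ref y * ref_deriv y)) => x; derive; rewrite /=; ring.
have e4 : 0 < e / 4 by lra.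
have [Z0 hZ0] : exists Z, forall z z', Z <= z -> Z <= z' -> `|F0 z - F0 (- z') - ref_norm| <= e / 4.
  have p2 : 0 < hermite_fun m Y ^+ 2 by rewrite lt_neqAle sqr_ge0 eq_sym sqrf_eq0 hY.
  have Gd : has_deriv (fun y => hermite_fun m Y ^+ 2 * F0 y) (fun y => hermite_fun m y ^+ 2).
    by move=> x; derive; rewrite /ref; field.
  have ee : 0 < hermite_fun m Y ^+ 2 * (e / 4) by rewrite mulr_gt0.
  have [Z hZ] := hermite_fun_norm Gd ee; exists Z => z z' z1 z2.
  have := hZ z z' z1 z2.
  have -> : hermite_fun m Y ^+ 2 * F0 z - hermite_fun m Y ^+ 2 * F0 (- z') - hermite_norm m =
    hermite_fun m Y ^+ 2 * (F0 z - F0 (- z') - ref_norm) by rewrite /ref_norm; field.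
  by rewrite normrM (gtr0_norm p2) ler_pM2l.
pose K := 1 + (`|ref (- Y)| + 1) * `|ref (- Y)|.
have K1 : 1 <= K by rewrite lerDl mulr_ge0 // addr_ge0.
have two0 : (0 : R) < 2 by [].
have [Z1 hZ1] := expR_small (K * expR (2 * Y)) e4 two0.
pose Zc := Num.max Y (Num.max Z0 Z1).
have cY : Y <= Zc by rewrite le_max lexx.
have c0 : Z0 <= Zc by rewrite !le_max lexx !orbT.
have c1 : Z1 <= Zc by rewrite !le_max lexx !orbT.
have Zc0 : 0 < Zc by lra.
have NY : - Zc <= Y by lra.
have NYc : - Y <= Zc by lra.
have [C C1 hC] := weyl_close_on NY cY osc_continuous w0 (confining_right Y0 cf0).
have [B B0 hB] := continuous_bounded (- Zc) Zc cr.
pose s1 := Num.min 1 (e / 4 / (B * (2 * Zc))).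
have s10 : 0 < s1 by rewrite lt_min ltr01 /= divr_gt0 // !mulr_gt0.
exists (Num.min 1 (s1 / C)); first by rewrite lt_min ltr01 divr_gt0.
exists (- Zc) => t q l u v F tZ qt; rewrite le_min => /andP[l1 l2] es Fd.
have l2n : l <= 2 * n%:R by move: l1; rewrite ler_norml => /andP[]; lra.
have tY : t <= - Y by lra.
have cf := truncated_confining qt tY l2n.
have [w [Cu bu]] := es; have [s _ _] := w; have [cq q1 _] := qt.
have close y : - Zc <= y <= Zc -> `|u y - ref y| <= s1.
  move=> yZ; have [a _] := hC q l u v w (fun y h => q1 y (le_trans tZ h))
    (confining_right Y0 (osc_confining l2n)) l1 y yZ.
  by apply: le_trans a _; move: l2; rewrite ler_pdivlMr // mulrC.
have s11 : s1 <= 1 by rewrite ge_min lexx.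
have s12 : s1 * (B * (2 * Zc)) <= e / 4.
  by rewrite -ler_pdivlMr ?mulr_gt0 // ge_min lexx orbT.
have tail z : Zc <= z -> K * expR (2 * Y) * expR (- (2 * z)) <= e / 4.
  move=> zZ; have := hZ1 z (le_trans c1 zZ).
  by rewrite ger0_norm // mulr_ge0 ?expR_ge0 //; lra.
(* beyond [Zc] both factors decay at least like [expR (Y - |y|)] *)
have right z : Zc <= z -> `|F z - F Zc| <= e / 4.
  move=> zZ.
  have bd y : Zc <= y <= z -> `|u y * ref y| <= 1 * expR (2 * Y - 2 * y).
    move=> /andP[Zy _]; have Yy : Y <= y := le_trans cY Zy.
    have [a1 _] := weyl_tail w (confining_right Y0 cf) Yy.
    have [a2 _] := weyl_tail w0 (confining_right Y0 cf0) Yy.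
    have -> : 2 * Y - 2 * y = - (y - Y) + - (y - Y) by ring.
    by rewrite mul1r normrM expRD; apply: ler_pM.
  apply: le_trans (increment_exp_decay Fd two0 ler01 zZ bd) _.
  apply: le_trans (tail Zc (lexx _)); rewrite expRD mulrA.
  apply: ler_wpM2r; first exact: expR_ge0.
  apply: ler_wpM2r; first exact: expR_ge0.
  by apply: le_trans K1; rewrite ler_pdivrMr // mul1r ler1n.
have left z : Zc <= z -> `|F (- Zc) - F (- z)| <= e / 4.
  move=> zZ; pose K2 := (`|ref (- Y)| + 1) * `|ref (- Y)|.
  have K20 : 0 <= K2 by rewrite mulr_ge0 // addr_ge0.
  have Gd : has_deriv (fun y => F (- y)) (fun y => - (u (- y) * ref (- y))).
    by move=> x; derive; ring.
  have uY : `|u (- Y)| <= `|ref (- Y)| + 1.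
    have -> : u (- Y) = ref (- Y) + (u (- Y) - ref (- Y)) by ring.
    apply: le_trans (ler_normD _ _) _; rewrite lerD2l; apply: le_trans s11.
    by apply: close; rewrite lerN2 cY NYc.
  have bd y : Zc <= y <= z -> `|- (u (- y) * ref (- y))| <= K2 * expR (2 * Y - 2 * y).
    move=> /andP[yZ _]; have yY : - y <= - Y by rewrite lerN2; exact: le_trans yZ.
    have a1 := decay_left s (confining_left Y0 cf) (fun y _ => bu y) (lexx (- Y)) yY.
    have a2 := decay_left s0 (confining_left Y0 cf0) (fun y _ => b0 y) (lexx (- Y)) yY.
    have -> : 2 * Y - 2 * y = - (- Y - - y) + - (- Y - - y) by ring.
    rewrite normrN normrM expRD /K2.
    apply: le_trans (ler_pM (normr_ge0 _) (normr_ge0 _) a1 a2) _.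
    set E := expR _; have E0 : 0 <= E by exact: expR_ge0.
    have -> : `|u (- Y)| * E * (`|ref (- Y)| * E) = `|u (- Y)| * (`|ref (- Y)| * (E * E)) by ring.
    by rewrite -mulrA; apply: ler_wpM2r => //; rewrite !mulr_ge0.
  rewrite distrC; apply: le_trans (increment_exp_decay Gd two0 K20 zZ bd) _.
  apply: le_trans (tail Zc (lexx _)); rewrite expRD mulrA.
  apply: ler_wpM2r; first exact: expR_ge0.
  apply: ler_wpM2r; first exact: expR_ge0.
  apply: (@le_trans _ _ K2); last by rewrite /K -/K2 lerDr.
  by rewrite ler_piMr // invf_le1 // ler1n.
have mid : `|F Zc - F (- Zc) - (F0 Zc - F0 (- Zc))| <= e / 4.
  have ZZ : - Zc <= Zc := le_trans NY cY.
  have gd : has_deriv (fun y => B * s1 * y) (fun => B * s1) by move=> x; derive; ring.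
  have dd : has_deriv (fun y => F y - F0 y) (fun y => u y * ref y - ref y ^+ 2) by move=> x; der.
  have bd y : - Zc <= y <= Zc -> `|u y * ref y - ref y ^+ 2| <= B * s1.
    move=> yZ; have -> : u y * ref y - ref y ^+ 2 = ref y * (u y - ref y) by ring.
    by rewrite normrM; apply: ler_pM => //; [exact: hB | exact: close].
  have := increment_dominated dd gd ZZ bd.
  have -> : F Zc - F0 Zc - (F (- Zc) - F0 (- Zc)) = F Zc - F (- Zc) - (F0 Zc - F0 (- Zc)) by ring.
  have -> : B * s1 * Zc - B * s1 * - Zc = s1 * (B * (2 * Zc)) by ring.
  by move=> /le_trans; apply.
exists Zc => z z' zZ zZ'.
have -> : F z - F (- z') - ref_norm = (F z - F Zc) + (F (- Zc) - F (- z')) +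
    (F Zc - F (- Zc) - (F0 Zc - F0 (- Zc))) + (F0 Zc - F0 (- Zc) - ref_norm) by ring.
have -> : e = e / 4 + e / 4 + e / 4 + e / 4 by field.
apply: le_trans (ler_normD _ _) _; apply: lerD; last exact: hZ0.
apply: le_trans (ler_normD _ _) _; apply: lerD; last exact: mid.
by apply: le_trans (ler_normD _ _) _; apply: lerD; [exact: right | exact: left].
Qed.

End Reference.

Section Asymptotics.
Context {R : realType}.
Variables (n m : nat).
Hypothesis mn : (m < n)%N.
Variables (g dg : R -> R).
Hypothesis gdg : has_deriv g dg.
Hypothesis g_left : forall d : R, d <= 0 -> g d = 0.
Hypothesis dg_ge0 : forall d : R, 0 <= dg d.
Hypothesis dg_le1 : forall d : R, dg d <= 1.
Implicit Types (t y l e : R) (q u v F : R -> R).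
Local Notation Y := (@radius R n).
Local Notation L := (level m : R).
Local Notation u0 := (@ref R n m).
Local Notation v0 := (@ref_deriv R n m).
Local Notation q := (shifted_osc g).

Section Eigenvalue.
Variables (t l : R) (u v F : R -> R).
Hypothesis tY : t <= - Y.
Hypothesis l_ge0 : 0 <= l.
Hypothesis l_le : l <= 2 * n%:R.
Hypothesis es : eigenstate Y (q t) l u v.
Hypothesis Fd : has_deriv F (fun y => u y * u0 y).

Let A := u t * u0 t.
Let W y := v y * u0 y - u y * v0 y.
Let P y := u y * u0 y / A.

(** The primitive of the perturbation of the potential weighted by the product
    of both eigenfunctions, normalised at [t]. It is constant to the right of
    [t]; over the whole line the Wronskian disappears, and its increment
    measures the energy shift. *)
Definition running_shift y : R := - (W y + (l - L) * F y) / A.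
Local Notation S := running_shift.

Let L_le : L <= 2 * n%:R.
Proof. by have := @level_le R n m mn; lra. Qed.

Let L_ge0 : 0 <= L.
Proof. exact: ler0n. Qed.

Let t_le0 : t <= 0.
Proof. by have := tY; have := radius_ge0 n (R := R); lra. Qed.

Let es0 := ref_eigenstate mn (R := R).

Lemma amplitude_neq0 : A != 0.
Proof.
have := product_at gdg g_left dg_le1 tY l_le L_le es es0.
by rewrite /A; apply: contra_eq_neq => ->; rewrite invr0 mulr0 eq_sym oner_neq0.
Qed.

Lemma running_shift_deriv :
  has_deriv S (fun y => g (t - y) * (- (2 * y) - g (t - y)) * P y).
Proof.
have [w _] := es; have [w0 _] := es0.
have [[ud vd] _ _] := w; have [[u0d v0d] _ _] := w0; have Fd' := Fd.
move=> x; rewrite /running_shift /W /P; derive.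
rewrite /osc /shifted_osc; field; exact: amplitude_neq0.
Qed.

Lemma running_shift_right z : t <= z -> S z = S t.
Proof.
move=> tz; apply/esym; apply: (deriv_eq0_eq running_shift_deriv tz) => x /andP[tx _].
by rewrite g_left ?mul0r //; lra.
Qed.

(** The exact form of first-order perturbation theory: the Wronskians vanish
    as [z] and [z'] tend to infinity. *)
Lemma energy_shift z z' : t <= z ->
  (l - L) * (F z - F (- z')) = - (A * (S t - S (- z'))) + (W (- z') - W z).
Proof.
move=> tz; rewrite -(running_shift_right tz) /running_shift.
by field; exact: amplitude_neq0.
Qed.

Lemma running_shift_nondecr y : y <= t -> S y <= S t.
Proof.
move=> yt; apply: (deriv_ge0_le running_shift_deriv yt) => x /andP[_ xt].
have tx : 0 <= t - x by rewrite subr_ge0.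
have g1 := shift_ge0 gdg g_left dg_ge0 tx.
have g2 := shift_le gdg g_left dg_le1 tx.
have [dP _ hP] := product_slopes gdg g_left dg_ge0 dg_le1 tY l_ge0 L_ge0 l_le L_le es es0.
have [p _ _] := hP x xt; have t0 := t_le0.
apply: mulr_ge0; last exact: ltW.
by rewrite mulr_ge0 //; lra.
Qed.

Lemma shift_upper Q c M y : 0 <= c -> 0 <= M ->
  (forall d : R, 0 <= d -> g d <= c * d ^+ Q + M * d ^+ Q.+1) -> y <= t ->
  S t - S y <= 2 * - t * c * laplace Q (2 * (- t - 1)) 0 +
    (2 * - t * M + 2 * c) * laplace Q.+1 (2 * (- t - 1)) 0
    + 2 * M * laplace Q.+2 (2 * (- t - 1)) 0.
Proof.
move=> c0 M0 gu yt.
have Y2 := radius_ge2 n (R := R); have tY' := tY.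
have [dP _ hP] := product_slopes gdg g_left dg_ge0 dg_le1 tY l_ge0 L_ge0 l_le L_le es es0.
apply: (weighted_upper (shift_ge0 gdg g_left dg_ge0) (shift_le gdg g_left dg_le1) M0 c0 gu
  (P := P) _ t_le0 running_shift_deriv) => //; first by move=> z zt; have [/ltW] := hP z zt.
  by rewrite mulr_gt0 //; lra.
exact: (product_upper gdg g_left dg_ge0 dg_le1 tY l_ge0 L_ge0 l_le L_le es es0).
Qed.

Lemma shift_lower Q b c M y : 0 <= c -> 0 <= M ->
  (forall d : R, 0 <= d -> g d <= c * d ^+ Q + M * d ^+ Q.+1) ->
  (forall d : R, 0 <= d -> b * d ^+ Q - M * d ^+ Q.+1 <= g d) -> y <= t ->
  2 * - t * (b * laplace Q (2 * (- t + 1)) 0 - M * laplace Q.+1 (2 * (- t + 1)) 0 -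
    c * laplace Q.+2 (2 * (- t + 1)) 0 - M * laplace Q.+3 (2 * (- t + 1)) 0)
    - 2 * - t * `|b| * laplace Q (2 * (- t + 1)) (t - y) <= S t - S y.
Proof.
move=> c0 M0 gu gl yt.
have Y2 := radius_ge2 n (R := R); have tY' := tY.
have [dP _ hP] := product_slopes gdg g_left dg_ge0 dg_le1 tY l_ge0 L_ge0 l_le L_le es es0.
apply: (weighted_lower (shift_ge0 gdg g_left dg_ge0) (shift_le gdg g_left dg_le1) M0 c0 gu
  (P := P) _ t_le0 running_shift_deriv gl) => //; first by move=> z zt; have [/ltW] := hP z zt.
  by rewrite mulr_gt0 //; lra.
exact: (product_lower gdg g_left dg_ge0 dg_le1 tY l_ge0 L_ge0 l_le L_le es es0).
Qed.

Lemma wronskian_vanishes e : 0 < e ->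
  exists Z, forall y, Z <= `|y| -> `|W y| <= e.
Proof.
have cf := truncated_confining (shifted_truncated gdg g_left dg_le1 t_le0) tY l_le.
exact: (eigenstate_wronskian_small (radius_ge0 n) cf (osc_confining L_le) es es0).
Qed.

End Eigenvalue.
End Asymptotics.

Lemma far_point (R : realType) (x1 x2 x3 t Y : R) : t <= 0 -> 0 <= Y -> exists z : R,
  [/\ x1 <= z, x2 <= z, x3 <= z + t & [/\ 0 <= z, Y <= z, t <= z & - z <= t]].
Proof.
move=> t0 Y0; exists (`|x1| + `|x2| + `|x3| - t + Y).
have := ler_norm x1; have := ler_norm x2; have := ler_norm x3.
have := normr_ge0 x1; have := normr_ge0 x2; have := normr_ge0 x3 => *.
by split; [lra | lra | lra | split; lra].
Qed.

Lemma far_left (R : realType) (t Y : R) : t <= - Y -> 2 <= Y -> 0 < - t /\ 2 <= - t.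
Proof. by move=> *; split; lra. Qed.

Lemma ratio_arithmetic (R : realType) (r rY a a' e : R) : a <= 1 -> a <= e / 2 ->
  a' <= 1 / 2 -> a' <= e / 8 -> 0 < a' -> 0 < r -> `|r - rY| <= a' * r ->
  `|rY - 1| <= a -> `|r - 1| <= e.
Proof.
move=> a1 a2 a'1 a'2 a'0 r0; rewrite !ler_norml => /andP[v1 v2] /andP[y1 y2].
have ah : a' * r <= 1 / 2 * r by rewrite ler_pM2r.
have r4 : r <= 4 by lra.
have ae : a' * r <= e / 8 * 4 by apply: ler_pM => //; exact: ltW.
by apply/andP; split; lra.
Qed.

Lemma three_quarters (R : realType) (x1 x2 h : R) : x1 <= x2 + h / 4 + h / 4 ->
  x2 - h / 4 - h / 4 - h / 4 <= x1 -> 0 < h -> `|x1 - x2| <= h.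
Proof. by move=> *; rewrite ler_norml; apply/andP; split; lra. Qed.

Section LevelAsymptotics.
Context {R : realType}.
Variables (n m : nat).
Hypothesis mn : (m < n)%N.
Variables (g dg : R -> R).
Hypothesis gdg : has_deriv g dg.
Hypothesis g_left : forall d : R, d <= 0 -> g d = 0.
Hypothesis dg_ge0 : forall d : R, 0 <= dg d.
Hypothesis dg_le1 : forall d : R, dg d <= 1.
Implicit Types (t y l e : R) (q u v F : R -> R).
Local Notation Y := (@radius R n).
Local Notation L := (level m : R).
Local Notation u0 := (@ref R n m).
Local Notation v0 := (@ref_deriv R n m).
Local Notation q := (shifted_osc g).
Local Notation I := (@ref_norm R n m).

Lemma level_window l : `|l - L| <= 1 / 2 -> 0 <= l <= 2 * n%:R.
Proof.
have lm := @level_le R n m mn; have l1 : 1 <= L by rewrite ler1n.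
by rewrite ler_norml => /andP[? ?]; apply/andP; split; lra.
Qed.

Lemma overlap_positive : exists2 d : R, 0 < d <= 1 / 2 & forall t l u v F, t <= - Y ->
  `|l - L| <= d -> eigenstate Y (q t) l u v -> has_deriv F (fun y => u y * u0 y) ->
  (forall y, y <= - Y -> 0 < u y * u0 y) /\
  (forall z, Y <= z -> F (- Y) <= F z).
Proof.
have es0 := ref_eigenstate mn (R := R); have [w0 [C0 b0]] := es0.
have Y2 := radius_ge2 n (R := R); have Y0 := radius_ge0 n (R := R).
have [d d2 [j j0 ov]] := overlap mn es0.
exists d => // t l u v F tY ld es Fd; have [w _] := es.
have t0 : t <= 0 by lra.
have Y00 : - Y <= 0 by lra.
have qt := shifted_truncated gdg g_left dg_le1 t0.
have qY := truncated_mono qt tY Y00.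
have d0 : `|L - L| <= d by rewrite subrr normr0; move: d2 => /andP[/ltW].
have [p pF] := ov _ _ _ _ _ _ _ _ qY (osc_truncated Y00) ld d0 w w0.
have ld2 : `|l - L| <= 1 / 2 by move: d2 => /andP[_]; exact: le_trans.
have /andP[l0 l2] := level_window ld2.
have [cq _ _] := qt.
have cf := truncated_confining qt tY l2.
have lm := @level_le R n m mn.
have L2 : L <= 2 * n%:R by lra.
have cf0 := osc_confining L2.
split; last by move=> z Yz; have := pF F Fd z Yz; lra.
move=> y yY.
have s1 := eigenstate_same_sign_left Y0 cq cf es yY (lexx (- Y)).
have s2 := eigenstate_same_sign_left Y0 osc_continuous cf0 es0 yY (lexx (- Y)).
have : 0 < (u y * u (- Y)) * (u0 y * u0 (- Y)) by rewrite mulr_gt0.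
have -> : u y * u (- Y) * (u0 y * u0 (- Y)) = (u y * u0 y) * (u (- Y) * u0 (- Y)) by ring.
by rewrite pmulr_lgt0.
Qed.

Section Ratio.
Variables (t l Z Ks : R) (u v F : R -> R).
Hypothesis tY : t <= - Y.
Hypothesis l_ge0 : 0 <= l.
Hypothesis l_le : l <= 2 * n%:R.
Hypothesis es : eigenstate Y (q t) l u v.
Hypothesis Fd : has_deriv F (fun y => u y * u0 y).
Hypothesis FZ : forall z z', Z <= z -> Z <= z' -> `|F z - F (- z') - I| <= I / 2.
Hypothesis pos : forall y, y <= - Y -> 0 < u y * u0 y.
Hypothesis Fpos : forall z, Y <= z -> F (- Y) <= F z.

Let X := l - L.
Let A := u t * u0 t.
Let W y := v y * u0 y - u y * v0 y.
Let S := running_shift n m t l u v F.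

Hypothesis S_le : forall y, y <= t -> S t - S y <= Ks.

Let A_gt0 : 0 < A.
Proof. exact: pos. Qed.

Let I_gt0 : 0 < I.
Proof. exact: ref_norm_gt0. Qed.

Let t_le0 : t <= 0.
Proof. by have := tY; have := radius_ge0 n (R := R); lra. Qed.

Let W_small e : 0 < e -> exists Z, forall y, Z <= `|y| -> `|W y| <= e.
Proof. by move=> e0; have [Z' hZ'] := wronskian_vanishes mn gdg g_left dg_le1 tY l_le es e0; exists Z'. Qed.

(** The energy shift times the overlap is the amplitude at [t] times the
    increment of [running_shift], and the overlap is at least half of its
    limit. *)
Lemma shift_bound : `|X| * (I / 2) <= A * Ks.
Proof.
apply/ler_addgt0Pr => r r0; have r2 : 0 < r / 2 by lra.
have [Zw hw] := W_small r2.
have [z [z1 z2 _ [z3 _ tz zt]]] := far_point Z Zw 0 t_le0 (radius_ge0 n).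
have E := energy_shift mn gdg g_left dg_le1 tY l_le es Fd z tz.
have s1 := S_le zt.
have s0 : 0 <= S t - S (- z).
  rewrite subr_ge0.
  exact: (running_shift_nondecr mn gdg g_left dg_ge0 dg_le1 tY l_ge0 l_le es Fd zt).
have w1 : `|W z| <= r / 2 by apply: hw; rewrite ger0_norm.
have w2 : `|W (- z)| <= r / 2 by apply: hw; rewrite normrN ger0_norm.
have D1 : I / 2 <= F z - F (- z).
  by have := FZ z1 z1; rewrite ler_norml => /andP[+ _]; lra.
have D0 : 0 <= F z - F (- z) by have := I_gt0; lra.
apply: (@le_trans _ _ (`|X| * (F z - F (- z)))); first by apply: ler_wpM2l.
rewrite -[X in _ * X <= _](ger0_norm D0) -normrM /X E.
apply: le_trans (ler_normD _ _) _; apply: lerD.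
  by rewrite normrN normrM (gtr0_norm A_gt0) (ger0_norm s0) ler_pM2l.
by apply: le_trans (ler_normB _ _) _; rewrite [leRHS](splitr r) lerD.
Qed.

(** To the right of [t] the Wronskian is the energy shift times the overlap
    that remains beyond [y]. *)
Lemma wronskian_bound y : t <= y -> y <= - Y -> `|W y| <= `|X| * (3 / 2 * I).
Proof.
move=> ty yY; apply/ler_addgt0Pr => r r0.
have [Zw hw] := W_small r0.
have [z [z1 z2 _ [z3 z4 tz zt]]] := far_point Z Zw 0 t_le0 (radius_ge0 n).
have zy : - z <= y by exact: le_trans ty.
have w1 : `|W z| <= r by apply: hw; rewrite ger0_norm.
have An : A != 0 by rewrite gt_eqF // A_gt0.
have e1 : W y = W z + X * (F z - F y).
  have := running_shift_right mn gdg g_left dg_le1 tY l_le es Fd ty.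
  rewrite -(running_shift_right mn gdg g_left dg_le1 tY l_le es Fd tz) /running_shift.
  rewrite -/A -/(W y) -/(W z) -/X => /(congr1 (fun r => - (r * A))).
  rewrite !divfK // !opprK => e2; have e3 : W y + X * F y = W z + X * F z by exact: e2.
  by move: e3; move: (W y) (W z) X => x1 x2 x3 e3; lra.
have f1 : F (- z) <= F y.
  by apply: (deriv_ge0_le Fd zy) => x /andP[_ xy]; apply: ltW; apply: pos; exact: le_trans yY.
have f2 : F y <= F (- Y).
  by apply: (deriv_ge0_le Fd yY) => x /andP[_ xy]; apply: ltW; apply: pos.
have f3 := Fpos z4.
have f4 : `|F z - F y| <= 3 / 2 * I.
  rewrite ger0_norm; last by rewrite subr_ge0 (le_trans f2).
  by have := FZ z1 z1; rewrite ler_norml => /andP[_]; lra.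
rewrite e1; apply: le_trans (ler_normD _ _) _; rewrite normrM addrC lerD //.
exact: ler_wpM2l.
Qed.

(** Integrates [(u / u0)' = W / u0 ^+ 2] against the barrier [- (u0 ^+ 2)^-1],
    whose derivative dominates since [u0 v0 >= u0 ^+ 2] on the left. *)
Lemma ratio_variation :
  `|u t / u0 t - u (- Y) / u0 (- Y)| <= 3 / 2 * Ks * (u t / u0 t).
Proof.
have Y0 := radius_ge0 n (R := R).
have [w0 [C0 b0]] := ref_eigenstate mn (R := R); have [s0 _ _] := w0.
have [w _] := es; have [s _ _] := w.
have [[ud vd] [u0d v0d]] := (s, s0).
have lm : L <= 2 * n%:R by have := @level_le R n m mn; lra.
have cf0 := osc_confining lm.
have ne y : y <= - Y -> u0 y != 0.
  by move=> yY; have := pos yY; apply: contraTneq => ->; rewrite mulr0 ltxx.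
have sq y : y <= - Y -> 0 < u0 y ^+ 2.
  by move=> yY; rewrite lt_neqAle sqr_ge0 eq_sym sqrf_eq0 ne.
pose k := `|X| * (3 / 2 * I).
have k0 : 0 <= k by rewrite mulr_ge0 // mulr_ge0 // ltW // I_gt0.
have rd y : y <= - Y -> is_derive y 1 (fun y => u y / u0 y) (W y / u0 y ^+ 2).
  move=> yY; have uy := ne y yY; derive; first exact: uy.
  by rewrite /W; field.
have Nd y : y <= - Y -> is_derive y 1 (fun y => - (k / 2 * (u0 y ^+ 2)^-1)) (k * (u0 y * v0 y) / u0 y ^+ 4).
  move=> yY; have uy := ne y yY; derive; first by rewrite sqrf_eq0.
  by rewrite /=; field.
have Nb y : t <= y <= - Y -> `|W y / u0 y ^+ 2| <= k * (u0 y * v0 y) / u0 y ^+ 4.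
  move=> /andP[ty yY]; have uy := ne y yY; have p2 := sq y yY.
  have p4 : 0 < u0 y ^+ 4 by rewrite (_ : 4 = 2 * 2)%N // exprM exprn_gt0.
  have hh := uv_ge_sqr_left s0 (confining_left Y0 cf0) (fun y _ => b0 y) yY.
  rewrite normrM normfV (gtr0_norm p2).
  apply: (@le_trans _ _ (k / u0 y ^+ 2)).
    by apply: ler_wpM2r; [rewrite invr_ge0 ltW | exact: wronskian_bound].
  rewrite ler_pdivlMr //.
  have -> : k / u0 y ^+ 2 * u0 y ^+ 4 = k * u0 y ^+ 2 by field.
  by apply: ler_wpM2l.
have N0 : 0 <= k / 2 * (u0 (- Y) ^+ 2)^-1.
  by rewrite mulr_ge0 ?divr_ge0 // invr_ge0 sqr_ge0.
have b1 y : t <= y <= - Y -> W y / u0 y ^+ 2 <= k * (u0 y * v0 y) / u0 y ^+ 4.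
  by move=> /Nb; apply: le_trans; exact: ler_norm.
have b2 y : t <= y <= - Y -> - (W y / u0 y ^+ 2) <= k * (u0 y * v0 y) / u0 y ^+ 4.
  by move=> /Nb; apply: le_trans; rewrite -normrN; exact: ler_norm.
have up : - (k / 2 * (u0 t ^+ 2)^-1) - u t / u0 t <= - (k / 2 * (u0 (- Y) ^+ 2)^-1) - u (- Y) / u0 (- Y).
  apply: (@deriv_ge0_le_on _ (fun y => - (k / 2 * (u0 y ^+ 2)^-1) - u y / u0 y)
    (fun y => k * (u0 y * v0 y) / u0 y ^+ 4 - W y / u0 y ^+ 2) _ _ tY).
    by move=> x /andP[_ xY]; exact: der_add (Nd x xY) (der_opp (rd x xY)).
  by move=> x xY; rewrite subr_ge0 b1.
have lo : - (k / 2 * (u0 t ^+ 2)^-1) + u t / u0 t <= - (k / 2 * (u0 (- Y) ^+ 2)^-1) + u (- Y) / u0 (- Y).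
  apply: (@deriv_ge0_le_on _ (fun y => - (k / 2 * (u0 y ^+ 2)^-1) + u y / u0 y)
    (fun y => k * (u0 y * v0 y) / u0 y ^+ 4 + W y / u0 y ^+ 2) _ _ tY).
    by move=> x /andP[_ xY]; exact: der_add (Nd x xY) (rd x xY).
  by move=> x xY; rewrite -lerBlDr sub0r b2.
apply: (@le_trans _ _ (k / 2 * (u0 t ^+ 2)^-1)).
  move: up lo N0; move: (k / 2 * _) (k / 2 * _) (u t / _) (u (- Y) / _) => x1 x2 x3 x4 *.
  by rewrite ler_norml; apply/andP; split; lra.
have u0t := ne t tY.
have -> : 3 / 2 * Ks * (u t / u0 t) = 3 / 2 * (A * Ks) * (u0 t ^+ 2)^-1 by rewrite /A; field.
apply: ler_wpM2r; first by rewrite invr_ge0 sqr_ge0.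
have -> : k / 2 = 3 / 2 * (`|X| * (I / 2)) by rewrite /k; field.
by apply: ler_wpM2l; [rewrite divr_ge0 | exact: shift_bound].
Qed.

End Ratio.

(** The first-order shift is so small that the eigenfunction, normalised on
    the right, still agrees with the Hermite function at the truncation
    point: [(u / u0)' = W / u0 ^+ 2] and [W] is bounded by the shift. *)
Lemma ratio_close e : 0 < e -> exists2 d : R, 0 < d & exists T, forall t l u v,
  t <= T -> `|l - L| <= d -> eigenstate Y (q t) l u v -> `|u t / u0 t - 1| <= e.
Proof.
move=> e0; have [w0 [C0 b0]] := ref_eigenstate mn (R := R); have [s0 _ _] := w0.
have Y2 := radius_ge2 n (R := R); have Y0 := radius_ge0 n (R := R).
have L2 : L <= 2 * n%:R by have := @level_le R n m mn; lra.
have cf0 := osc_confining L2.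
have I2 : 0 < I / 2 by rewrite divr_gt0 // ref_norm_gt0.
have [d1 d10 [T1 h1]] := overlap_total mn I2.
have [d2 /andP[d20 d22] h2] := overlap_positive.
have [K K0 hK] := scaled_upper 1 ler01 (lexx (0 : R)).
have YY : - Y <= Y by lra.
have [C C1 hC] := weyl_close YY osc_continuous w0 (confining_right Y0 cf0).
have uY : u0 (- Y) != 0.
  exact: (bound_state_neq0_left Y0 osc_continuous cf0 s0 b0 (weyl_neq0 w0) (lexx _)).
have uY0 : 0 < `|u0 (- Y)| by rewrite normr_gt0.
pose a := Num.min 1 (e / 2); pose a' := Num.min (1 / 2) (e / 8).
have a0 : 0 < a by rewrite lt_min ltr01 divr_gt0.
have a'0 : 0 < a' by rewrite lt_min !divr_gt0.
have a1 : a <= 1 by rewrite ge_min lexx.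
have a2 : a <= e / 2 by rewrite ge_min lexx orbT.
have a'1 : a' <= 1 / 2 by rewrite ge_min lexx.
have a'2 : a' <= e / 8 by rewrite ge_min lexx orbT.
pose K' := 1 + K.
have K'0 : 0 < K' by rewrite ltr_wpDr.
exists (Num.min (Num.min d1 d2) (a * `|u0 (- Y)| / C)).
  by rewrite !lt_min d10 d20 divr_gt0 // mulr_gt0.
exists (Num.min (Num.min T1 (- Y)) (- (3 / 2 * K' / a'))) => t l u v.
rewrite !le_min -!andbA => /and3P[tT1 tY tK] /and3P[ld1 ld2 ld3] es.
have ld4 : `|l - L| <= 1 / 2 by exact: le_trans d22.
have /andP[l0 l2] := level_window ld4.
have [tp t2] := far_left tY Y2.
have t0 : t <= 0 by rewrite -oppr_ge0 ltW.
have qt := shifted_truncated gdg g_left dg_le1 t0.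
have [w _] := es; have [s _ _] := w; have [cq q1 _] := qt.
have [[ud vd] [u0d v0d]] := (s, s0).
have [F [Fd _]] : exists F : R -> R, has_deriv F (fun y => u y * u0 y) /\ F 0 = 0.
  apply: primitive_exists.
  by apply: (@has_deriv_continuous _ _ (fun y => v y * u0 y + u y * v0 y)) => x; derive; ring.
have [Z hZ] := h1 t _ l u v F tT1 qt ld1 es Fd.
have [pos Fpos] := h2 t l u v F tY ld2 es Fd.
have Sb y : y <= t -> running_shift n m t l u v F t - running_shift n m t l u v F y <= K' / - t.
  move=> yt; apply: le_trans (shift_upper (Q := 1) (c := 1) (M := 0) mn gdg g_left dg_ge0 dg_le1 tY l0 l2 es Fd ler01 (lexx 0) _ yt) _.
    by move=> x x0; rewrite mul0r addr0 mul1r expr1; exact: (shift_le gdg g_left dg_le1 x0).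
  have := hK _ t2; rewrite expr1 (_ : 1`!%N = 1%N) // mul1r => b1.
  have p2 : 0 < 2 * - t by rewrite mulr_gt0.
  rewrite -(ler_pM2l p2); apply: le_trans b1 _.
  have -> : 2 * - t * (K' / - t) = 2 * K' by field; rewrite -oppr_eq0 gt_eqF.
  have : K / - t <= K.
    by rewrite ler_pdivrMr // ler_peMr //; apply: le_trans t2; rewrite ler1n.
  by move=> Kt; rewrite /K' mulrDr mulr1 lerD // ?(le_trans Kt) ?ler_peMl // ler1n.
have var := ratio_variation tY l0 l2 es Fd hZ pos Fpos Sb.
have u0t : u0 t != 0.
  by have := pos t tY; apply: contraTneq => ->; rewrite mulr0 ltxx.
have rho0 : 0 < u t / u0 t.
  have -> : u t / u0 t = (u t * u0 t) / u0 t ^+ 2 by field.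
  by rewrite divr_gt0 ?pos // lt_neqAle sqr_ge0 eq_sym sqrf_eq0 u0t.
have Ka : 3 / 2 * (K' / - t) <= a'.
  by rewrite mulrA ler_pdivrMr // [a' * _]mulrC -ler_pdivrMr // lerNr.
have rYb : `|u (- Y) / u0 (- Y) - 1| <= a.
  have -> : u (- Y) / u0 (- Y) - 1 = (u (- Y) - u0 (- Y)) / u0 (- Y) by field.
  rewrite normrM normfV ler_pdivrMr //.
  have ld5 : `|l - L| <= 1 by apply: le_trans ld4 _; rewrite ler_pdivrMr // mul1r ler1n.
  have [|c _] := hC _ _ _ _ w (fun y h => q1 y (le_trans tY h)) (confining_right Y0 (osc_confining l2)) ld5 (- Y).
    by rewrite lexx YY.
  by apply: le_trans c _; move: ld3; rewrite ler_pdivlMr // mulrC.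
have {}var : `|u t / u0 t - u (- Y) / u0 (- Y)| <= a' * (u t / u0 t).
  by apply: le_trans var _; rewrite ler_pM2r.
exact: ratio_arithmetic a1 a2 a'1 a'2 a'0 rho0 var rYb.
Qed.

(** Solves [x D = - rho sg + w] for [x] when [rho ~ 1], [sg ~ B], [D ~ J] and
    [w ~ 0]. *)
Lemma quotient_perturbation (B J e : R) : 0 <= B -> 0 < J -> 0 < e ->
  exists2 h : R, 0 < h & forall x D rho sg w : R, x * D = - (rho * sg) + w ->
    `|D - J| <= h -> `|rho - 1| <= h -> `|sg - B| <= h -> `|w| <= h ->
    `|x * J + B| <= e.
Proof.
move=> B0 J0 e0; pose K := (2 * (B + 1) + 1) * 2 / J.
have K0 : 0 <= K by rewrite divr_ge0 ?(ltW J0) // mulr_ge0 //; lra.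
have kb0 : 0 < K + B + 3 by lra.
pose h := Num.min (Num.min 1 (J / 2)) (e / (K + B + 3)).
have h0 : 0 < h by rewrite !lt_min ltr01 !divr_gt0.
have h1 : h <= 1 by rewrite !ge_min lexx.
have h2 : h <= J / 2 by rewrite !ge_min lexx orbT.
have h3 : h * (K + B + 3) <= e by rewrite -ler_pdivlMr // !ge_min lexx !orbT.
exists h => // x D rho sg w xD DJ r1 sB wh.
have sgB : `|sg| <= B + 1.
  by move: sB; rewrite !ler_norml => /andP[? ?]; apply/andP; split; lra.
have rho2 : `|rho| <= 2.
  by move: r1; rewrite !ler_norml => /andP[? ?]; apply/andP; split; lra.
have D2 : J / 2 <= D by move: DJ; rewrite ler_norml => /andP[]; lra.
have xb : `|x| <= K.
  rewrite /K ler_pdivlMr //.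
  have : `|x| * (J / 2) <= 2 * (B + 1) + 1.
    apply: (@le_trans _ _ (`|x| * D)); first by apply: ler_wpM2l.
    have D0 : 0 <= D by lra.
    rewrite -[X in _ * X <= _](ger0_norm D0) -normrM xD.
    apply: le_trans (ler_normD _ _) _; rewrite normrN normrM.
    by apply: lerD; [apply: ler_pM | exact: le_trans h1].
  lra.
have -> : x * J + B = - (x * (D - J)) + (- ((rho - 1) * sg) + (B - sg) + w).
  have -> : - (x * (D - J)) = - (x * D) + x * J by ring.
  by rewrite xD; ring.
apply: le_trans (ler_normD _ _) _.
have i1 : `|- (x * (D - J))| <= K * h by rewrite normrN normrM; apply: ler_pM.
have i2 : `|- ((rho - 1) * sg)| <= h * (B + 1) by rewrite normrN normrM; apply: ler_pM.
have i3 := ler_normD (- ((rho - 1) * sg) + (B - sg)) w.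
have i4 := ler_normD (- ((rho - 1) * sg)) (B - sg).
rewrite distrC in sB; lra.
Qed.

Variables (Q : nat) (b : R).
Hypothesis b0 : 0 <= b.
Hypothesis g_taylor : forall e, 0 < e -> exists2 M : R, 0 <= M & forall d : R, 0 <= d ->
  (b - e) * d ^+ Q - M * d ^+ Q.+1 <= g d <= (b + e) * d ^+ Q + M * d ^+ Q.+1.

(** If [g d] is equivalent to [b d ^+ Q] at [0], the level [L] is shifted by
    [- b Q! / (2 |t|) ^+ Q] times the density of the normalised Hermite
    function at [t]. *)
Lemma scaled_asymptotics e : 0 < e -> exists2 d : R, 0 < d & exists T, forall t l u v,
  t <= T -> `|l - L| <= d -> eigenstate Y (q t) l u v ->
  `|(l - L) * (2 * - t) ^+ Q * hermite_norm m / hermite_fun m t ^+ 2 + b * Q`!%:R| <= e.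
Proof.
move=> e0; have I0 := ref_norm_gt0 mn (R := R).
have Y2 := radius_ge2 n (R := R); have Y0 := radius_ge0 n (R := R).
have B0 : 0 <= b * Q`!%:R by rewrite mulr_ge0.
have [h h0 pert] := quotient_perturbation B0 I0 e0.
have f0 : 0 < Q`!%:R :> R by rewrite ltr0n fact_gt0.
pose e1 := h / (4 * Q`!%:R).
have e10 : 0 < e1 by rewrite divr_gt0 // mulr_gt0.
have e1f : e1 * Q`!%:R = h / 4 by rewrite /e1; field; rewrite gt_eqF.
have [M M0 gM] := g_taylor e10.
have c0 : 0 <= b + e1 by rewrite addr_ge0 // ltW.
have [K1 K10 hK1] := scaled_upper Q c0 M0.
have [K2 K20 hK2] := scaled_lower Q (b - e1) c0 M0.
have [d1 d10 [T1 hT1]] := ratio_close h0.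
have [d2 d20 [T2 hT2]] := overlap_total mn h0.
have [d3 /andP[d30 d32] hT3] := overlap_positive.
exists (Num.min (Num.min d1 d2) d3); first by rewrite !lt_min d10 d20 d30.
exists (Num.min (Num.min T1 T2) (Num.min (- Y) (- (4 * (K1 + K2) / h)))) => t l u v.
rewrite !le_min -!andbA => /and4P[tT1 tT2 tY tK] /and3P[ld1 ld2 ld3] es.
have [tp t2] := far_left tY Y2.
have t0 : t <= 0 by rewrite -oppr_ge0 ltW.
have /andP[l0 l2] := level_window (le_trans ld3 d32).
have qt := shifted_truncated gdg g_left dg_le1 t0.
have [w _] := es; have [s _ _] := w.
have rho1 := hT1 t l u v tT1 ld1 es.
have [w0 _] := ref_eigenstate mn (R := R); have [s0 _ _] := w0.
have [[ud vd] [u0d v0d]] := (s, s0).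
have [F [Fd _]] : exists F : R -> R, has_deriv F (fun y => u y * u0 y) /\ F 0 = 0.
  apply: primitive_exists.
  by apply: (@has_deriv_continuous _ _ (fun y => v y * u0 y + u y * v0 y)) => x; derive; ring.
have [Z hZ] := hT2 t _ l u v F tT2 qt ld2 es Fd.
have [pos _] := hT3 t l u v F tY ld3 es Fd.
have u0t : u0 t != 0.
  by have := pos t tY; apply: contraTneq => ->; rewrite mulr0 ltxx.
have sq0 : 0 < u0 t ^+ 2 by rewrite lt_neqAle sqr_ge0 eq_sym sqrf_eq0 u0t.
pose X := l - L; pose W y := v y * u0 y - u y * v0 y.
pose S := running_shift n m t l u v F.
pose c := (2 * - t) ^+ Q.
have cp : 0 < c by rewrite exprn_gt0 // mulr_gt0.
pose ew := h * u0 t ^+ 2 / (2 * c).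
have ew0 : 0 < ew by rewrite divr_gt0 // mulr_gt0.
have [Zw hw] := wronskian_vanishes mn gdg g_left dg_le1 tY l2 es ew0.
pose bb := `|b - e1| + 1.
have bb0 : 0 < bb by rewrite ltr_wpDl.
pose el := h / (4 * (c * (2 * - t) * bb)).
have el0 : 0 < el by rewrite divr_gt0 // !mulr_gt0.
have kl : 0 < 2 * (- t + 1) by rewrite mulr_gt0 // addr_gt0.
have [Zl hl] := laplace_small Q kl el0.
have [z [z1 z2 zl [z3 z4 tz zt]]] := far_point Z Zw Zl t0 Y0.
have zl' : Zl <= t - - z by rewrite opprK addrC.
have zl0 : 0 <= t - - z by rewrite subr_ge0.
have Kt K : 0 <= K -> K <= K1 + K2 -> K / - t <= h / 4.
  move=> K00 KK; rewrite ler_pdivrMr // [h / 4 * _]mulrC -ler_pdivrMr ?divr_gt0 //.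
  apply: le_trans (_ : 4 * (K1 + K2) / h <= _); last by rewrite lerNr.
  have -> : K / (h / 4) = 4 * K / h by field; rewrite gt_eqF.
  by rewrite ler_pM2r ?invr_gt0 // ler_pM2l.
have K1t : K1 / - t <= h / 4 by apply: Kt => //; rewrite lerDl.
have K2t : K2 / - t <= h / 4 by apply: Kt => //; rewrite lerDr.
have gu (d : R) : 0 <= d -> g d <= (b + e1) * d ^+ Q + M * d ^+ Q.+1.
  by move=> /gM /andP[].
have gw (d : R) : 0 <= d -> (b - e1) * d ^+ Q - M * d ^+ Q.+1 <= g d.
  by move=> /gM /andP[].
have sg_up : c * (S t - S (- z)) <= b * Q`!%:R + h / 4 + h / 4.
  have := shift_upper mn gdg g_left dg_ge0 dg_le1 tY l0 l2 es Fd c0 M0 gu zt.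
  rewrite -(ler_pM2l cp) => /le_trans /(_ (hK1 _ t2)).
  by rewrite mulrDl e1f => /le_trans; apply; rewrite lerD2l.
have sg_lo : b * Q`!%:R - h / 4 - h / 4 - h / 4 <= c * (S t - S (- z)).
  have := shift_lower mn gdg g_left dg_ge0 dg_le1 tY l0 l2 es Fd c0 M0 gu gw zt.
  rewrite -(ler_pM2l cp) => /(le_trans _); apply; rewrite mulrBr.
  apply: lerB; last first.
    apply: (@le_trans _ _ (c * (2 * - t * bb * el))).
      rewrite ler_pM2l //; apply: ler_pM.
      - by rewrite !mulr_ge0 // ltW.
      - exact: laplace_ge0.
      - by apply: ler_wpM2l; [rewrite mulr_ge0 // ltW | rewrite lerDl].
      - exact: hl.
    by rewrite le_eqVlt; apply/orP; left; apply/eqP; rewrite /el; field;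
      rewrite -?[t == 0]oppr_eq0 !gt_eqF.
  apply: le_trans (hK2 _ t2); rewrite mulrBl e1f.
  by rewrite lerB.
have E := energy_shift mn gdg g_left dg_le1 tY l2 es Fd z tz.
have w1 : `|W z| <= ew by apply: hw; rewrite ger0_norm.
have w2 : `|W (- z)| <= ew by apply: hw; rewrite normrN ger0_norm.
have -> : (l - L) * (2 * - t) ^+ Q * hermite_norm m / hermite_fun m t ^+ 2 =
    X * c / u0 t ^+ 2 * I.
  have hY := hermite_fun_radius_neq0 mn (R := R).
  have ht : hermite_fun m t != 0 by move: u0t; rewrite /ref mulf_eq0 negb_or => /andP[].
  rewrite /ref_norm /ref /X /c; move: ((2 * - t) ^+ Q) => cc.
  by field; rewrite ht hY.
apply: (pert _ (F z - F (- z)) (u t / u0 t) (c * (S t - S (- z))) (c * (W (- z) - W z) / u0 t ^+ 2)) => //.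
- have -> : X * c / u0 t ^+ 2 * (F z - F (- z)) = X * (F z - F (- z)) * c / u0 t ^+ 2 by ring.
  by rewrite /X E -/S -/(W z) -/(W (- z)); field.
- exact: hZ.
- exact: three_quarters sg_up sg_lo h0.
- rewrite normrM normfV (gtr0_norm sq0) normrM (gtr0_norm cp) ler_pdivrMr //.
  apply: (@le_trans _ _ (c * (ew + ew))).
    by rewrite ler_pM2l //; apply: le_trans (ler_normB _ _) _; exact: lerD.
  by rewrite le_eqVlt; apply/orP; left; apply/eqP; rewrite /ew; field; rewrite gt_eqF.
Qed.

End LevelAsymptotics.

(** * Square-integrable eigenfunctions and bounded solutions *)

Section SquareIntegrable.
Context {R : realType}.
Implicit Types (u v f V : R -> R) (x y r K d l lam : R).
Local Notation mu := (@lebesgue_measure R).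

(** Markov's inequality, with one constant for all sets and levels. *)
Lemma integrable_bounded_below_on disp (T : measurableType disp)
    (m : {measure set T -> \bar R}) (f : T -> R) : m.-integrable setT (EFin \o f) ->
  exists2 M : R, 0 <= M & forall (A : set T) (d : R), measurable A -> 0 <= d ->
    (forall z : T, A z -> d <= f z) -> (d%:E * m A <= M%:E)%E.
Proof.
move=> /integrableP[mf fin].
have Mfin : (\int[m]_z `|(EFin \o f) z|)%E \is a fin_num.
  by rewrite ge0_fin_numE // integral_ge0.
exists (fine (\int[m]_z `|(EFin \o f) z|)%E) => [|A d mA d0 h].
  by apply: fine_ge0; exact: integral_ge0.
have ma := measurableT_comp (@abse_measurable R setT) mf.
rewrite fineK // -(integral_cst m mA).
apply: (@le_trans _ _ (\int[m]_(z in A) `|(EFin \o f) z|)%E).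
  apply: ge0_le_integral => //.
  - exact: measurable_funTS.
  - move=> z Az /=.
    by rewrite lee_fin ger0_norm ?h // (le_trans d0) ?h.
by apply: ge0_subset_integral.
Qed.

Lemma in_L2_not_bounded_below_on u d : in_L2 u -> 0 < d ->
  exists2 N : R, 0 < N & forall x : R, ~ (forall y : R, x <= y <= x + N -> d <= u y ^+ 2).
Proof.
move=> /Lfun2_integrable_sqr /integrable_bounded_below_on[M M0 hM] d0.
have N0 : 0 < (M + 1) / d by rewrite divr_gt0 // ltr_wpDl.
exists ((M + 1) / d) => // x0 h; set N := (M + 1) / d in h N0.
have muN : mu `[x0, x0 + N]%classic = N%:E.
  by rewrite lebesgue_measure_itv /= lte_fin ltrDl N0 -EFinD addrAC subrr add0r.
have : (d%:E * mu `[x0, (x0 + N)%R]%classic <= M%:E)%E.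
  by apply: hM => [||z]; [exact: measurable_itv | exact: ltW | rewrite /= in_itv/=; exact: h].
rewrite muN -EFinM lee_fin mulrC divfK ?gt_eqF //.
by rewrite leNgt ltrDl ltr01.
Qed.

Lemma in_L2_not_bounded_below u x0 d : in_L2 u -> 0 < d ->
  (forall x, x0 <= x -> d <= u x ^+ 2) -> False.
Proof.
move=> L2 d0 h; have [N _ hN] := in_L2_not_bounded_below_on L2 d0.
by apply: (hN x0) => y /andP[/h].
Qed.

Lemma in_L2_not_bounded_below_left u x0 d : in_L2 u -> 0 < d ->
  (forall x, x <= x0 -> d <= u x ^+ 2) -> False.
Proof.
move=> L2 d0 h; have [N _ hN] := in_L2_not_bounded_below_on L2 d0.
by apply: (hN (x0 - N)) => y /andP[_]; rewrite subrK => /h.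
Qed.

Lemma integral_exp_abs_lty r : 0 < r -> (\int[mu]_x (expR (- (r * `|x|)))%:E < +oo)%E.
Proof.
move=> r0.
have ca : continuous (fun x : R => expR (- (r * `|x|))).
  move=> x; apply: (continuous_comp (f := fun x : R => - (r * `|x|))); last exact: continuous_expR.
  apply: continuousN; apply: continuousM; first exact: cst_continuous.
  exact: norm_continuous.
rewrite ge0_symfun_integralT //; last first.
- by move=> x /=; rewrite normrN.
have rn : r != 0 by rewrite gt_eqF.
pose F x := - (expR (- (r * x)) / r).
have Fd : has_deriv F (fun x => expR (- (r * x))).
  by move=> x; rewrite /F; derive; field.
have cf : continuous (fun x : R => expR (- (r * x))).
  apply: (@has_deriv_continuous _ _ (fun x => - r * expR (- (r * x)))) => x; derive; ring.
have -> : [set x : R | 0 <= x] = `[0, +oo[%classic.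
  by apply/seteqP; split => x /=; rewrite in_itv/= andbT.
have -> : (\int[mu]_(x in `[0%R, +oo[) (expR (- (r * `|x|)))%:E =
           \int[mu]_(x in `[0%R, +oo[) (expR (- (r * x)))%:E)%E.
  by apply: eq_integral => x; rewrite inE/= in_itv/= andbT => x0; rewrite ger0_norm.
rewrite (ge0_continuous_FTC2y (F := F) (l := 0)) //.
- by rewrite -EFinB -EFinM ltry.
- by apply: continuous_subspaceT => x; exact: cf.
- apply/cvgrPdist_le => e e0.
  have er : 0 < e * r by rewrite mulr_gt0.
  have [Z hZ] := expR_small 1 er r0.
  exists Z; split; first exact: num_real.
  move=> x /ltW /hZ; rewrite normr1 mul1r => h.
  rewrite /F sub0r opprK ger0_norm; last by rewrite divr_ge0 ?expR_ge0 // ltW.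
  by rewrite ler_pdivrMr.
- apply: cvg_at_right_filter; exact: (has_deriv_continuous Fd).
- move=> x _; rewrite derive1E; have := Fd x => -[_ ->]; by [].
Qed.

Lemma decaying_in_L2 u K r : continuous u -> 0 < r ->
  (forall x, `|u x| <= K * expR (- (r * `|x|))) -> in_L2 u.
Proof.
move=> cu r0 h.
have mu_ : measurable_fun [set: R] u by exact: continuous_measurable_fun.
rewrite /in_L2 inE; apply/andP; split; rewrite inE //=.
rewrite /finite_norm unlock; apply: poweR_lty.
have mg : measurable_fun [set: R] (fun x : R => (expR (- (2 * r * `|x|)))%:E).
  apply/measurable_EFinP; apply: continuous_measurable_fun => x.
  apply: (continuous_comp (f := fun x : R => - (2 * r * `|x|))); last exact: continuous_expR.
  apply: continuousN; apply: continuousM; first exact: cst_continuous.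
  exact: norm_continuous.
apply: (@le_lt_trans _ _ (\int[mu]_x ((K ^+ 2)%:E * (expR (- (2 * r * `|x|)))%:E))%E).
  apply: ge0_le_integral => //.
  - by move=> x _; exact: poweR_ge0.
  - apply/measurable_EFinP.
    apply/(@measurableT_comp _ _ _ _ _ _ (fun x : R => x `^ 2)%R) => //.
    exact/measurableT_comp.
  - exact: emeasurable_funM.
  - move=> x _; rewrite /= -EFinM lee_fin powR_mulrn //.
    have -> : - (2 * r * `|x|) = 2%:R * (- (r * `|x|)) by ring.
    rewrite expRM_natl -exprMn ler_sqr ?nnegrE //.
    exact: le_trans (h x).
rewrite ge0_integralZl //; last by rewrite lee_fin sqr_ge0.
apply: lte_mul_pinfty; [by rewrite lee_fin sqr_ge0 | by [] |].
by apply: integral_exp_abs_lty; rewrite mulr_gt0.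
Qed.

Lemma locally_integrable_segment f : locally_integrable [set: R] f -> segment_integrable f.
Proof.
move=> [mf _ h] a c; apply/integrableP; split.
  by apply/measurable_EFinP; exact: measurable_funTS.
by have := h `[a, c]%classic (@subsetT _ _) (@segment_compact _ a c).
Qed.

Lemma continuous_locally_integrable f : continuous f -> locally_integrable [set: R] f.
Proof.
move=> cf; split; [exact: continuous_measurable_fun | exact: openT |].
move=> K _ cK; have : mu.-integrable K (EFin \o f).
  apply: continuous_compact_integrable => //.
  by apply: continuous_subspaceT => x; exact: cf.
by move=> /integrableP[].
Qed.

Lemma primitive_continuous u f : is_AC_primitive u f -> continuous u.
Proof.
move=> [lf hu] x; have fi := locally_integrable_segment lf.
have x1 : x - 1 <= x + 1 by lra.
have xin : x \in `](x - 1), (x + 1)[ by rewrite in_itv/=; apply/andP; split; lra.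
have := parameterized_integral_continuous x1 (fi (x - 1) (x + 1)).
have lt1 : x - 1 < x + 1 by lra.
move/(continuous_within_itvP _ lt1) => [/(_ x xin) H _ _].
have H2 : {for x, continuous (fun y => u (x - 1) + parameterized_integral mu (x - 1) y f)}.
  by apply: continuousD; [exact: cst_continuous | exact: H].
have E : \forall y \near x, u (x - 1) + parameterized_integral mu (x - 1) y f = u y.
  near=> y; have := hu (x - 1) y; rewrite /oriented_integral.
  have -> : x - 1 <= y by apply: ltW; near: y; apply: lt_nbhsr; lra.
  by rewrite /parameterized_integral => <-; ring.
have E0 := nbhs_singleton E.
rewrite /continuous_at -E0; apply: cvg_trans H2; exact: near_eq_cvg.
Unshelve. all: by end_near. Qed.

Lemma primitive_has_deriv u f : continuous f -> is_AC_primitive u f -> has_deriv u f.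
Proof.
move=> cf [_ hu] x; have fd := oriented_integral_deriv 0 cf.
have -> : u = fun y => u 0 + oriented_integral f 0 y.
  by apply/funext => y; rewrite -hu; ring.
by derive; rewrite add0r.
Qed.

Lemma has_deriv_primitive u f : continuous f -> has_deriv u f -> is_AC_primitive u f.
Proof.
move=> cf ud; split; first exact: continuous_locally_integrable.
move=> x y; have fd := oriented_integral_deriv x cf.
have cd : has_deriv (fun y => u y - oriented_integral f x y) (fun => 0).
  by move=> z; derive; ring.
have base := oriented_integral_base f x.
have [xy|yx] := leP x y.
  have := deriv_eq0_eq cd xy (fun _ _ => erefl); rewrite base; lra.
have := deriv_eq0_eq cd (ltW yx) (fun _ _ => erefl); rewrite base; lra.
Qed.

Lemma ae_eq_oriented_integral f g x y : locally_integrable [set: R] f -> continuous g ->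
  {ae mu, forall x, f x = g x} -> oriented_integral f x y = oriented_integral g x y.
Proof.
move=> [mf _ _] cg fg.
have mg : measurable_fun [set: R] g by exact: continuous_measurable_fun.
have main a c : \int[mu]_(s in `[a, c]) f s = \int[mu]_(s in `[a, c]) g s.
  rewrite /Rintegral; congr fine; apply: ae_eq_integral => //.
  - by apply/measurable_EFinP; exact: measurable_funTS.
  - by apply/measurable_EFinP; exact: measurable_funTS.
  - by apply: negligibleS fg => z /= h e; apply: h; rewrite e.
by rewrite /oriented_integral; case: ifP => _; rewrite main.
Qed.

(** For continuous [V] the second derivative is almost everywhere equal to the
    continuous function [(V - lam) u], hence both have the same primitives and
    the equation holds classically. *)
Lemma graph_solves V u lam : continuous V ->
  schrodinger_graph_real V u (fun x => lam * u x) ->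
  in_L2 u /\ exists v, solves (fun x => V x - lam) u v.
Proof.
move=> cV [L2u _ [v [w [uv vw ae]]]]; split => //; exists v.
have cu := primitive_continuous uv; have cv := primitive_continuous vw.
have cg : continuous (fun x => (V x - lam) * u x).
  have cs := shift_continuous (l := lam) cV.
  by move=> x; apply: (@continuousM _ _ (fun x => V x - lam) u); [exact: cs | exact: cu].
split; first exact: primitive_has_deriv.
apply: primitive_has_deriv => //.
have [lw hv] := vw; split; first exact: continuous_locally_integrable.
move=> x y; rewrite hv; apply: ae_eq_oriented_integral => //.
by apply: negligibleS ae => z /= h e; apply: h; lra.
Qed.

Lemma solves_graph V u v lam K r : continuous V -> solves (fun x => V x - lam) u v ->
  0 < r -> (forall x, `|u x| <= K * expR (- (r * `|x|))) ->
  schrodinger_graph_real V u (fun x => lam * u x).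
Proof.
move=> cV [ud vd] r0 h; have cu := has_deriv_continuous ud.
have clu : continuous (fun x => lam * u x).
  by move=> x; apply: continuousM; [exact: cst_continuous | exact: cu].
have cw : continuous (fun x => (V x - lam) * u x).
  have cs := shift_continuous (l := lam) cV.
  by move=> x; apply: (@continuousM _ _ (fun x => V x - lam) u); [exact: cs | exact: cu].
split.
- exact: decaying_in_L2 cu r0 h.
- apply: (@decaying_in_L2 _ (`|lam| * K) r clu r0) => x.
  by rewrite normrM -mulrA ler_wpM2l.
- exists v, (fun x => (V x - lam) * u x); split.
  + by apply: has_deriv_primitive => //; exact: has_deriv_continuous vd.
  + exact: has_deriv_primitive.
  + by apply/nearW => x; ring.
Qed.

(** The potential and the eigenvalue are real, so the real and imaginary parts
    of an eigenfunction are solutions, and one of them is not zero. *)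
Lemma real_eigenfunction V lam : continuous V -> is_eigenvalue V lam ->
  exists u v, [/\ in_L2 u, solves (fun x => V x - lam) u v & exists x, u x != 0].
Proof.
move=> cV [u [nz [g1 g2]]].
have re z : complex.Re (lam%:C%C * z) = lam * complex.Re z.
  by case: z => a b /=; rewrite mul0r subr0.
have im z : complex.Im (lam%:C%C * z) = lam * complex.Im z.
  by case: z => a b /=; rewrite mul0r addr0.
have {}g1 : schrodinger_graph_real V (fun x => complex.Re (u x)) (fun x => lam * complex.Re (u x)).
  by move: g1; congr schrodinger_graph_real; apply/funext => x; rewrite re.
have {}g2 : schrodinger_graph_real V (fun x => complex.Im (u x)) (fun x => lam * complex.Im (u x)).
  by move: g2; congr schrodinger_graph_real; apply/funext => x; rewrite im.
have [x ux] : exists x, u x != 0.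
  apply: contrapT => h; apply: nz; apply/nearW => x; apply/eqP.
  by apply: contra_notT h => ux; exists x.
have [rx|rx] := eqVneq (complex.Re (u x)) 0; last first.
  have [L2 [v s]] := graph_solves cV g1.
  by exists (fun x => complex.Re (u x)), v; split => //; exists x.
have [L2 [v s]] := graph_solves cV g2.
exists (fun x => complex.Im (u x)), v; split => //; exists x.
by apply: contraNneq ux => ix; move: rx ix; case: (u x) => a b /= -> ->.
Qed.

Lemma eigenvalue_of_solution V lam u v K r x0 : continuous V ->
  solves (fun x => V x - lam) u v ->
  0 < r -> (forall x, `|u x| <= K * expR (- (r * `|x|))) ->
  (forall x, x0 <= x -> u x != 0) -> is_eigenvalue V lam.
Proof.
move=> cV s r0 h nz; exists (fun x => (u x)%:C%C); split.
  move=> ae0; have : mu.-negligible `[x0, (x0 + 1)].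
    apply: negligibleS ae0 => x /=; rewrite in_itv/= => /andP[x1 _] e.
    by have := nz x x1; move/(congr1 (@complex.Re R)): e => /= ->; rewrite eqxx.
  move=> neg; have : mu `[x0, x0 + 1]%classic = 0%E.
    by apply/negligibleP; [exact: measurable_itv | exact: neg].
  rewrite lebesgue_measure_itv /= lte_fin ltrDl ltr01 -EFinD addrAC subrr add0r.
  by move=> [] /eqP; rewrite oner_eq0.
split.
  have -> : (fun x => complex.Re (lam%:C%C * (u x)%:C%C)) = (fun x => lam * u x).
    by apply/funext => x /=; rewrite mul0r subr0.
  exact: solves_graph cV s r0 h.
have -> : (fun x => complex.Im (lam%:C%C * (u x)%:C%C)) = (fun x => lam * 0).
  by apply/funext => x /=; rewrite mul0r mulr0 addr0.
apply: (@solves_graph _ (fun => 0) (fun => 0) lam 0 r cV _ r0).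
  by split => x; derive; ring.
by move=> x; rewrite normr0 mul0r.
Qed.

End SquareIntegrable.

(** * The eigenvalues of a rescaled potential *)

Section Rescaling.
Context {R : realType}.
Implicit Types (Q V q u v : R -> R) (x y r s l lam Y : R).

Lemma solves_affine Q u v r s : solves Q u v ->
  solves (fun y => r ^+ 2 * Q (r * y + s)) (fun y => u (r * y + s))
         (fun y => r * v (r * y + s)).
Proof. by move=> [ud vd]; split => y; derive; ring. Qed.

(** A solution whose square is integrable cannot start to grow in modulus
    outside [[-Y, Y]], since there [u * v] keeps its sign once it points
    outwards and [u ^+ 2] would stay away from zero. *)
Lemma solution_nonincreasing q u v l r s Y : 0 < r -> 0 <= Y -> confining Y q l ->
  solves (fun y => q y - l) u v -> in_L2 (fun x => u (r * x + s)) ->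
  (forall y, Y <= y -> u y * v y <= 0) /\ (forall y, y <= - Y -> 0 <= u y * v y).
Proof.
move=> r0 Y0 q1 uv L2; have sd := sqr_deriv uv.
have Q1 y : Y <= y -> 1 <= q y - l.
  by move=> /(confining_right Y0 q1); lra.
have Q1l := confining_left Y0 q1.
have sq0 y : u y * v y != 0 -> 0 < u y ^+ 2.
  by rewrite lt0r sqr_ge0 andbT sqrf_eq0; apply: contraNneq => ->; rewrite mul0r.
have back y : r * ((y - s) / r) + s = y.
  by field; rewrite gt_eqF.
split => y Yy; rewrite leNgt; apply/negP => p.
- apply: (@in_L2_not_bounded_below _ _ ((y - s) / r) (u y ^+ 2) L2).
    by apply: sq0; rewrite gt_eqF.
  move=> x xy; have yx : y <= r * x + s by rewrite -{1}(back y) lerD2r ler_pM2l.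
  apply: (deriv_ge0_le sd yx) => z /andP[yz _].
  have := uv_nondecr uv Q1 Yy yz; move: p; lra.
- apply: (@in_L2_not_bounded_below_left _ _ ((y - s) / r) (u y ^+ 2) L2).
    by apply: sq0; rewrite lt_eqF.
  move=> x xy; have yx : r * x + s <= y by rewrite -[leRHS](back y) lerD2r ler_pM2l.
  apply: (deriv_le0_ge sd yx) => z /andP[_ yz].
  have := uv_nondecr_left uv Q1l Yy yz; move: p; lra.
Qed.

Lemma nonincreasing_bounded Q u v Y : solves Q u v ->
  (forall y, Y <= y -> u y * v y <= 0) -> (forall y, y <= - Y -> 0 <= u y * v y) ->
  exists C : R, forall y, `|u y| <= C.
Proof.
move=> uv h1 h2; have sd := sqr_deriv uv.
have le a c : u a ^+ 2 <= u c ^+ 2 -> `|u a| <= `|u c|.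
  by rewrite -[u a ^+ 2]real_normK ?num_real // -[u c ^+ 2]real_normK ?num_real // ler_sqr ?nnegrE.
apply: (@bounded_pieces _ u Y `|u Y| `|u (- Y)|).
- exact: has_deriv_continuous uv.1.
- move=> y Yy; apply: le; apply: (deriv_le0_ge sd Yy) => x /andP[/h1 ? _]; lra.
- move=> y Yy; apply: le; apply: (deriv_ge0_le sd Yy) => x /andP[_ /h2 ?]; lra.
Qed.

(** Outside [[- Y, Y]] square integrability and boundedness both exclude the
    growing solutions; the remaining ones decay exponentially, which gives
    square integrability back. *)
Lemma affine_eigenvalue V q r s l Y : 0 < r -> 0 <= Y -> continuous q -> confining Y q l ->
  (forall x, V x = r ^+ 2 * q (r * x + s)) ->
  is_eigenvalue V (r ^+ 2 * l) <-> eigenlevel Y q l.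
Proof.
move=> r0 Y0 cq q1 hV; have rn : r != 0 by rewrite gt_eqF.
have aff : continuous (fun x => r * x + s).
  by apply: (@has_deriv_continuous _ _ (fun=> r)) => x; derive; ring.
have cV : continuous V.
  have -> : V = fun x => r ^+ 2 * q (r * x + s) by apply/funext => x; rewrite hV.
  move=> x; apply: (@continuousM _ _ (fun=> r ^+ 2) (fun x => q (r * x + s))).
    exact: cst_continuous.
  by apply: (@continuous_comp _ _ _ (fun x => r * x + s) q); [exact: aff | exact: cq].
split.
  move=> /(real_eigenfunction cV)[u [v [L2 uv [x0 ux0]]]].
  have := solves_affine r^-1 (- s / r) uv.
  have eA x : r^-1 * (r * x + s) + - s / r = x by field.
  set U := (fun y => u _); set W := (fun y => r^-1 * _) => UW.
  have {}UW : solves (fun y => q y - l) U W.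
    move: UW; congr solves; apply/funext => y; rewrite hV.
    have -> : r * (r^-1 * y + - s / r) + s = y by field.
    by field.
  have L2U : in_L2 (fun x => U (r * x + s)).
    by move: L2; congr in_L2; apply/funext => x; rewrite /U eA.
  have [h1 h2] := solution_nonincreasing r0 Y0 q1 UW L2U.
  have [C hC] := nonincreasing_bounded UW h1 h2.
  apply: (bounded_solution_eigenlevel Y0 cq q1 UW hC).
  by exists (r * x0 + s); rewrite /U eA.
move=> [u [v [[uv uY tl] [C hC]]]].
have u0 : exists y, u y != 0 by exists Y; rewrite uY oner_neq0.
have UV := solves_affine r s uv.
apply: (@eigenvalue_of_solution _ V (r ^+ 2 * l) _ _ (C * expR Y * expR `|s|) r ((Y - s) / r) cV _ r0).
- move: UV; congr solves; apply/funext => x; rewrite hV; ring.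
- move=> x; have dec := bound_state_decay Y0 q1 uv hC (r * x + s).
  rewrite /=; apply: (le_trans dec).
  have C0 : 0 <= C := le_trans (normr_ge0 _) (hC 0).
  rewrite -[leRHS]mulrA -expRD ler_wpM2l ?mulr_ge0 ?expR_ge0 //.
  rewrite ler_expR; have := ler_normB (r * x + s) s.
  by rewrite addrK normrM (gtr0_norm r0); lra.
- move=> x xY; apply: (bound_state_neq0 Y0 cq q1 uv hC u0).
  by move: xY; rewrite ler_pdivrMr // mulrC; lra.
Qed.

End Rescaling.

(** * Taylor expansion from the left *)

Section LeftTaylor.
Context {R : realType}.
Implicit Types (f df g : R -> R) (x d L e : R) (p Q : nat).

Definition left_taylor f x0 p L : Prop := forall e : R, 0 < e ->
  exists2 d : R, 0 < d & forall x : R, x0 - d < x -> x < x0 ->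
    `|f x - L / p`!%:R * (x - x0) ^+ p| <= e * `|x - x0| ^+ p.

Lemma cvg_left_taylor f x0 L : f x @[x --> x0^'-] --> L -> left_taylor f x0 0 L.
Proof.
move=> /cvgrPdist_le h e e0; have [d /= d0 hd] := h e e0.
exists d => // x dx xx0; rewrite !expr0 !mulr1 divr1 distrC; apply: hd => //=.
by rewrite gtr0_norm; lra.
Qed.

(** Integrating an expansion: the mean value theorem bounds the increment of
    the remainder between [x] and a point which tends to [x0]. *)
Lemma left_taylor_primitive f df x0 p L :
  (forall x, x < x0 -> is_derive x 1 f (df x)) -> f x @[x --> x0^'-] --> (0 : R) ->
  left_taylor df x0 p L -> left_taylor f x0 p.+1 L.
Proof.
move=> fd f0 h e e0; have [d d0 hd] := h e e0; exists d => // x dx xx0.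
set K := L / _; pose P := fun z : R => K * (z - x0) ^+ p.+1.
have Pd : has_deriv P (fun z => L / p`!%:R * (z - x0) ^+ p).
  have p0 : p.+1%:R != 0 :> R by rewrite pnatr_eq0.
  have f0' : p`!%:R != 0 :> R by rewrite pnatr_eq0 -lt0n fact_gt0.
  move=> z; rewrite /P; derive; rewrite /K factS natrM /=; move: p0 f0'.
  by set a := p.+1%:R; set c := p`!%:R => p0 f0'; field; apply/andP.
have G0 : f z - P z @[z --> x0^'-] --> (0 : R).
  have -> : (0 : R) = 0 - P x0 by rewrite /P subrr expr0n mulr0 subr0.
  apply: cvgB => //; apply: cvg_at_left_filter; exact: has_deriv_continuous Pd x0.
apply/ler_addgt0Pr => eps eps0.
have [z [xz zx0 Gz]] : exists z : R, [/\ x < z, z < x0 & `|f z - P z| <= eps].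
  have [d1 /= d10 hd1] := (cvgr0_norm_le _ G0) eps eps0.
  pose z := Num.max ((x + x0) / 2) (x0 - d1 / 2).
  have zx0 : z < x0 by rewrite /z gt_max; apply/andP; split; lra.
  have xz : x < z by rewrite /z lt_max; apply/orP; left; lra.
  have zd : x0 - d1 / 2 <= z by rewrite /z le_max lexx orbT.
  exists z; split => //; apply: hd1 => //=.
  by rewrite gtr0_norm; lra.
have Gd y : x <= y <= z -> is_derive y 1 (fun y => f y - P y) (df y - L / p`!%:R * (y - x0) ^+ p).
  move=> /andP[xy yz]; have yx0 : y < x0 by exact: le_lt_trans yz zx0.
  by apply: is_deriveB; [exact: fd | exact: Pd].
have [y yxz mv] := mean_value_on (ltW xz) Gd.
have -> : f x - P x = (f z - P z) - (df y - L / p`!%:R * (y - x0) ^+ p) * (z - x).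
  by rewrite -mv; ring.
apply: (le_trans (ler_normB _ _)); rewrite addrC lerD // normrM.
have [xy yz] : x <= y /\ y <= z by move/andP: yxz.
apply: (@le_trans _ _ (e * `|y - x0| ^+ p * `|z - x|)).
  by rewrite ler_wpM2r // hd //; lra.
rewrite exprSr mulrA ler_pM ?mulr_ge0 ?exprn_ge0 ?(ltW e0) //.
  rewrite ler_pM2l // lerXn2r ?nnegrE //.
  by rewrite !ltr0_norm; lra.
by rewrite gtr0_norm ?ltr0_norm; lra.
Qed.

(** One integration per derivative, starting from the limit of the last one;
    the lower derivatives and [f - f x0] tend to zero, which fixes the
    constants of integration. *)
Lemma left_taylor_derivatives f x0 p L : (0 < p)%N ->
  (forall j x, (j < p)%N -> x < x0 -> derivable (f^`(j))%classic x 1) ->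
  (forall j, (0 < j < p)%N -> (f^`(j))%classic x @[x --> x0^'-] --> (0 : R)) ->
  (f^`(p))%classic x @[x --> x0^'-] --> L -> {for x0, continuous f} ->
  left_taylor (fun x => f x - f x0) x0 p L.
Proof.
move=> p0 fd fj fp fc.
have step j x : (j < p)%N -> x < x0 -> is_derive x 1 (f^`(j))%classic ((f^`(j.+1))%classic x).
  by move=> jp xx0; apply: DeriveDef; [exact: fd | rewrite derive1nS derive1E].
have ind i : (i < p)%N -> left_taylor (f^`(p - i))%classic x0 i L.
  elim: i => [_|i IH ip]; first by rewrite subn0; exact: cvg_left_taylor.
  have e : (p - i)%N = (p - i.+1).+1 by lia.
  apply: left_taylor_primitive (IH (ltnW ip)).
    by move=> x xx0; rewrite e; apply: step => //; lia.
  by apply: fj; lia.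
have -> : p = p.-1.+1 by rewrite prednK.
apply: (@left_taylor_primitive _ (f^`(1))%classic).
- move=> x xx0; have := step 0%N x p0 xx0; rewrite derive1n0 => fdx.
  rewrite -[X in is_derive _ _ _ X]subr0; apply: is_deriveB.
- rewrite -(subrr (f x0)); apply: cvgB; last exact: cvg_cst.
  exact: cvg_at_left_filter.
- have := ind p.-1; rewrite prednK // leqnn => /(_ isT).
  by have -> : (p - p.-1 = 1)%N by lia.
Qed.

(** The remainder of order [Q + 1] absorbs the values away from [0], where the
    expansion gives no information. *)
Lemma global_taylor g Q B : (0 < Q)%N -> (forall d, 0 <= d -> 0 <= g d) ->
  (forall d, 0 <= d -> g d <= d) ->
  (forall e, 0 < e -> exists2 d0 : R, 0 < d0 &
     forall d : R, 0 < d -> d < d0 -> `|g d - B * d ^+ Q| <= e * d ^+ Q) ->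
  0 <= B /\ forall e, 0 < e -> exists2 M : R, 0 <= M & forall d : R, 0 <= d ->
    (B - e) * d ^+ Q - M * d ^+ Q.+1 <= g d <= (B + e) * d ^+ Q + M * d ^+ Q.+1.
Proof.
move=> Q0 g0 gd h.
have B0 : 0 <= B.
  rewrite leNgt; apply/negP => Bn; have [d d0 hd] := h (- B / 2) ltac:(lra).
  have d2 : 0 < d / 2 by lra.
  have pw : 0 < (d / 2) ^+ Q by rewrite exprn_gt0.
  have := hd (d / 2) d2 ltac:(lra); have := g0 (d / 2) (ltW d2).
  rewrite ler_norml => g0' /andP[_ H].
  have : B * (d / 2) ^+ Q < 0 by rewrite pmulr_llt0.
  by move: H g0'; lra.
split => // e e0; have [d1 d10 hd1] := h e e0.
have pd : 0 < d1 ^+ Q by rewrite exprn_gt0.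
have M1 : 0 <= (d1 ^+ Q)^-1 by rewrite invr_ge0 ltW.
have M2 : 0 <= B / d1 by rewrite divr_ge0 // ltW.
exists ((d1 ^+ Q)^-1 + B / d1) => [|d dge]; first by rewrite addr_ge0.
have dQ : 0 <= d ^+ Q by rewrite exprn_ge0.
have dQ1 : 0 <= d ^+ Q.+1 by rewrite exprn_ge0.
have Md : 0 <= ((d1 ^+ Q)^-1 + B / d1) * d ^+ Q.+1 by rewrite mulr_ge0 // addr_ge0.
have [dd1|d1d] := ltP d d1.
  have [d00|dn] := eqVneq d 0.
    have := g0 d dge; have := gd d dge; rewrite d00 !expr0n gtn_eqF //= !mulr0; lra.
  have dp : 0 < d by rewrite lt0r dn.
  have := hd1 d dp dd1; rewrite ler_norml; lra.
have u1 : d <= (d1 ^+ Q)^-1 * d ^+ Q.+1.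
  rewrite mulrC ler_pdivlMr // exprS ler_wpM2l // lerXn2r ?nnegrE //; lra.
have u2 : B * d ^+ Q <= B / d1 * d ^+ Q.+1.
  rewrite exprS mulrA ler_wpM2r // -mulrA ler_peMr // mulrC ler_pdivlMr // mul1r //.
have := mulr_ge0 B0 dQ; have := mulr_ge0 (ltW e0) dQ.
have : 0 <= (d1 ^+ Q)^-1 * d ^+ Q.+1 by rewrite mulr_ge0.
have := g0 d dge; have := gd d dge; lra.
Qed.

End LeftTaylor.

(** * The Iwatsuka potential in the scaled variable *)

Section Iwatsuka.
Context {R : realType}.
Implicit Types (d k l e B L : R) (n m p Q : nat).
Variables (b : R -> R) (c x_inf : R).
Hypothesis b_cont : continuous b.
Hypothesis b_pos : forall x, 0 < b x.
Hypothesis b_le : forall x, b x <= c.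
Hypothesis b_right : forall x, x_inf <= x -> b x = c.

Local Notation a := (iwatsuka_a b).
Local Notation r := (Num.sqrt c).

Let c0 : 0 < c. Proof. exact: lt_le_trans (b_pos 0) (b_le 0). Qed.
Let r0 : 0 < r. Proof. by rewrite sqrtr_gt0. Qed.
Let rr : r ^+ 2 = c. Proof. by rewrite sqr_sqrtr // ltW. Qed.
Let rn : r != 0. Proof. by rewrite gt_eqF. Qed.

Lemma iwatsuka_deriv : has_deriv a b.
Proof. exact: oriented_integral_deriv. Qed.

Definition scaled_time (k : R) : R := (a x_inf - k) / r.

(** The deviation of the potential from the linear one, at distance [d] to the
    left of [x_inf] in the scaled variable; it does not depend on [k]. *)
Definition deviation (d : R) : R := (a (x_inf - d / r) - a x_inf) / r + d.

Definition deviation_slope (d : R) : R := 1 - b (x_inf - d / r) / c.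

Lemma deviation_deriv : has_deriv deviation deviation_slope.
Proof.
have ad := iwatsuka_deriv; move=> d; rewrite /deviation; derive.
rewrite /deviation_slope; have -> : c^-1 = r^-1 ^+ 2 by rewrite exprVn rr.
by field.
Qed.

Lemma deviation_slope_ge0 d : 0 <= deviation_slope d.
Proof.
by rewrite /deviation_slope subr_ge0 ler_pdivrMr // mul1r.
Qed.

Lemma deviation_slope_le1 d : deviation_slope d <= 1.
Proof. by rewrite /deviation_slope gerBl divr_ge0 // ltW. Qed.

Lemma deviation_left d : d <= 0 -> deviation d = 0.
Proof.
move=> d0; have ad := iwatsuka_deriv.
have xd : x_inf <= x_inf - d / r.
  by rewrite lerDl oppr_ge0 mulr_le0_ge0 // invr_ge0 ltW.
have fd : has_deriv (fun x => a x - c * x) (fun x => b x - c).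
  by move=> x; derive; ring.
have e : a (x_inf - d / r) - c * (x_inf - d / r) = a x_inf - c * x_inf.
  by apply: (esym (deriv_eq0_eq fd xd _)) => x /andP[xx _]; rewrite b_right ?subrr.
rewrite /deviation.
have -> : a (x_inf - d / r) - a x_inf = - (c * (d / r)) by lra.
have -> : c * (d / r) = r ^+ 2 * (d / r) by rewrite rr.
by field.
Qed.

Lemma scaled_potential k x : iwatsuka_potential b k x =
  r ^+ 2 * shifted_osc deviation (scaled_time k) (r * x + (scaled_time k - r * x_inf)).
Proof.
rewrite /iwatsuka_potential /shifted_osc /deviation.
set t := scaled_time k.
have -> : x_inf - (t - (r * x + (t - r * x_inf))) / r = x by field.
by rewrite /t /scaled_time; field.
Qed.

Lemma band_eigenlevel n k l : scaled_time k <= - radius n -> l <= 2 * n%:R ->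
  is_eigenvalue (iwatsuka_potential b k) (c * l) <->
  eigenlevel (radius n) (shifted_osc deviation (scaled_time k)) l.
Proof.
move=> tY l2; have Y0 := radius_ge0 n (R := R).
have t0 : scaled_time k <= 0 by move: tY Y0; lra.
have tr := shifted_truncated deviation_deriv deviation_left deviation_slope_le1 t0.
have [cq _ _] := tr.
rewrite -{1}rr; apply: (affine_eigenvalue r0 Y0 cq (truncated_confining tr tY l2)).
exact: scaled_potential.
Qed.

Lemma scaled_time_small (T : R) : exists K : R, forall k, K <= k -> scaled_time k <= T.
Proof.
exists (a x_inf - T * r) => k kK; rewrite /scaled_time ler_pdivrMr //; lra.
Qed.

Variable E : nat -> R -> R.
Hypothesis E_spec : forall k, is_eigenvalue_sequence (iwatsuka_potential b k) (fun i => E i k).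

Lemma band_eigenstate n m k : (m < n)%N -> scaled_time k <= - radius n ->
  E m.+1 k / c <= 2 * n%:R -> exists u v,
  eigenstate (radius n) (shifted_osc deviation (scaled_time k)) (E m.+1 k / c) u v.
Proof.
move=> mn tY l2; apply/(band_eigenlevel tY l2).
rewrite mulrC divfK ?gt_eqF //; apply/(E_spec k).2.
by exists m.+1.
Qed.

Lemma band_near_level n m e : (m < n)%N -> 0 < e ->
  exists K : R, forall k, K <= k -> `|E m.+1 k / c - level m| <= e.
Proof.
move=> mn e0; have Y0 := radius_ge0 n (R := R).
have [T hT] := nth_level_close n e0.
have [K hK] := scaled_time_small (Num.min T (- radius n)).
exists K => k /hK; rewrite le_min => /andP[tT tY].
have t0 : scaled_time k <= 0 by move: tY Y0; lra.
have tr := shifted_truncated deviation_deriv deviation_left deviation_slope_le1 t0.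
have [inc spec] := E_spec k.
apply: (hT _ _ (fun i => E i k / c) tT tr) => //.
  move=> i j i0 ij; rewrite ltr_pM2r ?invr_gt0 //; exact: inc.
move=> l l2; split.
  move=> /(band_eigenlevel tY l2)/spec[i i0 eE]; exists i => //.
  by rewrite -eE mulrC mulKf ?gt_eqF.
move=> [i i0 eE]; apply/(band_eigenlevel tY l2)/spec; exists i => //.
by rewrite eE mulrC divfK ?gt_eqF.
Qed.

Lemma band_asymptotics m Q B e : 0 <= B ->
  (forall e : R, 0 < e -> exists2 M : R, 0 <= M & forall d : R, 0 <= d ->
    (B - e) * d ^+ Q - M * d ^+ Q.+1 <= deviation d <= (B + e) * d ^+ Q + M * d ^+ Q.+1) ->
  0 < e -> exists K : R, forall k, K <= k ->
    `|(E m.+1 k / c - level m) * (2 * - scaled_time k) ^+ Q * hermite_norm m /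
       hermite_fun m (scaled_time k) ^+ 2 + B * Q`!%:R| <= e.
Proof.
move=> B0 tay e0.
have [d d0 [T hT]] := scaled_asymptotics (ltnSn m) deviation_deriv deviation_left
  deviation_slope_ge0 deviation_slope_le1 B0 tay e0.
have d1 : 0 < Num.min d 1 by rewrite lt_min d0 ltr01.
have [K1 hK1] := band_near_level (ltnSn m) d1.
have [K2 hK2] := scaled_time_small (Num.min T (- radius m.+1)).
exists (Num.max K1 K2) => k; rewrite ge_max => /andP[/hK1 h1 /hK2].
rewrite le_min => /andP[tT tY].
move: h1; rewrite le_min => /andP[ld l1].
have l2 : E m.+1 k / c <= 2 * m.+1%:R.
  have lv : level m = 2 * m%:R + 1 :> R by rewrite /level -natr1 -mul2n natrM.
  by move: l1; rewrite ler_norml lv -natr1 => /andP[_ ?]; lra.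
have [u [v es]] := band_eigenstate (ltnSn m) tY l2.
exact: (hT _ _ u v tT ld es).
Qed.

(** The expansion of [b - c] at [x_inf], integrated once and scaled. *)
Lemma deviation_taylor p L : left_taylor (fun x => b x - b x_inf) x_inf p L ->
  forall e : R, 0 < e -> exists2 d0 : R, 0 < d0 & forall d : R, 0 < d -> d < d0 ->
    `|deviation d - (-1) ^+ p.+1 * L / (r ^+ p.+2 * p.+1`!%:R) * d ^+ p.+1| <= e * d ^+ p.+1.
Proof.
move=> tay e e0; have ad := iwatsuka_deriv.
pose F x := a x - a x_inf - c * (x - x_inf).
have Fd : has_deriv F (fun x => b x - b x_inf).
  by move=> x; rewrite /F; derive; rewrite (b_right (lexx _)); ring.
have F0 : F x @[x --> x_inf^'-] --> (0 : R).
  have -> : (0 : R) = F x_inf by rewrite /F; ring.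
  apply: cvg_at_left_filter; exact: has_deriv_continuous Fd x_inf.
have := left_taylor_primitive (fun x _ => Fd x) F0 tay.
have er : 0 < e * r ^+ p.+2 by rewrite mulr_gt0 // exprn_gt0.
move=> /(_ _ er)[d0 d00 h]; exists (d0 * r) => [|d dp dd0]; first by rewrite mulr_gt0.
have dr : 0 < d / r by rewrite divr_gt0.
have dr0 : d / r < d0 by rewrite ltr_pdivrMr.
have := h (x_inf - d / r) ltac:(lra) ltac:(lra).
have eF : F (x_inf - d / r) = r * deviation d.
  rewrite /F /deviation; set y := x_inf - d / r.
  have -> : c * (y - x_inf) = r ^+ 2 * (y - x_inf) by rewrite rr.
  by rewrite {2}/y; field.
have -> : x_inf - d / r - x_inf = - (d / r) by ring.
rewrite eF normrN (gtr0_norm dr) [(- (d / r)) ^+ _]exprNn.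
have f0 : p.+1`!%:R != 0 :> R by rewrite pnatr_eq0 -lt0n fact_gt0.
have rp : r ^+ p.+1 != 0 by rewrite expf_neq0.
have -> : r * deviation d - L / p.+1`!%:R * ((-1) ^+ p.+1 * (d / r) ^+ p.+1) =
  r * (deviation d - (-1) ^+ p.+1 * L / (r ^+ p.+2 * p.+1`!%:R) * d ^+ p.+1).
  rewrite [r ^+ p.+2]exprS expr_div_n; move: f0 rp.
  set f := p.+1`!%:R; set s := r ^+ p.+1; set z := (-1) ^+ _; set w := d ^+ _ => f0 rp.
  by field; apply/and3P; split.
rewrite normrM (gtr0_norm r0).
have -> : e * r ^+ p.+2 * (d / r) ^+ p.+1 = r * (e * d ^+ p.+1).
  rewrite [r ^+ p.+2]exprS expr_div_n; move: rp.
  by set s := r ^+ p.+1; set w := d ^+ _ => rp; field.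
by rewrite ler_pM2l.
Qed.

Lemma band_left_taylor_asymptotics m p L e :
  left_taylor (fun x => b x - b x_inf) x_inf p L -> 0 < e ->
  exists K : R, forall k, K <= k ->
    `|(E m.+1 k / c - level m) * (2 * - scaled_time k) ^+ p.+1 * hermite_norm m /
       hermite_fun m (scaled_time k) ^+ 2 + (-1) ^+ p.+1 * L / r ^+ p.+2| <= e.
Proof.
move=> tay e0.
have g0 := shift_ge0 deviation_deriv deviation_left deviation_slope_ge0.
have g1 := shift_le deviation_deriv deviation_left deviation_slope_le1.
have [B0 gt] := global_taylor (ltn0Sn p) g0 g1 (deviation_taylor tay).
have := band_asymptotics m B0 gt e0.
have f0 : p.+1`!%:R != 0 :> R by rewrite pnatr_eq0 -lt0n fact_gt0.
have -> : (-1) ^+ p.+1 * L / (r ^+ p.+2 * p.+1`!%:R) * p.+1`!%:R = (-1) ^+ p.+1 * L / r ^+ p.+2.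
  by rewrite invfM mulrA divfK.
by [].
Qed.

End Iwatsuka.

(** * The expansion of a band function as [k] tends to infinity *)

Section BandExpansion.
Context {R : realType}.
Implicit Types (f : R -> R) (k l e : R) (m p n N Q : nat).

Lemma cvg_pinftyP f l :
  (forall e, 0 < e -> exists K : R, forall k, K <= k -> `|f k - l| <= e) ->
  f k @[k --> +oo] --> l.
Proof.
move=> h; apply/cvgrPdist_le => e e0; have [K hK] := h e e0.
exists K; split; first exact: num_real.
by move=> k /ltW /hK; rewrite distrC.
Qed.

Lemma hermite_ratio_cvg m (t : R -> R) :
  (forall T : R, exists K : R, forall k, K <= k -> t k <= T) ->
  hermite m (t k) / (2 * t k) ^+ m @[k --> +oo] --> (1 : R).
Proof.
move=> ht; apply: cvg_pinftyP => e e0; have [T T0 hT] := hermite_leading m e0.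
have [K hK] := ht (- T); exists K => k /hK tT.
have tn : t k < 0 by lra.
have dn : (2 * t k) ^+ m != 0 by rewrite expf_neq0 // mulf_neq0 // lt_eqF.
have -> : hermite m (t k) / (2 * t k) ^+ m - 1 = (hermite m (t k) - (2 * t k) ^+ m) / (2 * t k) ^+ m.
  by rewrite mulrBl divff.
rewrite normrM normfV ler_pdivrMr ?normr_gt0 // normrX hT // ltr0_norm //; lra.
Qed.

Lemma cvg_exprn f l n : f k @[k --> +oo] --> l -> f k ^+ n @[k --> +oo] --> l ^+ n.
Proof.
move=> fl; elim: n => [|n IH].
  by under eq_fun do rewrite expr0; rewrite expr0; exact: cvg_cst.
by under eq_fun do rewrite exprS; rewrite exprS; exact: cvgM.
Qed.

Section Expansion.
Variables (b : R -> R) (c x_inf : R).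
Hypothesis b_cont : continuous b.
Hypothesis b_pos : forall x, 0 < b x.
Hypothesis b_le : forall x, b x <= c.
Hypothesis b_right : forall x, x_inf <= x -> b x = c.
Variable E : nat -> R -> R.
Hypothesis E_spec : forall k, is_eigenvalue_sequence (iwatsuka_potential b k) (fun i => E i k).

Local Notation r := (Num.sqrt c).
Local Notation t := (scaled_time b c x_inf).

Let c0 : 0 < c. Proof. exact: lt_le_trans (b_pos 0) (b_le 0). Qed.
Let r0 : 0 < r. Proof. by rewrite sqrtr_gt0. Qed.
Let rn : r != 0. Proof. by rewrite gt_eqF. Qed.

Lemma momentum_ratio_cvg : - t k * r / k @[k --> +oo] --> (1 : R).
Proof.
pose A := iwatsuka_a b x_inf.
apply: cvg_pinftyP => e e0; exists (Num.max 1 (`|A| / e)) => k.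
rewrite ge_max => /andP[k1 kA]; have k0 : 0 < k by lra.
have -> : - t k * r / k - 1 = - A / k.
  by rewrite /scaled_time -/A; field; rewrite rn gt_eqF.
by rewrite normrM normfV normrN (gtr0_norm k0) ler_pdivrMr // -ler_pdivrMl // mulrC.
Qed.

(** The factor [h] collects what converges: the scaled energy shift, [hermite
    m t / (2 t) ^+ m] and [- t sqrt c / k]. The rest is a power of [k] times
    the Gaussian. *)
Lemma band_expansion m p L : left_taylor (fun x => b x - b x_inf) x_inf p L ->
  exists2 h : R -> R,
    h k @[k --> +oo] --> c * ((-1) ^+ p * L / r ^+ p.+2) *
      ((2 / r) ^+ m.*2 / (2 / r) ^+ p.+1) / hermite_norm m &
    exists K : R, forall k, K <= k ->
      E m.+1 k - c * level m = k ^+ m.*2 / k ^+ p.+1 * expR (- t k ^+ 2) * h k.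
Proof.
move=> tay.
have small := scaled_time_small x_inf b_pos b_le.
pose X k := (E m.+1 k / c - level m) * (2 * - t k) ^+ p.+1 * hermite_norm m /
  hermite_fun m (t k) ^+ 2.
pose w k := - t k * r / k.
pose rho k := hermite m (t k) / (2 * t k) ^+ m.
have Xc : X k @[k --> +oo] --> (-1) ^+ p * L / r ^+ p.+2.
  apply: cvg_pinftyP => e e0.
  have [K hK] := band_left_taylor_asymptotics b_cont b_pos b_le b_right E_spec m tay e0.
  exists K => k /hK; rewrite /X; congr (`|_| <= _); congr (_ + _).
  by rewrite [(-1) ^+ p.+1]exprS !mulN1r !mulNr.
have wc : w k @[k --> +oo] --> (1 : R) by exact: momentum_ratio_cvg.
have rc : rho k @[k --> +oo] --> (1 : R) by exact: hermite_ratio_cvg.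
exists (fun k => c * X k * ((2 / r) ^+ m.*2 / (2 / r) ^+ p.+1) / hermite_norm m *
   (rho k ^+ 2 * (w k ^+ m.*2 * (w k ^+ p.+1)^-1))).
  rewrite -[X in _ --> X]mulr1; apply: cvgM.
    apply: cvgM; last exact: cvg_cst.
    apply: cvgM; last exact: cvg_cst.
    by apply: cvgM => //; exact: cvg_cst.
  have -> : (1 : R) = 1 ^+ 2 * (1 ^+ m.*2 * (1 ^+ p.+1)^-1) by rewrite !expr1n invr1 !mulr1.
  apply: cvgM; first exact: cvg_exprn.
  apply: cvgM; first exact: cvg_exprn.
  by apply: cvgV; [rewrite expr1n oner_neq0 | exact: cvg_exprn].
have [T T0 hT] := hermite_leading m (ltac:(lra) : (0 : R) < 1 / 2).
have [K hK] := small (- T); exists (Num.max 1 K) => k.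
rewrite ge_max => /andP[k1 /hK tT].
have kn : k != 0 by rewrite gt_eqF //; lra.
have cn : c != 0 by rewrite gt_eqF.
have tn : t k < 0 by lra.
have t2n : 2 * t k != 0 by rewrite mulf_neq0 // lt_eqF.
have Hn : hermite m (t k) != 0.
  apply/negP => /eqP H0; have := hT (t k); rewrite H0 sub0r normrN normrX.
  have : 0 < `|2 * t k| ^+ m by rewrite exprn_gt0 // normr_gt0.
  by move=> pw; rewrite (ltr0_norm tn) => /(_ ltac:(lra)); lra.
have Nn : hermite_norm m != 0 :> R by rewrite gt_eqF // hermite_norm_gt0.
have wn : w k != 0 by rewrite /w !mulf_neq0 ?invr_neq0 // oppr_eq0 lt_eqF.
have sr : 2 * - t k = 2 / r * w k * k by rewrite /w; field; rewrite rn kn.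
have s2 : ((2 * t k) ^+ m) ^+ 2 = (2 / r * w k * k) ^+ m.*2.
  by rewrite -sr -exprM muln2 mulrN -!muln2 !(mulnC m) !exprM sqrrN.
have g2 : expR (- (t k ^+ 2 / 2)) ^+ 2 = expR (- t k ^+ 2).
  by rewrite -expRM_natl; congr expR; rewrite -sqrrN; field.
have gn : expR (- t k ^+ 2) != 0 by rewrite gt_eqF // expR_gt0.
have split_pow Q : (2 / r * w k * k) ^+ Q = (2 / r) ^+ Q * w k ^+ Q * k ^+ Q.
  by rewrite exprMn [X in X * _ = _]exprMn.
have fun2 : hermite_fun m (t k) ^+ 2 = hermite m (t k) ^+ 2 * expR (- t k ^+ 2).
  by rewrite /hermite_fun exprMn g2.
have rho2 : rho k ^+ 2 = hermite m (t k) ^+ 2 / (2 / r * w k * k) ^+ m.*2.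
  by rewrite /rho expr_div_n s2.
rewrite /X fun2 rho2 sr !split_pow.
have q1 : (2 / r) ^+ m.*2 != 0 by rewrite expf_neq0 // mulf_neq0 ?invr_neq0.
have q2 : (2 / r) ^+ p.+1 != 0 by rewrite expf_neq0 // mulf_neq0 ?invr_neq0.
have q3 : w k ^+ m.*2 != 0 by rewrite expf_neq0.
have q4 : w k ^+ p.+1 != 0 by rewrite expf_neq0.
have q5 : k ^+ m.*2 != 0 by rewrite expf_neq0.
have q6 : k ^+ p.+1 != 0 by rewrite expf_neq0.
move: q1 q2 q3 q4 q5 q6 gn Hn Nn cn.
move: ((2 / r) ^+ m.*2) ((2 / r) ^+ p.+1) (w k ^+ m.*2) (w k ^+ p.+1) (k ^+ m.*2) (k ^+ p.+1).
move: (expR _) (hermite m _) (hermite_norm m) => g H n a1 a2 a3 a4 a5 a6 *.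
by field; do ?[apply/andP; split].
Qed.

End Expansion.
End BandExpansion.

(** * The constant of the expansion and the theorem *)

Section Constant.
Context {R : realType}.
Implicit Types (c k L : R) (m p : nat).

Lemma half_power c : 0 < c -> c `^ (1 / 2) = Num.sqrt c.
Proof. by move=> c0; rewrite div1r powR12_sqrt // ltW. Qed.

Lemma three_halves_power c m : 0 < c -> c `^ (m.+1%:R - 3 / 2) = c ^+ m / Num.sqrt c.
Proof.
move=> c0; have -> : m.+1%:R - 3 / 2 = m%:R - 2^-1 :> R by rewrite -natr1; field.
rewrite powRB; last by rewrite (gt_eqF c0) implybT.
by rewrite powR_mulrn ?powR12_sqrt // ltW.
Qed.

Lemma contact_power k m p : k != 0 ->
  k ^ (2 * m.+1%:Z - p%:Z - 3) = k ^+ m.*2 / k ^+ p.+1.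
Proof.
move=> kn; have -> : 2 * m.+1%:Z - p%:Z - 3 = m.*2%:Z + - p.+1%:Z by lia.
by rewrite expfzDr // -exprnN -exprnP.
Qed.

Lemma contact_constantE c m p L : 0 < c ->
  c * ((-1) ^+ p * L / Num.sqrt c ^+ p.+2) *
    ((2 / Num.sqrt c) ^+ m.*2 / (2 / Num.sqrt c) ^+ p.+1) / hermite_norm m =
  contact_constant m.+1 p c * L.
Proof.
move=> c0; have r0 : 0 < Num.sqrt c by rewrite sqrtr_gt0.
have rr : Num.sqrt c ^+ 2 = c by rewrite sqr_sqrtr // ltW.
rewrite /contact_constant /hermite_norm three_halves_power //=.
have -> : (2 : R) ^ (m.+1%:Z - p%:Z - 2) = 2 ^+ m / 2 ^+ p.+1.
  have -> : m.+1%:Z - p%:Z - 2 = m%:Z + - p.+1%:Z by lia.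
  by rewrite expfzDr ?pnatr_eq0 // -exprnN -exprnP.
have cm : c ^+ m = Num.sqrt c ^+ m.*2 by rewrite -{1}rr -exprM mul2n.
have pn : Num.sqrt pi != 0 :> R by rewrite gt_eqF // sqrtr_gt0 pi_gt0.
have fn : m`!%:R != 0 :> R by rewrite pnatr_eq0 -lt0n fact_gt0.
have tn Q : (2 : R) ^+ Q != 0 by rewrite expf_neq0 // pnatr_eq0.
rewrite cm !expr_div_n.
have -> : (2 : R) ^+ m.*2 = 2 ^+ m * 2 ^+ m by rewrite -addnn exprD.
have -> : Num.sqrt c ^+ p.+2 = Num.sqrt c * Num.sqrt c ^+ p.+1 by rewrite exprS.
rewrite -{1}rr; move: r0; set r := Num.sqrt c => r0.
have rn : r != 0 by rewrite gt_eqF.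
have rQ Q : r ^+ Q != 0 by rewrite expf_neq0.
have := tn m; have := tn p.+1; have := rQ m.*2; have := rQ p.+1.
move: ((2 : R) ^+ m) ((2 : R) ^+ p.+1) (r ^+ m.*2) (r ^+ p.+1) ((-1) ^+ p) => a1 a2 a3 a4 s h4 h3 h2 h1.
by field; do ?[apply/andP; split].
Qed.

End Constant.

Theorem theorem2p1 (R : realType) (b : R -> R) (bm bp x_inf : R)
    (E : nat -> R -> R) (n : nat)
    (b_pos : forall x : R, 0 < b x)
    (b_cont : continuous b)
    (b_incr : {homo b : x y / x <= y})
    (b_lim_m : b x @[x --> -oo] --> bm)
    (b_lim_p : b x @[x --> +oo] --> bp)
    (bm_pos : 0 < bm)
    (bm_lt_bp : bm < bp)
    (b_right : forall x : R, x_inf <= x -> b x = bp)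
    (b_left : forall x : R, x < x_inf -> b x < bp)
    (E_spec : forall k : R,
       is_eigenvalue_sequence (iwatsuka_potential b k) (fun m => E m k))
    (n_pos : (0 < n)%N) :
  let t (k : R) := (iwatsuka_a b x_inf - k) / bp `^ (1 / 2) in
  (forall p : nat, contact_of_order b x_inf p ->
     let g (k : R) := k ^ (2 * n%:Z - p%:Z - 3) * expR (- (t k ^+ 2)) in
     (fun k => E n k) =
       (fun k => bp * Landau_level R n
          + contact_constant n p bp * left_derivative_limit b p x_inf * g k)
       +o_ (pinfty_nbhs R) g)
  /\
  (contact_of_infinite_order b x_inf ->
     forall N : nat,
       (fun k => expR (t k ^+ 2) * (E n k - bp * Landau_level R n))
         =o_ (pinfty_nbhs R) (fun k : R => k ^- N)).

Proof.
move=> t.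
have b_le x : b x <= bp.
  by have [/b_left/ltW|/b_right->] := ltP x x_inf.
have bp0 : 0 < bp := lt_trans bm_pos bm_lt_bp.
have tE k : scaled_time b bp x_inf k = t k by rewrite /scaled_time /t half_power.
have bx : {for x_inf, continuous b} by exact: b_cont.
case: n n_pos => // m _.
have levelE : Landau_level R m.+1 = level m.
  by rewrite /Landau_level /level -[m.*2.+1%:R]natr1 -[m.+1%:R]natr1 -mul2n natrM; ring.
split.
- move=> p [p0 bd _ bcv [b0 _]].
  set L := left_derivative_limit b p x_inf; move=> g.
  have tay : left_taylor (fun x => b x - b x_inf) x_inf p L.
    apply: left_taylor_derivatives => //.
    + move=> j /andP[j0 jp]; have := bcv j; rewrite j0 (ltnW jp) => /(_ isT).
      by have := b0 j; rewrite /left_derivative_limit j0 jp => ->.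
    + by apply: bcv; rewrite p0 leqnn.
  have [h hc [K hK]] := band_expansion b_cont b_pos b_le b_right E_spec m tay.
  move: hc; rewrite contact_constantE // => hc.
  apply/eqaddoP => e e0.
  have [K2 [_ hK2]] := (cvgrPdist_le _ _).1 hc e e0.
  exists (Num.max 1 (Num.max K K2)); split; first exact: num_real.
  move=> k; rewrite !gt_max => /and3P[k1 /ltW kK /hK2 hk].
  have kn : k != 0 by rewrite gt_eqF //; lra.
  have gE : g k = k ^+ m.*2 / k ^+ p.+1 * expR (- t k ^+ 2) by rewrite /g contact_power.
  have := hK k kK; rewrite tE -gE levelE => Ek.
  rewrite fctE /=.
  have -> : E m.+1 k - (bp * level m + contact_constant m.+1 p bp * L * g k) =
    - (contact_constant m.+1 p bp * L - h k) * g k by move: Ek; lra.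
  by rewrite normrM normrN ler_wpM2r.
(* every order is possible with coefficient [0]; this [p] leaves [k ^- (N + 2)] *)
- move=> [bd bcv] N; set p := (m.*2 + N)%N.+1.
  have tay : left_taylor (fun x => b x - b x_inf) x_inf p 0.
    apply: left_taylor_derivatives => //.
    + by move=> j x _; exact: bd.
    + by move=> j /andP[j0 _]; exact: bcv.
    + exact: bcv.
  have [h hc [K hK]] := band_expansion b_cont b_pos b_le b_right E_spec m tay.
  move: hc; rewrite contact_constantE // mulr0 => hc.
  apply/eqoP => e e0.
  have [K2 [_ hK2]] := (cvgr0_norm_le _ hc) e e0.
  exists (Num.max 1 (Num.max K K2)); split; first exact: num_real.
  move=> k; rewrite !gt_max => /and3P[k1 /ltW kK /hK2 hk].
  have k0 : 0 < k by lra.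
  have := hK k kK; rewrite tE levelE => ->.
  have -> : expR (t k ^+ 2) * (k ^+ m.*2 / k ^+ p.+1 * expR (- t k ^+ 2) * h k) =
    k ^- N * (h k / k ^+ 2).
    have -> : p.+1 = (m.*2 + (N + 2))%N by rewrite /p; lia.
    rewrite expRN !exprD.
    have := @expR_gt0 R (t k ^+ 2); have := exprn_gt0 N k0; have := exprn_gt0 m.*2 k0.
    have := exprn_gt0 2 k0.
    move: (expR _) (k ^+ N) (k ^+ m.*2) => G a1 a2 h2 h3 h4 h5.
    by field; do ?[apply/andP; split]; rewrite gt_eqF.
  rewrite normrM mulrC ler_wpM2r // normrM.
  apply: le_trans hk; rewrite ler_piMr // normfV normrX (gtr0_norm k0) invf_le1 ?exprn_gt0 //.
  by rewrite exprn_ege1 // ltW.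
Qed.
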